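(* Let $\mu$ be a non-trivial $d\times d$ matrix measure on $\mathbb{T}$ with Schur function $f$, Verblunsky coefficients $(\alpha_i)_{i\ge0}$, iterates $f_i$, inverse iterates $b_i$ and CMV bases $(\chi_i)$, $(x_i)$. For integers $0\le j\le k$ let $\mu_{[j,k]}$ and $\hat\mu_{[j,k]}$ be the $(k-j+1)d\times(k-j+1)d$ matrix measures with $d\times d$ blocks $(\mu_{[j,k]})_{r,s}=\chi_r^\dagger\,d\mu\,\chi_s$ and $(\hat\mu_{[j,k]})_{r,s}=x_r^\dagger\,d\mu\,x_s$, $j\le r,s\le k$, and let $f_{[j,k]}$, $\hat f_{[j,k]}$ be their Schur functions. Then $$f_{[j,k]}=\begin{cases}(b_j\oplus\mathbb{1}_{k-j})\,\mathcal{C}_{(j,k)}^\dagger\,(\mathbb{1}_{k-j}\oplus f_k), & j,k\text{ even},\\ (\mathbb{1}_{k-j}\oplus f_k)\,\mathcal{C}_{(j,k)}^\dagger\,(b_j\oplus\mathbb{1}_{k-j}), & j,k\text{ odd},\\ (b_j\oplus\mathbb{1}_{k-j-1}\oplus f_k)\,\mathcal{C}_{(j,k)}^\dagger, & j\text{ even},\ k\text{ odd},\\ \mathcal{C}_{(j,k)}^\dagger\,(b_j\oplus\mathbb{1}_{k-j-1}\oplus f_k), & j\text{ odd},\ k\text{ even},\end{cases}$$ and $$\hat f_{[j,k]}=\begin{cases}(b_j\oplus\mathbb{1}_{k-j})\,\hat{\mathcal{C}}_{(j,k)}^\dagger\,(\mathbb{1}_{k-j}\oplus f_k), & j,k\text{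 odd},\\ (\mathbb{1}_{k-j}\oplus f_k)\,\hat{\mathcal{C}}_{(j,k)}^\dagger\,(b_j\oplus\mathbb{1}_{k-j}), & j,k\text{ even},\\ (b_j\oplus\mathbb{1}_{k-j-1}\oplus f_k)\,\hat{\mathcal{C}}_{(j,k)}^\dagger, & j\text{ odd},\ k\text{ even},\\ \hat{\mathcal{C}}_{(j,k)}^\dagger\,(b_j\oplus\mathbb{1}_{k-j-1}\oplus f_k), & j\text{ even},\ k\text{ odd}.\end{cases}$$ Equivalently, $f_{[j,k]}$ and $\hat f_{[j,k]}$ are obtained by substituting $-\alpha_{j-1}^\dagger\to b_j$ and $\alpha_k\to f_k$ in $\mathcal{C}_{[j,k]}^\dagger$ and $\hat{\mathcal{C}}_{[j,k]}^\dagger$ respectively, where $\mathcal{C}_{[j,k]},\hat{\mathcal{C}}_{[j,k]}$ are the principal $d$-block submatrices of the block CMV matrices of $\mu$ on block rows/columns $j,\dots,k$.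
   Context: Matrix measures, Schur functions, Schur algorithm, non-triviality, Verblunsky coefficients $\alpha_i$ ($\|\alpha_i\|<1$), iterates $f_i$ (Schur function with parameters $(\alpha_i,\alpha_{i+1},\dots)$) and inverse iterates $b_i$ (Schur function with parameters $(-\alpha_{i-1}^\dagger,\dots,-\alpha_0^\dagger,\mathbb{1})$, i.e. the unique Schur function whose matrix Schur algorithm $g_{m+1}(z)=z^{-1}(\rho_m^R)^{-1}(g_m-\beta_m)(\mathbb{1}-\beta_m^\dagger g_m)^{-1}\rho_m^L$, $\beta_m=g_m(0)$, produces these parameters and then terminates at $g_i\equiv\mathbb{1}$; $b_0\equiv\mathbb{1}$) are as follows: a matrix measure $\mu$ on $\mathbb{T}$ takes positive semidefinite $d\times d$ values with $\mu(\mathbb{T})=\mathbb{1}$; its Schur function is $f=z^{-1}(F-\mathbb{1})(F+\mathbb{1})^{-1}$ with $F(z)=\int\frac{t+z}{t-z}d\mu(t)$; $\mu$ is non-trivial if $\int\phi^\dagger d\mu\,\phi\ne0$ for all nonzero vector polynomials $\phi$, and then $f$ has infinitely many Schur parameters $\alpha_i$ with $\|\alpha_i\|<1$; $\rho_i^L=(\mathbb{1}-\alpha_i^\dagger\alpha_i)^{1/2}$, $\rho_i^R=(\mathbb{1}-\alpha_i\alpha_i^\dagger)^{1/2}$. Orthonormal polynomials $\varphi_i^{L},\varphi_i^R$: Gram–Schmidt of $\mathbb{1},z\mathbb{1},\dots$ w.r.t. $\langle\!\langle g|h\rangle\!\rangle_L=\int h\,d\mu\,g^\dagger$, resp. $\langle\!\langle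 g|h\rangle\!\rangle_R=\int g^\dagger d\mu\,h$, with $\varphi_0=\mathbb{1}$ and leading coefficients satisfying $\kappa_{i+1}^L(\kappa_i^L)^{-1}>0$, $(\kappa_i^R)^{-1}\kappa_{i+1}^R>0$. CMV bases: $\chi_{2m}(z)=z^m\varphi_{2m}^L(1/\bar z)^\dagger$, $\chi_{2m+1}(z)=z^{-m}\varphi_{2m+1}^R(z)$, $x_{2m}(z)=z^{-m}\varphi_{2m}^R(z)$, $x_{2m+1}(z)=z^m\varphi_{2m+1}^L(1/\bar z)^\dagger$ (here $p^\dagger(z^{-1})$ means the polynomial with adjoint coefficients evaluated at $z^{-1}$). With $\Theta(\alpha)=\begin{pmatrix}\alpha^\dagger&\rho^L\\ \rho^R&-\alpha\end{pmatrix}$, the block CMV matrices of $\mu$ are $\mathcal{C}=\mathcal{L}\mathcal{M}$, $\hat{\mathcal{C}}=\mathcal{M}\mathcal{L}$ with $\mathcal{L}=\Theta(\alpha_0)\oplus\Theta(\alpha_2)\oplus\cdots$, $\mathcal{M}=\mathbb{1}\oplus\Theta(\alpha_1)\oplus\Theta(\alpha_3)\oplus\cdots$. Finite block CMV matrices for $(\beta_0,\dots,\beta_{N-1})$: $\mathcal{C}_N=\mathcal{L}_N\mathcal{M}_N$, $\hat{\mathcal{C}}_N=\mathcal{M}_N\mathcal{L}_N$ (order $(N+1)d$), where for odd $N$ $\mathcal{L}_N=\Theta(\beta_0)\oplus\Theta(\beta_2)\oplus\cdots\oplus\Theta(\beta_{N-1})$, $\mathcal{M}_N=\mathbb{1}\oplus\Theta(\beta_1)\oplus\cdots\oplus\Theta(\beta_{N-2})\oplus\mathbb{1}$,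 and for even $N$ $\mathcal{L}_N=\Theta(\beta_0)\oplus\cdots\oplus\Theta(\beta_{N-2})\oplus\mathbb{1}$, $\mathcal{M}_N=\mathbb{1}\oplus\Theta(\beta_1)\oplus\cdots\oplus\Theta(\beta_{N-1})$; $\mathcal{C}_0=\hat{\mathcal C}_0=\mathbb{1}$. The unitary truncations are: $\mathcal{C}_{(j,k)}=\mathcal{C}_{k-j}(\alpha_j,\dots,\alpha_{k-1})$ and $\hat{\mathcal{C}}_{(j,k)}=\hat{\mathcal{C}}_{k-j}(\alpha_j,\dots,\alpha_{k-1})$ for even $j$; $\mathcal{C}_{(j,k)}=\hat{\mathcal{C}}_{k-j}(\alpha_j,\dots,\alpha_{k-1})$ and $\hat{\mathcal{C}}_{(j,k)}=\mathcal{C}_{k-j}(\alpha_j,\dots,\alpha_{k-1})$ for odd $j$. $\mathbb{1}_m$ denotes the $md\times md$ identity ($\mathbb{1}_0$ absent), and direct sums are block diagonal. *)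

(* Defs.v *)
From HB Require Import structures.
From mathcomp Require Import all_boot all_order all_algebra.
From mathcomp Require Import all_classical all_reals all_analysis.
From mathcomp Require Import complex.
From Stdlib Require ClassicalEpsilon.
Set Implicit Arguments. Unset Strict Implicit. Unset Printing Implicit Defensive.
Import Order.TTheory GRing.Theory Num.Theory.
Local Open Scope ring_scope.
Local Open Scope classical_set_scope.

Definition the_one {A : Type} (x0 : A) (P : A -> Prop) : A :=
  ClassicalEpsilon.epsilon (inhabits x0) P.

Definition adjm {R : realType} {m n : nat} (A : 'M[R[i]]_(m, n)) : 'M[R[i]]_(n, m) :=
  (map_mx (@conjc R) A)^T.

Definition psdm {R : realType} {n : nat} (A : 'M[R[i]]_n) : Prop :=
  adjm A = A /\ forall v : 'cV[R[i]]_n, 0 <= (adjm v *m A *m v) 0 0.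
Definition pdm {R : realType} {n : nat} (A : 'M[R[i]]_n) : Prop :=
  adjm A = A /\ forall v : 'cV[R[i]]_n, v != 0 -> 0 < (adjm v *m A *m v) 0 0.

Definition sqrtm {R : realType} {n : nat} (A : 'M[R[i]]_n) : 'M[R[i]]_n :=
  the_one 0 (fun S => psdm S /\ S *m S = A).

Definition rhoL {R : realType} {d : nat} (a : 'M[R[i]]_d) : 'M[R[i]]_d :=
  sqrtm (1%:M - adjm a *m a).
Definition rhoR {R : realType} {d : nat} (a : 'M[R[i]]_d) : 'M[R[i]]_d :=
  sqrtm (1%:M - a *m adjm a).

Definition has_limz {R : realType} {m n : nat} (h : R[i] -> 'M[R[i]]_(m, n))
  (z0 : R[i]) (L : 'M[R[i]]_(m, n)) : Prop :=
  forall e : R, 0 < e -> exists2 del : R, 0 < del &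
    forall w : R[i], w != z0 -> `|w - z0| < (del%:C)%C ->
      forall a b, `|h w a b - L a b| < (e%:C)%C.

Definition limz {R : realType} {m n : nat} (h : R[i] -> 'M[R[i]]_(m, n))
  (z0 : R[i]) : 'M[R[i]]_(m, n) := the_one 0 (has_limz h z0).

Definition extend0 {R : realType} {m n : nat} (h : R[i] -> 'M[R[i]]_(m, n))
  : R[i] -> 'M[R[i]]_(m, n) :=
  fun z => if z == 0 then limz h 0 else h z.

Definition blk {R : realType} (n d : nat) (B : nat -> nat -> 'M[R[i]]_d)
  : 'M[R[i]]_(n * d) :=
  castmx (mxvec_cast n d, mxvec_cast n d)
    (\matrix_(p, q) let x := (enum_val p : 'I_n * 'I_d) in
                    let y := (enum_val q : 'I_n * 'I_d) in
                    B (nat_of_ord x.1) (nat_of_ord y.1) x.2 y.2).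
Arguments blk {R} n d B.

Definition dsum {R : realType} (n d : nat) (D : nat -> 'M[R[i]]_d) : 'M[R[i]]_(n * d) :=
  blk n d (fun r s => if r == s then D r else 0).
Arguments dsum {R} n d D.

(* Theta(a) = [[a^dag, rhoL], [rhoR, -a]], entry (p, q) with p, q : bool (0/1) *)
Definition Theta {R : realType} {d : nat} (a : 'M[R[i]]_d) (p q : bool) : 'M[R[i]]_d :=
  if ~~ p then (if ~~ q then adjm a else rhoL a)
  else (if ~~ q then rhoR a else - a).

(* block (r, s), 0 <= r, s <= N, of
     off = 0 : Theta(b_0) (+) Theta(b_2) (+) ...   (padded with 1 at the end)
     off = 1 : 1 (+) Theta(b_1) (+) Theta(b_3) (+) ... (padded with 1 at the end) *)
Definition pairblk {R : realType} {d : nat} (off N : nat) (beta : nat -> 'M[R[i]]_d)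
  (r s : nat) : 'M[R[i]]_d :=
  if [&& (off <= r)%N, (off <= s)%N, ((r - off)./2 == (s - off)./2)%N &
         (((r - off)./2).*2 + off).+1 <= N]%N
  then Theta (beta (((r - off)./2).*2 + off)%N) (odd (r - off)) (odd (s - off))
  else if r == s then 1%:M else 0.
Arguments pairblk {R d} off N beta r s.

Definition Lmat {R : realType} (d N : nat) (beta : nat -> 'M[R[i]]_d) : 'M[R[i]]_(N.+1 * d) :=
  blk N.+1 d (pairblk 0 N beta).
Arguments Lmat {R d} N beta.
Definition Mmat {R : realType} (d N : nat) (beta : nat -> 'M[R[i]]_d) : 'M[R[i]]_(N.+1 * d) :=
  blk N.+1 d (pairblk 1 N beta).
Arguments Mmat {R d} N beta.

Definition CMVfin {R : realType} (d N : nat) (beta : nat -> 'M[R[i]]_d) : 'M[R[i]]_(N.+1 * d) :=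
  Lmat N beta *m Mmat N beta.
Arguments CMVfin {R d} N beta.
Definition CMVhatfin {R : realType} (d N : nat) (beta : nat -> 'M[R[i]]_d) : 'M[R[i]]_(N.+1 * d) :=
  Mmat N beta *m Lmat N beta.
Arguments CMVhatfin {R d} N beta.

Definition CMVtr {R : realType} (d : nat) (alpha : nat -> 'M[R[i]]_d) (j k : nat)
  : 'M[R[i]]_((k - j).+1 * d) :=
  if odd j then CMVhatfin (k - j) (fun i => alpha (j + i)%N)
  else CMVfin (k - j) (fun i => alpha (j + i)%N).
Arguments CMVtr {R d} alpha j k.
Definition CMVhattr {R : realType} (d : nat) (alpha : nat -> 'M[R[i]]_d) (j k : nat)
  : 'M[R[i]]_((k - j).+1 * d) :=
  if odd j then CMVfin (k - j) (fun i => alpha (j + i)%N)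
  else CMVhatfin (k - j) (fun i => alpha (j + i)%N).
Arguments CMVhattr {R d} alpha j k.

(* T is parametrized by theta in [0, 2pi), t = e^{i theta}.  A d x d matrix
   measure is represented as  d mu = W d nu  with nu a (positive) measure on
   [0, 2pi) and W a PSD-valued nu-integrable density. *)

Definition eit {R : realType} (th : R) : R[i] := (cos th +i* sin th)%C.

Definition Tset {R : realType} : set R := `[0, 2 * pi[.

Definition mint {R : realType} (nu : {measure set R -> \bar R}) {m n : nat}
  (F : R -> 'M[R[i]]_(m, n)) : 'M[R[i]]_(m, n) :=
  \matrix_(a, b) ((Rintegral nu Tset (fun th => complex.Re (F th a b)))
                  +i* (Rintegral nu Tset (fun th => complex.Im (F th a b))))%C.

Definition is_mxmeasure {R : realType} {d : nat} (nu : {measure set R -> \bar R})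
  (W : R -> 'M[R[i]]_d) : Prop :=
  [/\ forall th, Tset th -> psdm (W th),
      forall a b, nu.-integrable Tset (fun th => (complex.Re (W th a b))%:E)
               /\ nu.-integrable Tset (fun th => (complex.Im (W th a b))%:E)
    & mint nu W = 1%:M ].

Definition peval {R : realType} {m n : nat} (P : 'M[{poly R[i]}]_(m, n)) (t : R[i])
  : 'M[R[i]]_(m, n) := map_mx (fun p => p.[t]) P.
Definition coefm {R : realType} {m n : nat} (P : 'M[{poly R[i]}]_(m, n)) (k : nat)
  : 'M[R[i]]_(m, n) := map_mx (fun p : {poly R[i]} => p`_k) P.
Definition degle {R : realType} {m n : nat} (P : 'M[{poly R[i]}]_(m, n)) (k : nat) : Prop :=
  forall a b, (size (P a b) <= k.+1)%N.

Definition nontrivial {R : realType} {d : nat} (nu : {measure set R -> \bar R})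
  (W : R -> 'M[R[i]]_d) : Prop :=
  forall phi : 'cV[{poly R[i]}]_d, phi != 0 ->
    mint nu (fun th => adjm (peval phi (eit th)) *m W th *m peval phi (eit th)) != 0.

Definition ipR {R : realType} {d : nat} (nu : {measure set R -> \bar R})
  (W : R -> 'M[R[i]]_d) (P Q : 'M[{poly R[i]}]_d) : 'M[R[i]]_d :=
  mint nu (fun th => adjm (peval P (eit th)) *m W th *m peval Q (eit th)).
Definition ipL {R : realType} {d : nat} (nu : {measure set R -> \bar R})
  (W : R -> 'M[R[i]]_d) (P Q : 'M[{poly R[i]}]_d) : 'M[R[i]]_d :=
  mint nu (fun th => peval Q (eit th) *m W th *m adjm (peval P (eit th))).

(* Gram-Schmidt of 1, z1, z^2 1, ... : phi_0 = 1, deg phi_n <= n, orthonormal,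
   with the normalization of the leading coefficients kappa_n *)
Definition is_onpR {R : realType} {d : nat} (nu : {measure set R -> \bar R})
  (W : R -> 'M[R[i]]_d) (phi : nat -> 'M[{poly R[i]}]_d) : Prop :=
  [/\ phi 0%N = 1%:M, forall n, degle (phi n) n,
      forall m n, ipR nu W (phi m) (phi n) = if m == n then 1%:M else 0
    & forall n, pdm (invmx (coefm (phi n) n) *m coefm (phi n.+1) n.+1)].
Definition is_onpL {R : realType} {d : nat} (nu : {measure set R -> \bar R})
  (W : R -> 'M[R[i]]_d) (phi : nat -> 'M[{poly R[i]}]_d) : Prop :=
  [/\ phi 0%N = 1%:M, forall n, degle (phi n) n,
      forall m n, ipL nu W (phi m) (phi n) = if m == n then 1%:M else 0
    & forall n, pdm (coefm (phi n.+1) n.+1 *m invmx (coefm (phi n) n))].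

Definition phiR {R : realType} {d : nat} (nu : {measure set R -> \bar R})
  (W : R -> 'M[R[i]]_d) : nat -> 'M[{poly R[i]}]_d :=
  the_one (fun _ => 0) (is_onpR nu W).
Definition phiL {R : realType} {d : nat} (nu : {measure set R -> \bar R})
  (W : R -> 'M[R[i]]_d) : nat -> 'M[{poly R[i]}]_d :=
  the_one (fun _ => 0) (is_onpL nu W).

Definition chi {R : realType} {d : nat} (nu : {measure set R -> \bar R})
  (W : R -> 'M[R[i]]_d) (n : nat) (t : R[i]) : 'M[R[i]]_d :=
  if odd n then t ^- n./2 *: peval (phiR nu W n) t
  else t ^+ n./2 *: adjm (peval (phiL nu W n) ((conjc t)^-1)).
Definition xcmv {R : realType} {d : nat} (nu : {measure set R -> \bar R})
  (W : R -> 'M[R[i]]_d) (n : nat) (t : R[i]) : 'M[R[i]]_d :=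
  if odd n then t ^+ n./2 *: adjm (peval (phiL nu W n) ((conjc t)^-1))
  else t ^- n./2 *: peval (phiR nu W n) t.

(* densities of mu_[j,k] and hat mu_[j,k] (w.r.t. the same nu):
   blocks chi_r^dag W chi_s, resp. x_r^dag W x_s, j <= r, s <= k *)
Definition W_jk {R : realType} {d : nat} (nu : {measure set R -> \bar R})
  (W : R -> 'M[R[i]]_d) (j k : nat) (th : R) : 'M[R[i]]_((k - j).+1 * d) :=
  blk (k - j).+1 d (fun r s => adjm (chi nu W (j + r) (eit th)) *m W th
                                   *m chi nu W (j + s) (eit th)).
Arguments W_jk {R d} nu W j k th.
Definition What_jk {R : realType} {d : nat} (nu : {measure set R -> \bar R})
  (W : R -> 'M[R[i]]_d) (j k : nat) (th : R) : 'M[R[i]]_((k - j).+1 * d) :=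
  blk (k - j).+1 d (fun r s => adjm (xcmv nu W (j + r) (eit th)) *m W th
                                   *m xcmv nu W (j + s) (eit th)).
Arguments What_jk {R d} nu W j k th.

Definition caraF {R : realType} {d : nat} (nu : {measure set R -> \bar R})
  (W : R -> 'M[R[i]]_d) (z : R[i]) : 'M[R[i]]_d :=
  mint nu (fun th => ((eit th + z) / (eit th - z)) *: W th).

Definition schur_fun {R : realType} {d : nat} (nu : {measure set R -> \bar R})
  (W : R -> 'M[R[i]]_d) : R[i] -> 'M[R[i]]_d :=
  extend0 (fun z => z^-1 *: ((caraF nu W z - 1%:M) *m invmx (caraF nu W z + 1%:M))).

Definition schur_step {R : realType} {d : nat} (g : R[i] -> 'M[R[i]]_d)
  : R[i] -> 'M[R[i]]_d :=
  let a := g 0 in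
  extend0 (fun z => z^-1 *: (invmx (rhoR a) *m (g z - a)
                             *m invmx (1%:M - adjm a *m g z) *m rhoL a)).

Definition schur_iter {R : realType} {d : nat} (g : R[i] -> 'M[R[i]]_d) (n : nat)
  : R[i] -> 'M[R[i]]_d := iter n schur_step g.

Definition verb {R : realType} {d : nat} (f : R[i] -> 'M[R[i]]_d) (n : nat) : 'M[R[i]]_d :=
  schur_iter f n 0.

Definition is_schur {R : realType} {d : nat} (g : R[i] -> 'M[R[i]]_d) : Prop :=
  forall z : R[i], `|z| < 1 ->
    psdm (1%:M - adjm (g z) *m g z) /\
    exists L, has_limz (fun w => (w - z)^-1 *: (g w - g z)) z L.

(* inverse iterate b_n: the Schur function with parameters
   (-alpha_{n-1}^dag, ..., -alpha_0^dag, 1), i.e. whose Schur algorithm yields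
   these parameters and terminates at g_n == 1 *)
Definition schur_inv_iter {R : realType} {d : nat} (f : R[i] -> 'M[R[i]]_d) (n : nat)
  : R[i] -> 'M[R[i]]_d :=
  the_one (fun _ => 0) (fun g =>
    [/\ is_schur g,
        forall m, (m < n)%N -> verb g m = - adjm (verb f (n - 1 - m)%N)
      & forall z : R[i], `|z| < 1 -> schur_iter g n z = 1%:M]).

(* Main.v *)
(* Write phi_n for the right orthonormal polynomials, phi*_n for the reversed
   left ones, and <X, A>_z for the integral of X^* dmu A / (t - z).  The pair
   (phi_n, phi*_n) obeys the Szego recursion, which turns
   <phi_n, 1>_z = f_n(z) <phi*_n, t>_z into the same identity for n + 1; this is
   one step of the Schur algorithm, and letting z -> 0 identifies the Szego
   coefficients with the Schur parameters.  By orthogonality, 1 may be replaced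
   by any polynomial A of degree at most n.  Run from n = 0 upwards, the same
   recursion gives <phi*_j, A>_z = b_j(z) <phi_j, A>_z when A is orthogonal to
   t, ..., t^j.

   In the CMV bases chi and x the recursion says that multiplication by t
   factors through the matrices L and M.  The two identities above close the
   truncation to the indices j, ..., k: at the ends, an unpaired index is
   multiplied by b_j or f_k.  With G and H the matrices of
   <chi_r, chi_s>_z and <chi_r, t chi_s>_z = delta_rs + z G_rs, this reads
   G = X H with X the claimed product, and the Schur function is G H^-1. *)

Require Import Defs.
From HB Require Import structures.
From mathcomp Require Import all_boot all_order all_algebra.
From mathcomp Require Import all_classical all_reals all_analysis.
From mathcomp Require Import measurable_realfun.
From mathcomp Require Import complex.
From mathcomp Require Import ring zify.
Import Order.TTheory GRing.Theory Num.Theory.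
Local Open Scope ring_scope.
Set Implicit Arguments. Unset Strict Implicit. Unset Printing Implicit Defensive.

(** * Adjoints, positive matrices and square roots *)

Section AdjointMatrices.
Variable R : realType.
Local Notation C := R[i].

(** Three features of the definitions shape the proof: values at 0 are limits, square roots and
    inverse iterates are choices, and [invmx] is total. Identities in [z] are therefore proved on
    the punctured disc and carried to 0 by continuity, and every inverse needs an invertibility
    argument.

    The Szego coefficients start as unnamed matrices [g n]. Since a Schur step divides by [z] after
    subtracting the value at 0, the bracket identity for [f_n] must first yield its limit [g n] at 0
    before the step to [f_(n+1)] can be computed. The brackets are bounded for [|z| <= 1/2], and
    this gives the limit by a direct estimate.

    The inverse iterates are built explicitly as rational functions [binv], regular on the closed
    disc. Their unitary value at [z = 1] shows that their determinants vanish at finitely many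
    points only, which is what the comparison with an arbitrary solution of the specification rests
    on.

    The eight cases of the theorem reduce to one product of two layers: each end factor commutes
    with the layer that leaves its index unpaired, so its position in the product is a matter of
    parity. *)

Lemma adjmE m n (A : 'M[C]_(m, n)) i j : adjm A i j = conjc (A j i).
Proof. by rewrite !mxE. Qed.

Lemma adjmK m n (A : 'M[C]_(m, n)) : adjm (adjm A) = A.
Proof. by apply/matrixP=> i j; rewrite !adjmE conjcK. Qed.

Lemma adjmM m n p (A : 'M[C]_(m, n)) (B : 'M[C]_(n, p)) :
  adjm (A *m B) = adjm B *m adjm A.
Proof. by rewrite /adjm map_mxM trmx_mul. Qed.

Lemma adjmD m n (A B : 'M[C]_(m, n)) : adjm (A + B) = adjm A + adjm B.
Proof. by rewrite /adjm map_mxD linearD. Qed.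

Lemma adjmN m n (A : 'M[C]_(m, n)) : adjm (- A) = - adjm A.
Proof. by rewrite /adjm map_mxN linearN. Qed.

Lemma adjmB m n (A B : 'M[C]_(m, n)) : adjm (A - B) = adjm A - adjm B.
Proof. by rewrite adjmD adjmN. Qed.

Lemma adjm0 m n : adjm (0 : 'M[C]_(m, n)) = 0.
Proof. by apply/matrixP=> i j; rewrite adjmE !mxE conjc0. Qed.

Lemma adjmZ m n (c : C) (A : 'M[C]_(m, n)) : adjm (c *: A) = conjc c *: adjm A.
Proof. by apply/matrixP=> i j; rewrite !(adjmE, mxE) rmorphM. Qed.

Lemma adjm1 n : adjm (1%:M : 'M[C]_n) = 1%:M.
Proof. by apply/matrixP=> i j; rewrite !(adjmE, mxE) eq_sym rmorph_nat. Qed.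

Lemma adjm_sum m n I (r : seq I) (P : pred I) (F : I -> 'M[C]_(m, n)) :
  adjm (\sum_(i <- r | P i) F i) = \sum_(i <- r | P i) adjm (F i).
Proof.
by elim/big_rec2: _ => [|i _ y _ <-]; rewrite ?adjm0 ?adjmD.
Qed.

Lemma adjmV n (A : 'M[C]_n) : adjm (invmx A) = invmx (adjm A).
Proof. by rewrite /adjm map_invmx trmx_inv. Qed.

Lemma mulmx1_invmx n (A B : 'M[C]_n) : A *m B = 1%:M -> invmx A = B.
Proof.
move=> AB; have [Au _] := mulmx1_unit AB.
by rewrite -[LHS]mulmx1 -AB mulKmx.
Qed.

Lemma unitmx_inj n (A : 'M[C]_n) :
  (forall v : 'cV[C]_n, A *m v = 0 -> v = 0) -> A \in unitmx.
Proof.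
move=> Ainj; rewrite -unitmx_tr unitmxE unitfE; apply/det0P => -[v v0 vA].
move/eqP: v0; apply; apply: trmx_inj; rewrite trmx0; apply: Ainj.
by apply: trmx_inj; rewrite trmx_mul trmxK vA trmx0.
Qed.

Definition sqn m (v : 'cV[C]_m) : C := (adjm v *m v) 0 0.

Lemma sqnE m (v : 'cV[C]_m) : sqn v = \sum_i `|v i 0| ^+ 2.
Proof. by rewrite /sqn mxE; apply: eq_bigr => i _; rewrite adjmE mulrC -sqr_normc. Qed.

Lemma sqn_ge0 m (v : 'cV[C]_m) : 0 <= sqn v.
Proof. by rewrite sqnE sumr_ge0 // => i _; rewrite exprn_ge0. Qed.

Lemma sqn_eq0 m (v : 'cV[C]_m) : sqn v = 0 -> v = 0.
Proof.
rewrite sqnE => /eqP; rewrite psumr_eq0; last by move=> i _; rewrite exprn_ge0.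
move=> /allP v0; apply/matrixP => i j; rewrite ord1 mxE; apply/eqP.
by have := v0 i (mem_index_enum _); rewrite /= expf_eq0 /= normr_eq0.
Qed.

Lemma sqn0 m : sqn (0 : 'cV[C]_m) = 0.
Proof. by rewrite /sqn mulmx0 mxE. Qed.

Lemma sqnZ m (c : C) (v : 'cV[C]_m) : sqn (c *: v) = `|c| ^+ 2 * sqn v.
Proof.
by rewrite !sqnE mulr_sumr; apply: eq_bigr => i _; rewrite mxE normrM exprMn.
Qed.

Lemma pdm_psdm n (A : 'M[C]_n) : pdm A -> psdm A.
Proof.
case=> hA pA; split=> // v; have [->|/pA/ltW//] := eqVneq v 0.
by rewrite mulmx0 mxE.
Qed.

Lemma pdm_unit n (A : 'M[C]_n) : pdm A -> A \in unitmx.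
Proof.
case=> hA pA; apply: unitmx_inj => v Av; apply/eqP; apply: contraT => /pA.
by rewrite -mulmxA Av mulmx0 mxE ltxx.
Qed.

Lemma pdm_congr n (A K : 'M[C]_n) : K \in unitmx -> pdm A -> pdm (adjm K *m A *m K).
Proof.
move=> Ku [hA pA]; split=> [|v v0]; first by rewrite !adjmM adjmK hA mulmxA.
rewrite !mulmxA -adjmM -mulmxA; apply: pA.
by apply: contraNneq v0 => Kv; rewrite -(mulKmx Ku v) Kv mulmx0.
Qed.

Lemma pdm_inv n (A : 'M[C]_n) : pdm A -> pdm (invmx A).
Proof.
move=> pA; have Au := pdm_unit pA.
have := @pdm_congr _ A (invmx A); rewrite unitmx_inv => /(_ Au pA).
by rewrite adjmV (proj1 pA) (mulVmx Au) mul1mx.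
Qed.

Lemma quad_colE m n (A : 'M[C]_m) (X : 'M[C]_(m, n)) i :
  (adjm (col i X) *m A *m col i X) 0 0 = (adjm X *m A *m X) i i.
Proof.
rewrite !mxE; apply: eq_bigr => j _; rewrite !mxE; congr (_ * _).
by apply: eq_bigr => l _; rewrite !mxE.
Qed.

Lemma psdm_mxtrace_ge0 m n (A : 'M[C]_m) (X : 'M[C]_(m, n)) :
  psdm A -> 0 <= \tr (adjm X *m A *m X).
Proof. by case=> _ pA; rewrite /mxtrace sumr_ge0 // => i _; rewrite -quad_colE. Qed.

(* [tr (X^* S X)] and [tr (X T X^* )] are nonnegative with zero sum. *)
Lemma sylvester_eq0 n (S T X : 'M[C]_n) :
  pdm S -> psdm T -> S *m X + X *m T = 0 -> X = 0.
Proof.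
move=> pS pT SX.
have tX : \tr (adjm X *m S *m X) = 0.
  have h : \tr (adjm X *m S *m X) + \tr (adjm (adjm X) *m T *m adjm X) = 0.
    rewrite adjmK [X in _ + X]mxtrace_mulC -mulmxA -mxtraceD -mulmxDr SX.
    by rewrite mulmx0 mxtrace0.
  apply/eqP; move/eqP: h; rewrite paddr_eq0 ?psdm_mxtrace_ge0 //; last exact: pdm_psdm.
  by case/andP.
have colX i : col i X = 0.
  apply/eqP; apply: contraT => /(proj2 pS).
  suff -> : (adjm (col i X) *m S *m col i X) 0 0 = 0 by rewrite ltxx.
  move/eqP: tX; rewrite /mxtrace psumr_eq0 => [/allP h|l _].
    by rewrite quad_colE; apply/eqP/h; rewrite mem_index_enum.
  by rewrite -quad_colE; apply: (proj2 (pdm_psdm pS)).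
by apply/matrixP => a b; have /matrixP /(_ a 0) := colX b; rewrite !mxE.
Qed.

(** [sqrtm] is a choice among psd roots. Two roots [S], [T] of [A] satisfy
    [S (S - T) + (S - T) T = 0], a Sylvester equation, and definiteness of [S] forces [S = T]. *)
Lemma sqrtmE n (A S : 'M[C]_n) : pdm S -> S *m S = A -> sqrtm A = S.
Proof.
move=> pS SA; have := ClassicalEpsilon.epsilon_spec (inhabits 0)
  (fun S => psdm S /\ S *m S = A) (ex_intro _ S (conj (pdm_psdm pS) SA)).
rewrite -/(the_one 0 (fun S => psdm S /\ S *m S = A)) -/(sqrtm A).
case=> pT TA; apply/esym/eqP; rewrite -subr_eq0; apply/eqP.
apply: sylvester_eq0 pS pT _.
by rewrite mulmxBr mulmxBl SA TA addrA subrK subrr.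
Qed.

Lemma pdm_sqrt_exists n (A : 'M[C]_n) : pdm A -> exists2 S, pdm S & S *m S = A.
Proof.
move=> pA; have hA := proj1 pA.
have tE (M : 'M[C]_n) : map_mx Num.conj M^T = adjm M.
  by apply/matrixP => i j; rewrite adjmE !mxE.
have nA : A \is normalmx by apply/normalmxP; rewrite tE hA.
have := orthomx_spectralP nA.
set P := spectralmx A; set D := spectral_diag A => AE.
have Pu : P \in unitmx by apply: spectral_unit.
have PV : invmx P = adjm P by rewrite invmx_unitary ?spectral_unitarymx ?tE.
(* The eigenvalue [D 0 i] is the value of the form of [A] at the unit eigenvector
   [adjm P *m delta_mx i 0]. *)
have Dpos i : 0 < D 0 i.
  have nz : adjm P *m (delta_mx i 0 : 'cV[C]_n) != 0.
    apply/negP => /eqP /(congr1 (mulmx P)); rewrite -PV mulKVmx // mulmx0.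
    by move/matrixP/(_ i 0)/eqP; rewrite !mxE !eqxx oner_eq0.
  have := (proj2 pA) _ nz.
  rewrite {1}AE adjmM adjmK !mulmxA -PV !mulmxK //.
  have -> : adjm (delta_mx i 0 : 'cV[C]_n) = delta_mx 0 i.
    by apply/matrixP => a b; rewrite adjmE !mxE rmorph_nat andbC.
  by rewrite -colE mxE -rowE !mxE eqxx mulr1n.
pose E : 'rV[C]_n := \row_i sqrtC (D 0 i).
have ED : diag_mx E *m diag_mx E = diag_mx D.
  rewrite mulmx_diag; congr diag_mx; apply/rowP => i.
  by rewrite !mxE -expr2 sqrtCK.
have pE : pdm (diag_mx E).
  have Epos i : 0 < E 0 i by rewrite mxE sqrtC_gt0.
  split=> [|v v0].
    apply/matrixP => a b; rewrite adjmE !mxE eq_sym.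
    case: eqP => [->|_]; last by rewrite !mulr0n conjc0.
    rewrite !mulr1n; have := ltW (Epos b); rewrite mxE.
    case: (sqrtC _) => x y; rewrite lecE => /andP[/eqP /= y0 _].
    by rewrite y0 oppr0.
  rewrite mxE (eq_bigr (fun i => E 0 i * `|v i 0| ^+ 2)) => [|i _]; last first.
    rewrite mul_mx_diag mxE adjmE [_^*%C * _]mulrC -mulrA [_^*%C * _]mulrC.
    by rewrite -sqr_normc.
  rewrite lt_neqAle sumr_ge0 => [|i _]; last by rewrite mulr_ge0 ?exprn_ge0 // ltW.
  rewrite andbT eq_sym; apply: contra v0.
  rewrite psumr_eq0 => [/allP h|i _]; last by rewrite mulr_ge0 ?exprn_ge0 // ltW.
  apply/eqP/matrixP => i l; rewrite ord1 [RHS]mxE.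
  have := h i (mem_index_enum _).
  by rewrite /= mulf_eq0 (gt_eqF (Epos i)) expf_eq0 normr_eq0 => /eqP.
exists (adjm P *m diag_mx E *m P); first exact: pdm_congr.
by rewrite AE -PV -ED !mulmxA (mulmxK Pu).
Qed.

End AdjointMatrices.

(** * Integration against the matrix measure *)

Section ComplexIntegral.
Import numFieldNormedType.Exports.
Variable R : realType.
Local Notation C := R[i].
Local Notation Re := complex.Re.
Local Notation Im := complex.Im.

Lemma ReD (x y : C) : Re (x + y) = Re x + Re y. Proof. by case: x; case: y. Qed.
Lemma ImD (x y : C) : Im (x + y) = Im x + Im y. Proof. by case: x; case: y. Qed.
Lemma ReM (x y : C) : Re (x * y) = Re x * Re y - Im x * Im y.
Proof. by case: x; case: y. Qed.
Lemma ImM (x y : C) : Im (x * y) = Re x * Im y + Im x * Re y.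
Proof. by case: x; case: y. Qed.
Lemma Re_conj (x : C) : Re (conjc x) = Re x. Proof. by case: x. Qed.
Lemma Im_conj (x : C) : Im (conjc x) = - Im x. Proof. by case: x. Qed.

Lemma eq_ReIm (x y : C) : Re x = Re y -> Im x = Im y -> x = y.
Proof. by case: x => a b; case: y => c d /= -> ->. Qed.

Lemma normc_ge_Im (x : C) : `|Im x|%:C%C <= `|x|.
Proof.
by case: x => a b; rewrite normc_def /= lecR -sqrtr_sqr ler_wsqrtr // lerDr sqr_ge0.
Qed.

Lemma normc_le_ReIm (x : C) : `|x| <= (`|Re x| + `|Im x|)%:C%C.
Proof.
rewrite {1}[x]complexE; apply: le_trans (ler_normD _ _) _.
rewrite rmorphD lerD //; first by rewrite normc_def /= expr0n addr0 sqrtr_sqr.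
by rewrite normrM !normc_def /= !expr0n /= add0r addr0 expr1n sqrtr1 mul1r sqrtr_sqr.
Qed.

(** Multipliers that preserve integrability: continuity gives measurability, and the bound does the
    rest. Real and imaginary parts are separated because [mint] integrates them separately. *)
Definition cbounded (g : R -> C) :=
  [/\ continuous (fun th => Re (g th) : R), continuous (fun th => Im (g th) : R)
    & exists M : R, forall th, `|g th| <= M%:C%C].

Lemma cbounded_cst (c : C) : cbounded (fun=> c).
Proof.
split; [by move=> th; exact: cvg_cst | by move=> th; exact: cvg_cst |].
exists (`|Re c| + `|Im c|) => _; exact: normc_le_ReIm.
Qed.

Lemma cboundedD f g : cbounded f -> cbounded g -> cbounded (fun th => f th + g th).
Proof.
case=> [rf mf [M fM]] [rg mg [N gN]]; split.
- by under eq_fun do rewrite ReD; move=> th; apply: cvgD; [apply: rf|apply: rg].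
- by under eq_fun do rewrite ImD; move=> th; apply: cvgD; [apply: mf|apply: mg].
- by exists (M + N) => th; rewrite rmorphD (le_trans (ler_normD _ _)) ?lerD.
Qed.

Lemma cboundedM f g : cbounded f -> cbounded g -> cbounded (fun th => f th * g th).
Proof.
case=> [rf mf [M fM]] [rg mg [N gN]]; split.
- under eq_fun do rewrite ReM.
  by move=> th; apply: cvgB; apply: cvgM; [apply: rf|apply: rg|apply: mf|apply: mg].
- under eq_fun do rewrite ImM.
  by move=> th; apply: cvgD; apply: cvgM; [apply: rf|apply: mg|apply: mf|apply: rg].
- by exists (M * N) => th; rewrite rmorphM normrM ler_pM.
Qed.

Lemma cbounded_conj f : cbounded f -> cbounded (fun th => conjc (f th)).
Proof.
case=> [rf mf [M fM]]; split.
- by under eq_fun do rewrite Re_conj.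
- by under eq_fun do rewrite Im_conj; move=> th; apply: cvgN; apply: mf.
- by exists M => th; rewrite normcJ.
Qed.

Lemma cbounded_sum I (r : seq I) (P : pred I) (F : I -> R -> C) :
  (forall i, cbounded (F i)) -> cbounded (fun th => \sum_(i <- r | P i) F i th).
Proof.
move=> bF; elim: r => [|i r IHr].
  by under eq_fun do rewrite big_nil; exact: cbounded_cst.
under eq_fun do rewrite big_cons.
by case: (P i) => //; apply: cboundedD.
Qed.

Lemma cbounded_eit : cbounded (@eit R).
Proof.
split; [exact: continuous_cos | exact: continuous_sin |].
by exists 1 => th; rewrite normc_def /= cos2Dsin2 sqrtr1.
Qed.

Lemma norm_eit (th : R) : `|eit th| = 1.
Proof. by rewrite normc_def /= cos2Dsin2 sqrtr1. Qed.

Lemma eit_neq0 (th : R) : eit th != 0.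
Proof. by rewrite -normr_eq0 norm_eit oner_eq0. Qed.

Lemma eit_conj (th : R) : conjc (eit th) = (eit th)^-1.
Proof. by rewrite invc_norm norm_eit expr1n invr1 mul1r. Qed.

Lemma eit_subr_neq0 (th : R) (z : C) : `|z| < 1 -> eit th - z != 0.
Proof.
by move=> z1; rewrite subr_eq0; apply: contraTneq z1 => <-; rewrite norm_eit ltxx.
Qed.

(** The bound comes from [|t - z| >= 1 - |z|] on the circle. *)
Lemma cbounded_cauchy (z : C) : `|z| < 1 -> cbounded (fun th => (eit th - z)^-1).
Proof.
move=> z1; have [rt mt _] : cbounded (fun th => eit th - z).
  by apply: cboundedD; [exact: cbounded_eit | exact: cbounded_cst].
have nz th : Re (eit th - z) ^+ 2 + Im (eit th - z) ^+ 2 != 0.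
  have := eit_subr_neq0 th z1; rewrite -normr_eq0 normc_def.
  apply: contraNneq => ->; by rewrite sqrtr0.
have cn : continuous (fun th => (Re (eit th - z) ^+ 2 + Im (eit th - z) ^+ 2)^-1 : R).
  move=> th; apply: cvgV => //.
  apply: cvgD; rewrite expr2; under eq_fun do rewrite expr2.
    by apply: cvgM; apply: rt.
  by apply: cvgM; apply: mt.
have ReV (x : C) : Re x^-1 = Re x * (Re x ^+ 2 + Im x ^+ 2)^-1 by case: x.
have ImV (x : C) : Im x^-1 = - Im x * (Re x ^+ 2 + Im x ^+ 2)^-1.
  by case: x => a b; rewrite /= mulNr.
split.
- under eq_fun do rewrite ReV.
  by move=> th; apply: cvgM; [apply: rt | apply: cn].
- under eq_fun do rewrite ImV.
  by move=> th; apply: cvgM; [apply: cvgN; apply: mt | apply: cn].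
- have [r zr] : exists r : R, `|z| = r%:C%C by exists (Num.sqrt (Re z ^+ 2 + Im z ^+ 2)); rewrite normc_def.
  exists (1 - r)^-1 => th.
  have r1 : 0 < 1 - r by rewrite subr_gt0 -ltcR -zr.
  have h : (1 - r)%:C%C <= `|eit th - z|.
    have -> : (1 - r)%:C%C = `|eit th| - `|z| by rewrite norm_eit zr rmorphB.
    by rewrite lerBDr -[X in `|X| <= _](subrK z) ler_normD.
  have r1C : 0 < (1 - r)%:C%C by rewrite ltcR.
  rewrite normfV [X in _ <= X]fmorphV /= lef_pV2 // posrE //.
  exact: lt_le_trans h.
Qed.

Variable nu : {measure set R -> \bar R}.

Definition cint (h : R -> C) : C :=
  (Rintegral nu Tset (fun th => Re (h th)) +i* Rintegral nu Tset (fun th => Im (h th)))%C.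

Definition cintegrable (h : R -> C) :=
  nu.-integrable Tset (fun th => (Re (h th))%:E) /\
  nu.-integrable Tset (fun th => (Im (h th))%:E).

Lemma measurable_Tset : measurable (@Tset R).
Proof. exact: measurable_itv. Qed.
Local Hint Resolve measurable_Tset : core.

Lemma cintegrableD f g :
  cintegrable f -> cintegrable g -> cintegrable (fun th => f th + g th).
Proof.
case=> rf mf [rg mg]; split.
  by under eq_fun do rewrite ReD EFinD; apply: integrableD.
by under eq_fun do rewrite ImD EFinD; apply: integrableD.
Qed.

Lemma integrable_boundedM (h w : R -> R) (M : R) :
  continuous h -> (forall th, `|h th| <= M) ->
  nu.-integrable Tset (fun th => (w th)%:E) ->
  nu.-integrable Tset (fun th => (h th * w th)%:E).
Proof.
move=> ch hM iw; have := @integrableMr _ _ _ nu Tset measurable_Tset h _ _ _ iw.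
apply; first by apply: measurable_funTS; exact: continuous_measurable_fun.
exists M; split; first exact: num_real.
by move=> x Mx th _; exact: le_trans (hM th) (ltW Mx).
Qed.

Lemma cintegrableM f g :
  cbounded f -> cintegrable g -> cintegrable (fun th => f th * g th).
Proof.
case=> [rf mf [M fM]] [rg mg].
have RM th : `|Re (f th)| <= M by rewrite -lecR (le_trans (normc_ge_Re _)).
have IM th : `|Im (f th)| <= M by rewrite -lecR (le_trans (normc_ge_Im _)).
split.
  under eq_fun do rewrite ReM EFinB.
  by apply: integrableB => //; apply: integrable_boundedM.
under eq_fun do rewrite ImM EFinD.
by apply: integrableD => //; apply: integrable_boundedM.
Qed.

Lemma cintegrable0 : cintegrable (fun=> 0).
Proof. by split; exact: integrable0. Qed.

Lemma cintegrable_sum I (r : seq I) (F : I -> R -> C) :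
  (forall i, cintegrable (F i)) -> cintegrable (fun th => \sum_(i <- r) F i th).
Proof.
move=> iF; elim: r => [|i r IHr].
  by under eq_fun do rewrite big_nil; exact: cintegrable0.
by under eq_fun do rewrite big_cons; exact: cintegrableD.
Qed.

Lemma cintD f g : cintegrable f -> cintegrable g ->
  cint (fun th => f th + g th) = cint f + cint g.
Proof.
case=> rf mf [rg mg]; apply: eq_ReIm; rewrite ?ReD ?ImD /=.
  by under eq_fun do rewrite ReD; rewrite RintegralD.
by under eq_fun do rewrite ImD; rewrite RintegralD.
Qed.

Lemma cintZ (c : C) f : cintegrable f -> cint (fun th => c * f th) = c * cint f.
Proof.
case=> rf mf.
have Zl (r : R) (h : R -> R) : nu.-integrable Tset (EFin \o h) ->
  nu.-integrable Tset (EFin \o (fun th => r * h th)).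
  by move=> ih; rewrite (_ : _ \o _ = fun th => (r%:E * (h th)%:E)%E) //; exact: integrableZl.
apply: eq_ReIm; rewrite ?ReM ?ImM /=.
  by under eq_fun do rewrite ReM; rewrite RintegralB ?RintegralZl //; exact: Zl.
by under eq_fun do rewrite ImM; rewrite RintegralD ?RintegralZl //; exact: Zl.
Qed.

Lemma cint_conj f : cintegrable f -> cint (fun th => conjc (f th)) = conjc (cint f).
Proof.
case=> rf mf; apply: eq_ReIm; rewrite ?Re_conj ?Im_conj /=.
  by under eq_fun do rewrite Re_conj.
by under eq_fun do rewrite Im_conj -mulN1r; rewrite RintegralZl //= mulN1r.
Qed.

Lemma eq_cint f g : (forall th, Tset th -> f th = g th) -> cint f = cint g.
Proof.
by move=> fg; congr (_ +i* _)%C; apply: eq_Rintegral => th; rewrite inE => /fg ->.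
Qed.

Lemma cint_sum I (r : seq I) (F : I -> R -> C) : (forall i, cintegrable (F i)) ->
  cint (fun th => \sum_(i <- r) F i th) = \sum_(i <- r) cint (F i).
Proof.
move=> iF; elim: r => [|i r IHr].
  under eq_fun do rewrite big_nil; rewrite big_nil.
  rewrite -[RHS](mul0r (cint (fun=> 0))) -cintZ; last exact: cintegrable0.
  by apply: eq_cint => th _; rewrite mul0r.
under eq_fun do rewrite big_cons.
by rewrite cintD ?IHr ?big_cons //; exact: cintegrable_sum.
Qed.

Lemma cint_ge0 f : (forall th, Tset th -> 0 <= f th) -> 0 <= cint f.
Proof.
move=> f0; rewrite lecE /=; apply/andP; split.
  rewrite (@eq_Rintegral _ _ _ _ _ (fun=> 0 * 0)) => [|th].
    by rewrite RintegralZl ?mul0r //; exact: integrable0.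
  by rewrite inE => /f0 /ger0_Im ->; rewrite mul0r.
by apply: Rintegral_ge0 => th /f0; rewrite lecE => /andP[].
Qed.

(** [B] depends on [h] alone, so one constant serves a whole family of kernels [g]. It is twice the
    integral of [|Re h| + |Im h|], since the real and imaginary parts of the integral are bounded
    separately. *)
Lemma cint_bound h : cintegrable h -> exists2 B : R, 0 <= B &
  forall (g : R -> C) (K : R), cbounded g -> (forall th, `|g th| <= K%:C%C) ->
    `|cint (fun th => g th * h th)| <= (K * B)%:C%C.
Proof.
move=> ih; pose n th := `|Re (h th)| + `|Im (h th)|.
have iN (w : R -> R) : nu.-integrable Tset (fun th => (w th)%:E) ->
    nu.-integrable Tset (fun th => (`|w th|)%:E).
  by move=> iw; exact: (integrable_abse iw).
have inn : nu.-integrable Tset (fun th => (n th)%:E).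
  by rewrite /n; under eq_fun do rewrite EFinD; apply: integrableD => //; apply: iN; case: ih.
exists (2 * Rintegral nu Tset n).
  by rewrite mulr_ge0 ?Rintegral_ge0 // => th _; rewrite addr_ge0.
move=> g K bg gK; have [ir im] := cintegrableM bg ih.
apply: le_trans (normc_le_ReIm _) _; rewrite lecR mulrCA [2 * _]mulr_natl mulr2n.
have gR th : `|Re (g th)| <= K by rewrite -lecR (le_trans (normc_ge_Re _)).
have gI th : `|Im (g th)| <= K by rewrite -lecR (le_trans (normc_ge_Im _)).
have bnd (w : R -> R) : nu.-integrable Tset (fun th => (w th)%:E) ->
    (forall th, `|w th| <= K * n th) ->
    `|Rintegral nu Tset w| <= K * Rintegral nu Tset n.
  move=> iw wK; apply: le_trans (le_normr_Rintegral _ _) _ => //.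
  rewrite -RintegralZl //; apply: le_Rintegral => //; first exact: iN.
  rewrite (_ : _ \o _ = fun th => (K%:E * (n th)%:E)%E) //; exact: integrableZl.
rewrite /= lerD //; apply: bnd => // th.
  rewrite ReM (le_trans (ler_normB _ _)) // !normrM mulrDr lerD // ler_pM //.
rewrite ImM (le_trans (ler_normD _ _)) // !normrM mulrDr addrC lerD // ler_pM //.
Qed.

End ComplexIntegral.

(* Locked, so that unification never unfolds them down to [cos] and [sin]. *)
HB.lock Definition ip (R : realType) (d : nat) (nu : {measure set R -> \bar R})
    (W : R -> 'M[R[i]]_d) m n (P : R -> 'M[R[i]]_(d, m)) (Q : R -> 'M[R[i]]_(d, n)) :
  'M[R[i]]_(m, n) := mint nu (fun th => adjm (P th) *m W th *m Q th).

HB.lock Definition tmul (R : realType) d e m (P : R -> 'M[R[i]]_(d, m)) :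
  R -> 'M[R[i]]_(d, m) := fun th => eit th ^+ e *: P th.

HB.lock Definition cauchy (R : realType) d (z : R[i]) m (P : R -> 'M[R[i]]_(d, m)) :
  R -> 'M[R[i]]_(d, m) := fun th => (eit th - z)^-1 *: P th.

HB.lock Definition rmul (R : realType) d m n (P : R -> 'M[R[i]]_(d, m))
    (c : 'M[R[i]]_(m, n)) : R -> 'M[R[i]]_(d, n) := fun th => P th *m c.

Definition cstf (R : realType) d m (c : 'M[R[i]]_(d, m)) (th : R) := c.

(** * The matrix-valued inner product and the Cauchy kernel *)

Section MatrixInnerProduct.
Variables (R : realType) (d : nat) (nu : {measure set R -> \bar R}).
Variable W : R -> 'M[R[i]]_d.
Hypothesis Hmu : is_mxmeasure nu W.
Local Notation C := R[i].
Local Notation fn m := (R -> 'M[C]_(d, m)).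
Local Notation ip := (ip nu W).

Definition mintegrable m n (F : R -> 'M[C]_(m, n)) :=
  forall a b, cintegrable nu (fun th => F th a b).
Definition mbounded m n (P : R -> 'M[C]_(m, n)) :=
  forall a b, cbounded (fun th => P th a b).

Lemma ipE m n (P : fn m) (Q : fn n) :
  ip P Q = mint nu (fun th => adjm (P th) *m W th *m Q th).
Proof. by rewrite ip.unlock. Qed.

Lemma tmulE e m (P : fn m) th : tmul e P th = eit th ^+ e *: P th.
Proof. by rewrite tmul.unlock. Qed.

Lemma cauchyE z m (P : fn m) th : cauchy z P th = (eit th - z)^-1 *: P th.
Proof. by rewrite cauchy.unlock. Qed.

Lemma rmulE m n (P : fn m) (c : 'M[C]_(m, n)) th : rmul P c th = P th *m c.
Proof. by rewrite rmul.unlock. Qed.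

Lemma mintE m n (F : R -> 'M[C]_(m, n)) a b : mint nu F a b = cint nu (fun th => F th a b).
Proof. by rewrite mxE. Qed.

Lemma eq_mint m n (F G : R -> 'M[C]_(m, n)) :
  (forall th, Tset th -> F th = G th) -> mint nu F = mint nu G.
Proof. by move=> FG; apply/matrixP => a b; rewrite !mintE; apply: eq_cint => th /FG ->. Qed.

Lemma mintD m n (F G : R -> 'M[C]_(m, n)) : mintegrable F -> mintegrable G ->
  mint nu (fun th => F th + G th) = mint nu F + mint nu G.
Proof.
move=> iF iG; apply/matrixP => a b; rewrite [RHS]mxE !mintE -cintD //.
by apply: eq_cint => th _; rewrite mxE.
Qed.

Lemma mint_mulr m n p (F : R -> 'M[C]_(m, n)) (c : 'M[C]_(n, p)) : mintegrable F ->
  mint nu (fun th => F th *m c) = mint nu F *m c.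
Proof.
move=> iF; apply/matrixP => a b; rewrite [RHS]mxE mintE.
have iZ j : cintegrable nu (fun th => c j b * F th a j).
  by apply: cintegrableM => //; exact: cbounded_cst.
rewrite (@eq_cint _ _ _ (fun th => \sum_j c j b * F th a j)) => [|th _].
  by rewrite cint_sum //; apply: eq_bigr => j _; rewrite cintZ // mintE mulrC.
by rewrite mxE; apply: eq_bigr => j _; rewrite mulrC.
Qed.

Lemma mint_adj m n (F : R -> 'M[C]_(m, n)) : mintegrable F ->
  mint nu (fun th => adjm (F th)) = adjm (mint nu F).
Proof.
move=> iF; apply/matrixP => a b; rewrite adjmE !mintE -cint_conj //.
by apply: eq_cint => th _; rewrite adjmE.
Qed.

Lemma mbounded_cst m (c : 'M[C]_(d, m)) : mbounded (cstf c).
Proof. by move=> a b; exact: cbounded_cst. Qed.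

Lemma mboundedD m (P Q : fn m) : mbounded P -> mbounded Q -> mbounded (P + Q).
Proof.
move=> bP bQ a b; rewrite addrfctE; under eq_fun do rewrite mxE.
exact: cboundedD.
Qed.

Lemma mboundedZ m (P : fn m) (g : R -> C) :
  cbounded g -> mbounded P -> mbounded (fun th => g th *: P th).
Proof. by move=> bg bP a b; under eq_fun do rewrite mxE; exact: cboundedM. Qed.

Lemma cboundedX n (g : R -> C) : cbounded g -> cbounded (fun th => g th ^+ n).
Proof.
move=> bg; elim: n => [|n IHn].
  by under eq_fun do rewrite expr0; exact: cbounded_cst.
by under eq_fun do rewrite exprS; exact: cboundedM.
Qed.

Lemma mbounded_tmul n m (P : fn m) : mbounded P -> mbounded (tmul n P).
Proof. by rewrite tmul.unlock; apply: mboundedZ; apply: cboundedX; exact: cbounded_eit. Qed.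

Lemma mbounded_cauchy z m (P : fn m) : `|z| < 1 -> mbounded P -> mbounded (cauchy z P).
Proof. by move=> z1; rewrite cauchy.unlock; apply: mboundedZ; exact: cbounded_cauchy. Qed.

Lemma mbounded_rmul m n (P : fn m) (c : 'M[C]_(m, n)) : mbounded P -> mbounded (rmul P c).
Proof.
move=> bP a b; rewrite rmul.unlock; under eq_fun do rewrite mxE.
by apply: cbounded_sum => i; apply: cboundedM => //; exact: cbounded_cst.
Qed.

Lemma mboundedN m (P : fn m) : mbounded P -> mbounded (- P).
Proof.
move=> bP a b; rewrite opprfctE; under eq_fun do rewrite mxE -mulN1r.
by apply: cboundedM => //; exact: cbounded_cst.
Qed.

Lemma mboundedB m (P Q : fn m) : mbounded P -> mbounded Q -> mbounded (P - Q).
Proof. by move=> bP bQ; apply: mboundedD => //; exact: mboundedN. Qed.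

Lemma mbounded_sum m I (r : seq I) (F : I -> fn m) :
  (forall i, mbounded (F i)) -> mbounded (\sum_(i <- r) F i).
Proof.
move=> bF; elim: r => [|i r IHr]; first by rewrite big_nil; exact: (mbounded_cst 0).
by rewrite big_cons; exact: mboundedD.
Qed.

Lemma mintegrable_ip m n (P : fn m) (Q : fn n) : mbounded P -> mbounded Q ->
  mintegrable (fun th => adjm (P th) *m W th *m Q th).
Proof.
move=> bP bQ a b.
rewrite (_ : (fun th => _) =
  (fun th => \sum_j \sum_i conjc (P th i a) * Q th j b * W th i j)).
  apply: cintegrable_sum => j; apply: cintegrable_sum => i; apply: cintegrableM.
    by apply: cboundedM => //; exact: cbounded_conj.
  by case: Hmu => _ /(_ i j) [].
apply: funext => th; rewrite mxE; apply: eq_bigr => j _; rewrite mxE mulr_suml.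
by apply: eq_bigr => i _; rewrite adjmE mulrAC.
Qed.

Lemma ip_rmul m n p (P : fn m) (Q : fn n) (c : 'M[C]_(n, p)) :
  mbounded P -> mbounded Q -> ip P (rmul Q c) = ip P Q *m c.
Proof.
move=> bP bQ; rewrite !ipE -mint_mulr; last exact: mintegrable_ip.
by apply: eq_mint => th _; rewrite rmulE mulmxA.
Qed.

Lemma ipDr m n (P : fn m) (Q1 Q2 : fn n) : mbounded P -> mbounded Q1 -> mbounded Q2 ->
  ip P (Q1 + Q2) = ip P Q1 + ip P Q2.
Proof.
move=> bP b1 b2; rewrite !ipE -mintD; try exact: mintegrable_ip.
by apply: eq_mint => th _; rewrite addrfctE mulmxDr.
Qed.

Lemma ip_adj m n (P : fn m) (Q : fn n) : mbounded P -> mbounded Q ->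
  adjm (ip P Q) = ip Q P.
Proof.
move=> bP bQ; rewrite !ipE -mint_adj; last exact: mintegrable_ip.
apply: eq_mint => th Tth; rewrite !adjmM adjmK mulmxA.
by have [/(_ th Tth) [-> _] _ _] := Hmu.
Qed.

Lemma ip_scale m n (g : R -> C) (P : fn m) (Q : fn n) :
  ip (fun th => g th *: P th) Q = ip P (fun th => conjc (g th) *: Q th).
Proof. by rewrite !ipE; apply: eq_mint => th _; rewrite adjmZ -!scalemxAl -scalemxAr. Qed.

Lemma conjcX (x : C) e : conjc (x ^+ e) = conjc x ^+ e.
Proof. exact: rmorphXn. Qed.

(** Multiplication by [t] is isometric because [|t| = 1]. Shifting both entries by a power of [t] is
    how Laurent polynomials are replaced by polynomials below. *)
Lemma ip_tmul e m n (P : fn m) (Q : fn n) : ip (tmul e P) (tmul e Q) = ip P Q.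
Proof.
have tP : tmul e P = fun th => eit th ^+ e *: P th by rewrite tmul.unlock.
rewrite tP ip_scale; congr ip; apply: funext => th; rewrite tmulE scalerA conjcX eit_conj.
by rewrite -exprMn mulVf ?eit_neq0 // expr1n scale1r.
Qed.

Lemma ip_rmull m n p (P : fn m) (Q : fn n) (c : 'M[C]_(m, p)) :
  mbounded P -> mbounded Q -> ip (rmul P c) Q = adjm c *m ip P Q.
Proof.
move=> bP bQ; rewrite -ip_adj ?ip_rmul ?adjmM ?ip_adj //; exact: mbounded_rmul.
Qed.

Lemma ipDl m n (P1 P2 : fn m) (Q : fn n) : mbounded P1 -> mbounded P2 -> mbounded Q ->
  ip (P1 + P2) Q = ip P1 Q + ip P2 Q.
Proof.
by move=> b1 b2 bQ; rewrite -ip_adj ?ipDr ?adjmD ?ip_adj //; exact: mboundedD.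
Qed.

Lemma rmulN1 m (P : fn m) : rmul P (- 1%:M) = - P.
Proof. by apply: funext => th; rewrite rmulE mulmxN mulmx1. Qed.

Lemma ipNr m n (P : fn m) (Q : fn n) : mbounded P -> mbounded Q -> ip P (- Q) = - ip P Q.
Proof. by move=> bP bQ; rewrite -rmulN1 ip_rmul // mulmxN mulmx1. Qed.

Lemma ipBr m n (P : fn m) (Q1 Q2 : fn n) : mbounded P -> mbounded Q1 -> mbounded Q2 ->
  ip P (Q1 - Q2) = ip P Q1 - ip P Q2.
Proof. by move=> bP b1 b2; rewrite ipDr ?ipNr //; exact: mboundedN. Qed.

Lemma ipBl m n (P1 P2 : fn m) (Q : fn n) : mbounded P1 -> mbounded P2 -> mbounded Q ->
  ip (P1 - P2) Q = ip P1 Q - ip P2 Q.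
Proof.
by move=> b1 b2 bQ; rewrite -ip_adj ?ipBr ?adjmB ?ip_adj //; exact: mboundedB.
Qed.

Lemma ip0r m n (P : fn m) : ip P (0 : fn n) = 0.
Proof.
apply/matrixP => a b; rewrite ipE mintE (@eq_cint _ _ _ (fun th => 0 * 0)) => [|th _].
  by rewrite cintZ ?mul0r ?mxE //; exact: cintegrable0.
by rewrite mulmx0 mxE mul0r.
Qed.

Lemma ip_sumr m n (P : fn m) I (r : seq I) (F : I -> fn n) :
  mbounded P -> (forall i, mbounded (F i)) ->
  ip P (\sum_(i <- r) F i) = \sum_(i <- r) ip P (F i).
Proof.
move=> bP bF; elim: r => [|i r IHr]; first by rewrite !big_nil ip0r.
by rewrite !big_cons ipDr ?IHr //; exact: mbounded_sum.
Qed.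

Lemma rmulZ m (P : fn m) (c : C) : rmul P c%:M = c *: P.
Proof. by apply: funext => th; rewrite rmulE mul_mx_scalar. Qed.

Lemma mbounded_scale m (P : fn m) (c : C) : mbounded P -> mbounded (c *: P).
Proof. by rewrite -rmulZ; exact: mbounded_rmul. Qed.

Lemma ipZr m n (P : fn m) (Q : fn n) (c : C) : mbounded P -> mbounded Q ->
  ip P (c *: Q) = c *: ip P Q.
Proof. by move=> bP bQ; rewrite -rmulZ ip_rmul // mul_mx_scalar. Qed.

Lemma ipZl m n (P : fn m) (Q : fn n) (c : C) : mbounded P -> mbounded Q ->
  ip (c *: P) Q = conjc c *: ip P Q.
Proof.
by move=> bP bQ; rewrite -ip_adj ?ipZr ?adjmZ ?ip_adj //; exact: mbounded_scale.
Qed.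

Lemma ip_psd m (P : fn m) : mbounded P -> psdm (ip P P).
Proof.
move=> bP; split=> [|v]; first by rewrite ip_adj.
rewrite -ip_rmull // -ip_rmul //; last exact: mbounded_rmul.
rewrite ipE mintE; apply: cint_ge0 => th Tth.
by have [/(_ th Tth) [_ pW] _ _] := Hmu; rewrite rmulE; exact: pW.
Qed.

Lemma ip_cst1 : ip (cstf 1%:M) (cstf 1%:M) = 1%:M.
Proof.
have [_ _ W1] := Hmu; rewrite ipE -[RHS]W1; apply: eq_mint => th _.
by rewrite /cstf adjm1 mul1mx mulmx1.
Qed.

Lemma tmul_rmul e m n (P : fn m) (c : 'M[C]_(m, n)) : tmul e (rmul P c) = rmul (tmul e P) c.
Proof. by apply: funext => th; rewrite !(tmulE, rmulE) scalemxAl. Qed.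

Lemma cauchy_rmul z m n (P : fn m) (c : 'M[C]_(m, n)) :
  cauchy z (rmul P c) = rmul (cauchy z P) c.
Proof. by apply: funext => th; rewrite !(cauchyE, rmulE) scalemxAl. Qed.

Lemma cauchy_tmul z e m (P : fn m) : cauchy z (tmul e P) = tmul e (cauchy z P).
Proof. by apply: funext => th; rewrite !(cauchyE, tmulE) !scalerA mulrC. Qed.

Lemma tmulD e m (P Q : fn m) : tmul e (P + Q) = tmul e P + tmul e Q.
Proof. by apply: funext => th; rewrite !(tmulE, addrfctE) scalerDr. Qed.

Lemma cauchyD z m (P Q : fn m) : cauchy z (P + Q) = cauchy z P + cauchy z Q.
Proof. by apply: funext => th; rewrite !(cauchyE, addrfctE) scalerDr. Qed.

Lemma tmul_tmul e f m (P : fn m) : tmul e (tmul f P) = tmul (e + f) P.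
Proof. by apply: funext => th; rewrite !tmulE scalerA exprD. Qed.

Lemma tmul0 m (P : fn m) : tmul 0 P = P.
Proof. by apply: funext => th; rewrite tmulE expr0 scale1r. Qed.

Lemma cauchyK z m (P : fn m) : `|z| < 1 -> tmul 1 (cauchy z P) - z *: cauchy z P = P.
Proof.
move=> z1; apply: funext => th; rewrite addrfctE opprfctE scalrfctE tmulE !cauchyE expr1.
by rewrite -scalerBl scalerA mulfV ?scale1r ?eit_subr_neq0.
Qed.

(* For [y = (t - z)^-1 X v] with [v] in the kernel, [v^* v = - (1 - |z|^2) <y, y>]. *)
Lemma ip_cauchy_unit z m (X : fn m) : mbounded X -> ip X X = 1%:M -> `|z| < 1 ->
  ip X (cauchy z (tmul 1 X)) \in unitmx.
Proof.
move=> bX XX z1; apply: unitmx_inj => v Kv.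
have : mbounded (rmul (cauchy z X) v) by apply: mbounded_rmul; exact: mbounded_cauchy.
move yE: (rmul (cauchy z X) v) => y by_.
have bty : mbounded (tmul 1 y) by exact: mbounded_tmul.
have bzy : mbounded (z *: y) by exact: mbounded_scale.
have bx : mbounded (rmul X v) by exact: mbounded_rmul.
have xE : rmul X v = tmul 1 y - z *: y.
  by rewrite -[LHS](cauchyK (rmul X v) z1) cauchy_rmul yE.
have e1 : ip (rmul X v) (tmul 1 y) = 0.
  rewrite ip_rmull // -yE tmul_rmul -cauchy_tmul ip_rmul ?Kv ?mulmx0 //.
  by apply: mbounded_cauchy => //; exact: mbounded_tmul.
have e2 : ip y y = conjc z *: ip y (tmul 1 y).
  move: e1; rewrite xE ipBl // ip_tmul ipZl // => /eqP; rewrite subr_eq0.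
  by move/eqP.
have e3 : ip y y = z *: ip (tmul 1 y) y.
  by rewrite -[LHS]ip_adj // e2 adjmZ conjcK ip_adj.
have e4 : ip (rmul X v) (rmul X v) = - (1 - `|z| ^+ 2) *: ip y y.
  rewrite {2}xE ipBr // e1 sub0r ipZr // xE ipBl // ipZl // scalerBr -e3.
  by rewrite sqr_normc scalerA scaleNr scalerBl scale1r.
have e5 : sqn v = - (1 - `|z| ^+ 2) * (ip y y) 0 0.
  transitivity (ip (rmul X v) (rmul X v) 0 0); last by rewrite e4 mxE.
  by rewrite ip_rmull // ip_rmul // XX mul1mx.
apply/sqn_eq0/eqP; rewrite eq_le sqn_ge0 e5 mulNr oppr_le0 andbT.
rewrite mulr_ge0 //.
  by rewrite subr_ge0 expr_le1 // ltW.
by have [_ /(_ 1%:M)] := ip_psd by_; rewrite adjm1 mul1mx mulmx1.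
Qed.

End MatrixInnerProduct.

(** * Orthonormal polynomials and the Szego recursion *)

Section GramSchmidt.
Variables (R : realType) (d : nat) (nu : {measure set R -> \bar R}).
Variable W : R -> 'M[R[i]]_d.
Hypothesis Hmu : is_mxmeasure nu W.
Local Notation C := R[i].
Local Notation fn m := (R -> 'M[C]_(d, m)).
Local Notation ip := (ip nu W).

(** Coefficients stand on the right, where [ip] is linear. The family [em] stays abstract because it
    will be the powers of [t] for the right polynomials and those of [conj t] for the adjoints of
    the left ones. *)
Definition lincomb (em : nat -> fn d) n m (x : nat -> 'M[C]_(d, m)) : fn m :=
  \sum_(i < n) rmul (em i) (x i).

Variable em : nat -> fn d.
Hypothesis em_bounded : forall i, mbounded (em i).

Lemma mbounded_lincomb n m (x : nat -> 'M[C]_(d, m)) : mbounded (lincomb em n x).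
Proof. by apply: mbounded_sum => i; exact: mbounded_rmul. Qed.

Lemma rmulDr m n (P : fn m) (a b : 'M[C]_(m, n)) : rmul P (a + b) = rmul P a + rmul P b.
Proof. by apply: funext => th; rewrite addrfctE !rmulE mulmxDr. Qed.

Lemma rmulNr m n (P : fn m) (a : 'M[C]_(m, n)) : rmul P (- a) = - rmul P a.
Proof. by apply: funext => th; rewrite opprfctE !rmulE mulmxN. Qed.

Lemma rmulDl m n (P Q : fn m) (a : 'M[C]_(m, n)) : rmul (P + Q) a = rmul P a + rmul Q a.
Proof. by apply: funext => th; rewrite !(addrfctE, rmulE) mulmxDl. Qed.

Lemma rmulNl m n (P : fn m) (a : 'M[C]_(m, n)) : rmul (- P) a = - rmul P a.
Proof. by apply: funext => th; rewrite !(opprfctE, rmulE) mulNmx. Qed.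

Lemma rmul_rmul m n p (P : fn m) (a : 'M[C]_(m, n)) (b : 'M[C]_(n, p)) :
  rmul (rmul P a) b = rmul P (a *m b).
Proof. by apply: funext => th; rewrite !rmulE mulmxA. Qed.

Lemma rmul1 m (P : fn m) : rmul P 1%:M = P.
Proof. by apply: funext => th; rewrite rmulE mulmx1. Qed.

Lemma rmul_lincomb n m p (x : nat -> 'M[C]_(d, m)) (a : 'M[C]_(m, p)) :
  rmul (lincomb em n x) a = lincomb em n (fun i => x i *m a).
Proof.
rewrite /lincomb; elim/big_rec2: _ => [|i y1 y2 _ <-].
  by apply: funext => th; rewrite rmulE mul0mx.
by rewrite rmulDl rmul_rmul.
Qed.

Lemma ip_lincombl n m p (x : nat -> 'M[C]_(d, m)) (A : fn p) : mbounded A ->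
  ip (lincomb em n x) A = \sum_(i < n) adjm (x i) *m ip (em i) A.
Proof.
move=> bA; rewrite -ip_adj //; last exact: mbounded_lincomb.
rewrite ip_sumr // => [|i]; last exact: mbounded_rmul.
rewrite adjm_sum; apply: eq_bigr => i _.
by rewrite ip_adj ?ip_rmull //; exact: mbounded_rmul.
Qed.

Lemma ip_lincomb_eq0 n m p (x : nat -> 'M[C]_(d, m)) (A : fn p) : mbounded A ->
  (forall l, (l < n)%N -> ip (em l) A = 0) -> ip (lincomb em n x) A = 0.
Proof.
by move=> bA A0; rewrite ip_lincombl // big1 // => i _; rewrite A0 // mulmx0.
Qed.

Hypothesis em_indep : forall n (v : nat -> 'cV[C]_d),
  ip (lincomb em n v) (lincomb em n v) = 0 -> forall i, (i < n)%N -> v i = 0.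

Definition monic n (y : nat -> 'M[C]_d) : fn d := em n - lincomb em n y.

Lemma mbounded_monic n y : mbounded (monic n y).
Proof. by apply: mboundedB => //; exact: mbounded_lincomb. Qed.

Lemma monic_rmul n y m (a : 'M[C]_(d, m)) :
  rmul (monic n y) a = lincomb em n.+1 (fun i => if (i < n)%N then - (y i *m a) else a).
Proof.
rewrite /monic rmulDl rmulNl rmul_lincomb /lincomb big_ord_recr /= ltnn addrC.
congr (_ + _); rewrite -sumrN; apply: eq_bigr => i _.
by rewrite ltn_ord rmulNr.
Qed.

(** For [v != 0] the combination [monic n y] times [v] has the nonzero coefficient [v] at [em n], so
    independence keeps its norm from vanishing, whatever [y] is. *)
Lemma monic_gram_pdm n y : pdm (ip (monic n y) (monic n y)).
Proof.
have bE := mbounded_monic n y.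
have [hG pG] := ip_psd Hmu bE; split=> // v v0.
rewrite lt_neqAle pG andbT eq_sym; apply: contra v0 => /eqP vGv.
have := @em_indep n.+1 (fun i => if (i < n)%N then - (y i *m v) else v).
rewrite -monic_rmul => /(_ _ n); rewrite ltnn => -> //.
rewrite ip_rmul //; last exact: mbounded_rmul.
by rewrite ip_rmull //; apply/matrixP => i j; rewrite !ord1 vGv mxE.
Qed.

(** The induction hypothesis is used twice: for [A], and for [em n] itself, which makes [monic n y]
    orthogonal to the lower span. The remainder of [A] is then projected on [monic n y], whose Gram
    matrix is invertible. *)
Lemma projection_exists n (A : fn d) : mbounded A ->
  exists x, forall l, (l < n)%N -> ip (em l) (A - lincomb em n x) = 0.
Proof.
elim: n A => [|n IHn] A bA; first by exists (fun=> 0).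
have [x xP] := IHn A bA; have [y yP] := IHn (em n) (em_bounded n).
have bE := mbounded_monic n y; have bl := mbounded_lincomb.
pose A' := A - lincomb em n x.
have bA' : mbounded A' by apply: mboundedB.
pose G := ip (monic n y) (monic n y).
have Gu : G \in unitmx by apply/pdm_unit/monic_gram_pdm.
pose g := invmx G *m ip (monic n y) A'.
exists (fun i => if (i < n)%N then x i - y i *m g else g).
have -> : A - lincomb em n.+1 (fun i => if (i < n)%N then x i - y i *m g else g) =
    A' - rmul (monic n y) g.
  rewrite monic_rmul /A' -addrA -opprD; congr (_ - _).
  rewrite /lincomb !big_ord_recr /= ltnn addrA -big_split /=; congr (_ + _).
  by apply: eq_bigr => i _; rewrite ltn_ord -rmulDr.
have bEg : mbounded (rmul (monic n y) g) by exact: mbounded_rmul.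
have bB : mbounded (A' - rmul (monic n y) g) by exact: mboundedB.
have lP l : (l < n)%N -> ip (em l) (A' - rmul (monic n y) g) = 0.
  by move=> ln; rewrite ipBr // ip_rmul // xP // yP // mul0mx subrr.
move=> l; rewrite ltnS leq_eqVlt => /orP[/eqP->|]; last exact: lP.
have -> : em n = monic n y + lincomb em n y by rewrite /monic subrK.
rewrite ipDl // [X in _ + X]ip_lincomb_eq0 // addr0.
by rewrite ipBr // ip_rmul // -/G /g mulKVmx // subrr.
Qed.

(** Leading coefficients are chosen as [k_(n+1) = k_n S^-1], where [S] is the positive root of
    [k_n^* G_(n+1) k_n] and [G] the Gram matrix of the monic element. This normalizes the element
    and makes [k_n^-1 k_(n+1) = S^-1] positive. *)
Lemma gram_schmidt : ip (em 0) (em 0) = 1%:M ->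
  exists c : nat -> nat -> 'M[C]_d, let phi n := lincomb em n.+1 (c n) in
  [/\ c 0%N 0%N = 1%:M,
      forall n l, (l < n)%N -> ip (em l) (phi n) = 0,
      forall n, ip (phi n) (phi n) = 1%:M
    & forall n, pdm (invmx (c n n) *m c n.+1 n.+1)].
Proof.
move=> e0; have [y yP] := choice (fun n => projection_exists n (em_bounded n)).
pose G n := ip (monic n (y n)) (monic n (y n)).
(* Stated for every pair, with invertibility as a premise, so that choice gives a total function to
   iterate. *)
have stepP (kn : 'M[C]_d * nat) : exists k' : 'M[C]_d, kn.1 \in unitmx ->
    pdm (invmx kn.1 *m k') /\ adjm k' *m G kn.2.+1 *m k' = 1%:M.
  case: kn => k n /=; have [ku|] := boolP (k \in unitmx); last by exists 0.
  have [S pS SS] := pdm_sqrt_exists (pdm_congr ku (monic_gram_pdm n.+1 (y n.+1))).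
  have Su := pdm_unit pS; exists (k *m invmx S) => _; split.
    by rewrite (mulKmx ku); exact: pdm_inv.
  have -> : G n.+1 = adjm (invmx k) *m (S *m S) *m invmx k.
    by rewrite SS !mulmxA -adjmM mulmxV // adjm1 mul1mx mulmxK.
  rewrite adjmM adjmV (proj1 pS) !mulmxA mulmxKV // -!mulmxA (mulmxA (adjm k)).
  by rewrite -adjmM mulVmx // adjm1 mul1mx !mulmxA mulVmx // mul1mx mulmxV.
have [step {}stepP] := choice stepP.
pose k := fix k n := if n is m.+1 then step (k m, m) else 1%:M : 'M[C]_d.
have ku n : k n \in unitmx.
  elim: n => [|n IHn]; first exact: unitmx1.
  have [/pdm_unit] := stepP (k n, n) IHn.
  by rewrite unitmx_mul => /andP[].
have kP n : pdm (invmx (k n) *m k n.+1) by have [] := stepP (k n, n) (ku n).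
have kG n : adjm (k n) *m G n *m k n = 1%:M.
  case: n => [|n]; last by have [] := stepP (k n, n) (ku n).
  by rewrite /= adjm1 mul1mx mulmx1 /G /monic /lincomb big_ord0 subr0.
have bE n := mbounded_monic n (y n).
exists (fun n i => if (i < n)%N then - (y n i *m k n) else k n); split.
- exact: erefl.
- by move=> n l ln; rewrite -monic_rmul ip_rmul // yP // mul0mx.
- by move=> n; rewrite -monic_rmul ip_rmul ?ip_rmull ?kG //; exact: mbounded_rmul.
- by move=> n; rewrite !ltnn.
Qed.

Lemma lincomb_orthonormal (c : nat -> nat -> 'M[C]_d) (phi := fun n => lincomb em n.+1 (c n)) :
  (forall n l, (l < n)%N -> ip (em l) (phi n) = 0) ->
  (forall n, ip (phi n) (phi n) = 1%:M) ->
  forall m n, ip (phi m) (phi n) = if m == n then 1%:M else 0.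
Proof.
move=> o1 n1 m n; have bl := mbounded_lincomb.
have lt p q : (p < q)%N -> ip (phi p) (phi q) = 0.
  by move=> pq; apply: ip_lincomb_eq0 => [|l lp]; [exact: bl | exact: (o1 q l (leq_trans lp pq))].
case: ltngtP => [/lt //|nm|->] //.
by rewrite -ip_adj ?lt ?adjm0 //; exact: bl.
Qed.

(** Triangular elimination: the coefficient of [em l] in the [l]-th combination is invertible, and
    the lower terms vanish by strong induction. *)
Lemma orthogonal_lincomb (c : nat -> nat -> 'M[C]_d) n m (A : fn m) : mbounded A ->
  (forall l, c l l \in unitmx) ->
  (forall l, (l < n)%N -> ip (lincomb em l.+1 (c l)) A = 0) ->
  forall l, (l < n)%N -> ip (em l) A = 0.
Proof.
move=> bA cu cA; elim/ltn_ind => l IHl ln.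
have := cA l ln; rewrite ip_lincombl // big_ord_recr /= big1 ?add0r.
  by move/(congr1 (mulmx (adjm (invmx (c l l))))); rewrite mulmxA -adjmM mulmxV // adjm1 mul1mx mulmx0.
by move=> i _; rewrite IHl ?mulmx0 // (ltn_trans _ ln).
Qed.

Lemma pdm_ratio_unit (c : nat -> nat -> 'M[C]_d) : c 0%N 0%N = 1%:M ->
  (forall n, pdm (invmx (c n n) *m c n.+1 n.+1)) -> forall n, c n n \in unitmx.
Proof.
move=> c0 cP; elim=> [|n IHn]; first by rewrite c0 unitmx1.
by have /pdm_unit := cP n; rewrite unitmx_mul => /andP[].
Qed.

End GramSchmidt.

HB.lock Definition phi (R : realType) d (nu : {measure set R -> \bar R})
    (W : R -> 'M[R[i]]_d) n (th : R) := peval (phiR nu W n) (eit th).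

(* On the unit circle, the reversed polynomial [t^n phiL_n(1 / conj t)^*]. *)
HB.lock Definition rphi (R : realType) d (nu : {measure set R -> \bar R})
    (W : R -> 'M[R[i]]_d) n :=
  tmul n (fun th => adjm (peval (phiL nu W n) (eit th))).

(** * Existence and orthogonality relations of the orthonormal polynomials *)

Section OrthonormalPolynomials.
Variables (R : realType) (d : nat) (nu : {measure set R -> \bar R}).
Variable W : R -> 'M[R[i]]_d.
Hypothesis (Hmu : is_mxmeasure nu W) (Hnt : nontrivial nu W).
Local Notation C := R[i].
Local Notation fn m := (R -> 'M[C]_(d, m)).
Local Notation ip := (ip nu W).
Local Notation phi := (phi nu W).
Local Notation rphi := (rphi nu W).

Definition tpow (i : nat) : fn d := tmul i (cstf 1%:M).
(** On the circle the adjoint of a left polynomial is a combination of these powers with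
    coefficients on the right, and the left inner product becomes [ip] of the adjoints in the
    opposite order. *)
Definition ctpow (i : nat) : fn d := fun th => conjc (eit th) ^+ i *: 1%:M.

Lemma tpow_bounded i : mbounded (tpow i).
Proof. by apply: mbounded_tmul; exact: mbounded_cst. Qed.

Lemma ctpow_bounded i : mbounded (ctpow i).
Proof.
apply: (mboundedZ (P := cstf 1%:M)); last exact: mbounded_cst.
by apply: cboundedX; apply: cbounded_conj; exact: cbounded_eit.
Qed.

Lemma tpowE i th : tpow i th = eit th ^+ i *: 1%:M.
Proof. by rewrite /tpow tmulE. Qed.

Lemma lincomb_tpowE n m (x : nat -> 'M[C]_(d, m)) th :
  lincomb tpow n x th = \sum_(i < n) eit th ^+ i *: x i.
Proof.
rewrite /lincomb fct_sumE; apply: eq_bigr => i _.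
by rewrite rmulE tpowE -scalemxAl mul1mx.
Qed.

Lemma lincomb_ctpowE n m (x : nat -> 'M[C]_(d, m)) th :
  lincomb ctpow n x th = \sum_(i < n) conjc (eit th) ^+ i *: x i.
Proof.
rewrite /lincomb fct_sumE; apply: eq_bigr => i _.
by rewrite rmulE -scalemxAl mul1mx.
Qed.

Lemma peval_degle m (P : 'M[{poly C}]_(d, m)) n t : degle P n ->
  peval P t = \sum_(i < n.+1) t ^+ i *: coefm P i.
Proof.
move=> dP; apply/matrixP => a b; rewrite summxE mxE (horner_coef_wide _ (dP a b)).
by apply: eq_bigr => i _; rewrite !mxE mulrC.
Qed.

Definition mkpoly n m (x : nat -> 'M[C]_(d, m)) : 'M[{poly C}]_(d, m) :=
  \matrix_(a, b) \poly_(i < n) x i a b.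

Lemma degle_mkpoly n m (x : nat -> 'M[C]_(d, m)) : degle (mkpoly n.+1 x) n.
Proof. by move=> a b; rewrite mxE size_poly. Qed.

Lemma coefm_mkpoly n m (x : nat -> 'M[C]_(d, m)) i : (i < n)%N -> coefm (mkpoly n x) i = x i.
Proof. by move=> i_n; apply/matrixP => a b; rewrite !mxE coef_poly i_n. Qed.

Lemma peval_mkpoly n m (x : nat -> 'M[C]_(d, m)) t :
  peval (mkpoly n x) t = \sum_(i < n) t ^+ i *: x i.
Proof.
apply/matrixP => a b; rewrite summxE !mxE horner_poly.
by apply: eq_bigr => i _; rewrite !mxE mulrC.
Qed.

(** Non-triviality of the measure enters here: a combination of powers of [t] with vector
    coefficients is a vector polynomial. *)
Lemma tpow_indep n (v : nat -> 'cV[C]_d) :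
  ip (lincomb tpow n v) (lincomb tpow n v) = 0 -> forall i, (i < n)%N -> v i = 0.
Proof.
move=> v0 i i_n; have [E|/Hnt] := eqVneq (mkpoly n v) 0.
  by rewrite -(coefm_mkpoly v i_n) E; apply/matrixP => a b; rewrite !mxE coef0.
have pE th : peval (mkpoly n v) (eit th) = lincomb tpow n v th.
  by rewrite peval_mkpoly lincomb_tpowE.
under eq_fun do rewrite pE; by rewrite -ipE v0 eqxx.
Qed.

Lemma eitX_conj n i th : (i <= n)%N -> eit th ^+ n * conjc (eit th) ^+ (n - i) = eit th ^+ i :> C.
Proof.
move=> i_n; rewrite -{1}(subnKC i_n) exprD -mulrA -exprMn eit_conj mulfV ?eit_neq0 //.
by rewrite expr1n mulr1.
Qed.

Lemma tmul_lincomb_ctpow n m (x : nat -> 'M[C]_(d, m)) :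
  tmul n (lincomb ctpow n.+1 x) = lincomb tpow n.+1 (fun i => x (n - i)%N).
Proof.
apply: funext => th; rewrite tmulE lincomb_tpowE lincomb_ctpowE scaler_sumr.
rewrite (reindex_inj rev_ord_inj); apply: eq_bigr => i _ /=.
have i_n : (i <= n)%N by rewrite -ltnS.
by rewrite scalerA subSS eitX_conj.
Qed.

Lemma ctpow_indep n (v : nat -> 'cV[C]_d) :
  ip (lincomb ctpow n v) (lincomb ctpow n v) = 0 -> forall i, (i < n)%N -> v i = 0.
Proof.
case: n => // n; rewrite -(ip_tmul _ _ n) tmul_lincomb_ctpow => /tpow_indep h i i_n.
by have := h (n - i)%N; rewrite subKn // => -> //; rewrite ltnS leq_subr.
Qed.

Lemma tpow0 : tpow 0 = cstf 1%:M.
Proof. by rewrite /tpow tmul0. Qed.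

Lemma ctpow0 : ctpow 0 = cstf 1%:M.
Proof. by apply: funext => th; rewrite /ctpow expr0 scale1r. Qed.

Lemma mkpoly1 (x : nat -> 'M[C]_d) : x 0%N = 1%:M -> mkpoly 1 x = 1%:M.
Proof.
move=> x0; apply/matrixP => a b; rewrite mxE poly_def big_ord1 expr0 x0 !mxE.
by rewrite alg_polyC rmorph_nat.
Qed.

Lemma onpR_exists : exists phi, is_onpR nu W phi.
Proof.
have [|c [c0 co c1 cp]] := gram_schmidt Hmu tpow_bounded tpow_indep.
  by rewrite tpow0 ip_cst1.
have o := lincomb_orthonormal Hmu tpow_bounded co c1.
exists (fun n => mkpoly n.+1 (c n)); split.
- by apply: mkpoly1; rewrite c0 ?adjm1.
- by move=> n; exact: degle_mkpoly.
- move=> m n; rewrite -o ipE; apply: eq_mint => th _.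
  by rewrite !peval_mkpoly !lincomb_tpowE.
- by move=> n; rewrite !coefm_mkpoly.
Qed.

Lemma onpL_exists : exists phi, is_onpL nu W phi.
Proof.
have [|c [c0 co c1 cp]] := gram_schmidt Hmu ctpow_bounded ctpow_indep.
  by rewrite ctpow0 ip_cst1.
have o := lincomb_orthonormal Hmu ctpow_bounded co c1.
have adjE n th : adjm (peval (mkpoly n.+1 (fun i => adjm (c n i))) (eit th)) =
    lincomb ctpow n.+1 (c n) th.
  rewrite peval_mkpoly lincomb_ctpowE adjm_sum; apply: eq_bigr => i _.
  by rewrite adjmZ adjmK conjcX.
exists (fun n => mkpoly n.+1 (fun i => adjm (c n i))); split.
- by apply: mkpoly1; rewrite c0 ?adjm1.
- by move=> n; exact: degle_mkpoly.
- move=> m n; rewrite eq_sym -o ipE; apply: eq_mint => th _.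
  by rewrite -!adjE adjmK.
- by move=> n; rewrite !coefm_mkpoly // -adjmV -adjmM (proj1 (cp n)).
Qed.

Lemma phiR_onp : is_onpR nu W (phiR nu W).
Proof. exact: ClassicalEpsilon.epsilon_spec onpR_exists. Qed.

Lemma phiL_onp : is_onpL nu W (phiL nu W).
Proof. exact: ClassicalEpsilon.epsilon_spec onpL_exists. Qed.

Lemma phiE n th : phi n th = peval (phiR nu W n) (eit th).
Proof. by rewrite phi.unlock. Qed.

Lemma rphiE n : rphi n = tmul n (fun th => adjm (peval (phiL nu W n) (eit th))).
Proof. by rewrite rphi.unlock. Qed.

Lemma phi_coef : exists c : nat -> nat -> 'M[C]_d,
  [/\ forall n, phi n = lincomb tpow n.+1 (c n), c 0%N 0%N = 1%:M
    & forall n, pdm (invmx (c n n) *m c n.+1 n.+1)].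
Proof.
have [p0 pd _ pp] := phiR_onp.
exists (fun n i => coefm (phiR nu W n) i); split; last exact: pp.
- by move=> n; apply: funext => th; rewrite lincomb_tpowE phiE (peval_degle _ (pd n)).
- by rewrite p0; apply/matrixP => a b; rewrite !mxE coefMn coef1.
Qed.

Lemma rphi_coef : exists s : nat -> nat -> 'M[C]_d,
  [/\ forall n, (fun th => adjm (peval (phiL nu W n) (eit th))) = lincomb ctpow n.+1 (s n),
      s 0%N 0%N = 1%:M
    & forall n, pdm (invmx (s n n) *m s n.+1 n.+1)].
Proof.
have [p0 pd _ pp] := phiL_onp.
exists (fun n i => adjm (coefm (phiL nu W n) i)); split.
- move=> n; apply: funext => th; rewrite lincomb_ctpowE (peval_degle _ (pd n)).
  by rewrite adjm_sum; apply: eq_bigr => i _; rewrite adjmZ conjcX.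
- rewrite p0; apply/matrixP => a b; rewrite adjmE !mxE eq_sym.
  by rewrite coefMn coef1; exact: rmorph_nat.
- by move=> n; rewrite -adjmV -adjmM (proj1 (pp n)).
Qed.

Lemma phi_bounded n : mbounded (phi n).
Proof. by have [c [-> _ _]] := phi_coef; apply: mbounded_lincomb; exact: tpow_bounded. Qed.

Lemma rphi_bounded n : mbounded (rphi n).
Proof.
rewrite rphiE; have [s [-> _ _]] := rphi_coef.
by apply: mbounded_tmul; apply: mbounded_lincomb; exact: ctpow_bounded.
Qed.

Lemma ip_phi m n : ip (phi m) (phi n) = if m == n then 1%:M else 0.
Proof. by have [_ _ <- _] := phiR_onp; rewrite ipE; apply: eq_mint => th _; rewrite !phiE. Qed.

Lemma ip_rphi n : ip (rphi n) (rphi n) = 1%:M.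
Proof.
have [_ _ h _] := phiL_onp; have := h n n; rewrite eqxx => <-.
by rewrite rphiE ip_tmul ipE; apply: eq_mint => th _; rewrite adjmK.
Qed.

Lemma phi_orth n l : (l < n)%N -> ip (tpow l) (phi n) = 0.
Proof.
have [c [pE c0 cp]] := phi_coef; have cu := pdm_ratio_unit c0 cp.
apply: (orthogonal_lincomb Hmu tpow_bounded (phi_bounded n) cu) => i i_n.
by rewrite -pE ip_phi ltn_eqF.
Qed.

(** [t^l = t^n conj(t)^(n - l)] with [n - l < n]: once [t^n] is removed, the adjoint of the left
    polynomial meets only lower powers of [conj t]. The power [t^0] would meet its leading one. *)
Lemma rphi_orth n l : (0 < l <= n)%N -> ip (tpow l) (rphi n) = 0.
Proof.
case/andP => l0 ln; have [s [pE s0 sp]] := rphi_coef; have su := pdm_ratio_unit s0 sp.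
have -> : tpow l = tmul n (ctpow (n - l)).
  by apply: funext => th; rewrite tmulE tpowE /ctpow scalerA eitX_conj.
rewrite rphiE ip_tmul pE.
have bl := mbounded_lincomb ctpow_bounded.
apply: (orthogonal_lincomb Hmu ctpow_bounded (bl _ _ _) su (n := n)) => [i i_n|]; last first.
  by rewrite ltn_subrL l0 (leq_trans l0 ln).
have [_ _ h _] := phiL_onp; have := h n i; rewrite gtn_eqF // => <-.
by rewrite -!pE ipE; apply: eq_mint => th _; rewrite adjmK.
Qed.

End OrthonormalPolynomials.

(** * The Szego recursion *)

Section SzegoRecursion.
Variables (R : realType) (d : nat) (nu : {measure set R -> \bar R}).
Variable W : R -> 'M[R[i]]_d.
Hypothesis (Hmu : is_mxmeasure nu W) (Hnt : nontrivial nu W).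
Local Notation C := R[i].
Local Notation fn m := (R -> 'M[C]_(d, m)).
Local Notation ip := (ip nu W).
Local Notation tp := (@tpow R d).
Local Notation lc := (lincomb tp).
Local Notation ph := (phi nu W).
Local Notation rph := (rphi nu W).

Lemma rphi_coef_tpow : exists s : nat -> nat -> 'M[C]_d,
  [/\ forall n, rph n = lc n.+1 (s n), s 0%N 0%N = 1%:M
    & forall n, pdm (invmx (s n 0%N) *m s n.+1 0%N)].
Proof.
have [s [sE s0 sp]] := rphi_coef Hmu Hnt.
exists (fun n i => s n (n - i)%N); split; [|exact: s0|].
  by move=> n; rewrite rphiE sE tmul_lincomb_ctpow.
by move=> n; rewrite !subn0; exact: sp.
Qed.

Lemma lincombD n m (x y : nat -> 'M[C]_(d, m)) :
  lc n x + lc n y = lc n (fun i => x i + y i).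
Proof. by rewrite /lincomb -big_split; apply: eq_bigr => i _; rewrite rmulDr. Qed.

Lemma lincombN n m (x : nat -> 'M[C]_(d, m)) : - lc n x = lc n (fun i => - x i).
Proof. by rewrite /lincomb -sumrN; apply: eq_bigr => i _; rewrite rmulNr. Qed.

Lemma tmul_sum e m I (r : seq I) (F : I -> fn m) :
  tmul e (\sum_(i <- r) F i) = \sum_(i <- r) tmul e (F i).
Proof.
elim: r => [|i r IHr]; last by rewrite !big_cons tmulD IHr.
by rewrite !big_nil; apply: funext => th; rewrite tmulE scaler0.
Qed.

Lemma tmul1_lincomb n m (x : nat -> 'M[C]_(d, m)) :
  tmul 1 (lc n x) = lc n.+1 (fun i => if i is j.+1 then x j else 0).
Proof.
rewrite /lincomb tmul_sum big_ord_recl.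
have -> : rmul (tp (@ord0 n)) (0 : 'M[C]_(d, m)) = 0.
  by apply: funext => th; rewrite rmulE mulmx0.
by rewrite add0r; apply: eq_bigr => i _; rewrite tmul_rmul /tpow tmul_tmul.
Qed.

Lemma lincomb_widen n m (x : nat -> 'M[C]_(d, m)) :
  lc n x = lc n.+1 (fun i => if (i < n)%N then x i else 0).
Proof.
rewrite /lincomb big_ord_recr /= ltnn.
have -> : rmul (tp n) (0 : 'M[C]_(d, m)) = 0 by apply: funext => th; rewrite rmulE mulmx0.
by rewrite addr0; apply: eq_bigr => i _; rewrite ltn_ord.
Qed.

(** Without its two extreme terms the polynomial is [t] times one of degree below [n], which is then
    orthogonal to all the powers that span it and has norm zero. An identity between polynomials of
    degree [n + 1] may thus be checked on the extreme coefficients and against [t, ..., t^n]. *)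
Lemma inner_lincomb_eq0 n (y : nat -> 'M[C]_d) : y 0%N = 0 -> y n.+1 = 0 ->
  (forall l, (0 < l <= n)%N -> ip (tp l) (lc n.+2 y) = 0) -> lc n.+2 y = 0.
Proof.
move=> y0 yn yo; pose x i := y i.+1.
have yE : lc n.+2 y = tmul 1 (lc n x).
  rewrite tmul1_lincomb /lincomb big_ord_recr /= yn.
  have -> : rmul (tp n.+1) (0 : 'M[C]_d) = 0 by apply: funext => th; rewrite rmulE mulmx0.
  by rewrite addr0; apply: eq_bigr => -[[|i] lt_i] _ //=; rewrite y0.
have bl := mbounded_lincomb (@tpow_bounded R d).
have xx0 : ip (lc n x) (lc n x) = 0.
  apply: ip_lincomb_eq0 => // [|l ln]; first exact: tpow_bounded.
  rewrite -(ip_tmul _ _ 1) -yE /tpow tmul_tmul; exact: (yo l.+1).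
have xv i : (i < n)%N -> x i = 0.
  move=> i_n; apply/matrixP => a b; rewrite [RHS]mxE.
  (* Independence concerns vector coefficients, so it is applied to column [b] of the matrices
     [x i]. *)
  have := @tpow_indep _ _ _ _ Hnt n (fun i => x i *m delta_mx b 0).
  rewrite -rmul_lincomb => /(_ _ i i_n).
  rewrite ip_rmul ?ip_rmull ?xx0 ?mulmx0 ?mul0mx //; last exact: mbounded_rmul.
  by move=> /(_ erefl)/matrixP/(_ a 0); rewrite -colE !mxE.
rewrite yE tmul1_lincomb /lincomb big1 // => -[[|i] lt_i] _ /=.
  by apply: funext => th; rewrite rmulE mulmx0.
by rewrite xv //; apply: funext => th; rewrite rmulE mulmx0.
Qed.

(** [D = P a - a Q] satisfies [P D + D Q = P^2 a - a Q^2 = 0], a Sylvester equation. *)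
Lemma rho_intertwine (a : 'M[C]_d) (P Q : 'M[C]_d) : pdm P -> pdm Q ->
  P *m P = 1%:M - a *m adjm a -> Q *m Q = 1%:M - adjm a *m a -> P *m a = a *m Q.
Proof.
move=> pP pQ PP QQ; apply/eqP; rewrite -subr_eq0; apply/eqP.
apply: sylvester_eq0 pP (pdm_psdm pQ) _.
rewrite mulmxBr mulmxBl !mulmxA addrA subrK PP -mulmxA QQ.
by rewrite mulmxBl mulmxBr mul1mx mulmx1 !mulmxA subrr.
Qed.

(** Strict contractivity of [a] in the form used below: the chosen roots [rhoL a], [rhoR a] really
    are positive definite roots of the defects. *)
Definition defect_pos (a : 'M[C]_d) :=
  [/\ pdm (rhoL a), pdm (rhoR a), rhoL a *m rhoL a = 1%:M - adjm a *m a
    & rhoR a *m rhoR a = 1%:M - a *m adjm a].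

(** Two expansions, [E1] of [t phi_n] and [E2] of [phi*_n], have definite coefficients [r] and [q]
    by positivity of the ratios of leading coefficients. Inner products then give [a = g^*],
    [r^2 = 1 - g g^*] and [q^2 = 1 - g^* g], and uniqueness of roots identifies [r] and [q] with
    [rhoR g] and [rhoL g]. *)
Lemma szego n : exists g : 'M[C]_d,
  [/\ defect_pos g,
      tmul 1 (ph n) = rmul (rph n) (adjm g) + rmul (ph n.+1) (rhoR g)
    & rph n.+1 = rmul (rph n) (rhoL g) - rmul (ph n.+1) g].
Proof.
have [c [cE c0 cp]] := phi_coef Hmu Hnt; have cu := pdm_ratio_unit c0 cp.
have [s [sE s0 sp]] := rphi_coef_tpow.
have su m : s m 0%N \in unitmx.
  elim: m => [|m IHm]; first by rewrite s0 unitmx1.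
  by have /pdm_unit := sp m; rewrite unitmx_mul => /andP[].
have bl := mbounded_lincomb (@tpow_bounded R d).
have bp := phi_bounded Hmu Hnt; have bs := rphi_bounded Hmu Hnt.
have btp m : mbounded (tmul 1 (ph m)) by exact: mbounded_tmul.
have bt := @tpow_bounded R d.
have br m P (a : 'M[C]_(d, m)) : mbounded P -> mbounded (rmul P a).
  exact: mbounded_rmul.
have to m l : (0 < l <= m)%N -> ip (tp l) (tmul 1 (ph m)) = 0.
  case: l => // l lm; have -> : tp l.+1 = tmul 1 (tp l) by rewrite /tpow tmul_tmul.
  by rewrite ip_tmul phi_orth.
(* [r] matches the coefficients of [t^(n+1)] and [a] the constant ones; the interior powers are
   settled by orthogonality. *)
pose r := invmx (c n.+1 n.+1) *m c n n.
have pr : pdm r.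
  have := pdm_inv (cp n); congr pdm.
  by apply: mulmx1_invmx; rewrite /r mulmxA mulmxK ?mulVmx.
pose a := - (invmx (s n 0%N) *m (c n.+1 0%N *m r)).
have b1 : mbounded (rmul (rph n) a) by exact: br.
have b2 : mbounded (rmul (ph n.+1) r) by exact: br.
have b12 : mbounded (rmul (rph n) a + rmul (ph n.+1) r) by exact: mboundedD.
have E1 : tmul 1 (ph n) = rmul (rph n) a + rmul (ph n.+1) r.
  apply/eqP; rewrite -subr_eq0; apply/eqP.
  have DE : tmul 1 (ph n) - (rmul (rph n) a + rmul (ph n.+1) r) =
    lc n.+2 (fun i => (if i is j.+1 then c n j else 0) -
      ((if (i < n.+1)%N then s n i *m a else 0) + c n.+1 i *m r)).
    by rewrite !cE sE tmul1_lincomb !rmul_lincomb (lincomb_widen n.+1) lincombD lincombN lincombD.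
  rewrite DE; apply: inner_lincomb_eq0.
  - by rewrite ltnS leq0n /a mulmxN mulKVmx // sub0r addNr oppr0.
  - by rewrite ltnn add0r /r mulKVmx // subrr.
  move=> l ln; rewrite -DE ipBr // ipDr // !ip_rmul //.
  case/andP: (ln) => _ ln'.
  by rewrite to // rphi_orth // phi_orth ?ltnS // !mul0mx addr0 subrr.
clearbody r a.
(* In this expansion [q] matches the constant coefficients and [g] those of [t^(n+1)]. *)
pose q := invmx (s n.+1 0%N) *m s n 0%N.
have pq : pdm q.
  have := pdm_inv (sp n); congr pdm.
  by apply: mulmx1_invmx; rewrite /q mulmxA mulmxK ?mulVmx.
pose g := - (invmx (c n n) *m (s n.+1 n.+1 *m q)).
have b3 : mbounded (rmul (rph n.+1) q) by exact: br.
have b4 : mbounded (rmul (tmul 1 (ph n)) g) by exact: br.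
have b34 : mbounded (rmul (rph n.+1) q + rmul (tmul 1 (ph n)) g) by exact: mboundedD.
have E2 : rph n = rmul (rph n.+1) q + rmul (tmul 1 (ph n)) g.
  apply/eqP; rewrite -subr_eq0; apply/eqP.
  have DE : rph n - (rmul (rph n.+1) q + rmul (tmul 1 (ph n)) g) =
    lc n.+2 (fun i => (if (i < n.+1)%N then s n i else 0) -
      (s n.+1 i *m q + (if i is j.+1 then c n j else 0) *m g)).
    by rewrite !sE cE tmul1_lincomb !rmul_lincomb (lincomb_widen n.+1) lincombD lincombN lincombD.
  rewrite DE; apply: inner_lincomb_eq0.
  - by rewrite ltnS leq0n /q mulKVmx // mul0mx addr0 subrr.
  - by rewrite ltnn /g mulmxN mulKVmx // subrr oppr0 addr0.
  move=> l ln; rewrite -DE ipBr // ipDr // !ip_rmul //.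
  case/andP: (ln) => l0 ln'.
  by rewrite to // !rphi_orth ?l0 ?(leqW ln') // !mul0mx addr0 subrr.
clearbody q g.
have o1 : ip (rph n) (ph n.+1) = 0.
  by rewrite sE; apply: ip_lincomb_eq0 => // l; exact: phi_orth.
have o2 : ip (tmul 1 (ph n)) (rph n.+1) = 0.
  rewrite cE tmul1_lincomb; rewrite ip_lincombl // big1 // => -[[|i] li] _ /=.
    by rewrite adjm0 mul0mx.
  by rewrite rphi_orth ?mulmx0.
have aE : a = ip (rph n) (tmul 1 (ph n)).
  by rewrite E1 ipDr // !ip_rmul // ip_rphi // o1 mul0mx mul1mx addr0.
have gE : g = ip (tmul 1 (ph n)) (rph n).
  rewrite [in RHS]E2 ipDr // !ip_rmul //.
  by rewrite o2 ip_tmul ip_phi // eqxx mul0mx mul1mx add0r.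
have ag : a = adjm g by rewrite gE aE ip_adj.
have rr : r *m r = 1%:M - g *m adjm g.
  have : ip (tmul 1 (ph n)) (tmul 1 (ph n)) = 1%:M by rewrite ip_tmul ip_phi // eqxx.
  rewrite {2}E1 ipDr // !ip_rmul //.
  rewrite -gE ag => <-; rewrite addrC addKr E1 ipDl // !ip_rmull //.
  by rewrite o1 ip_phi // eqxx mulmx0 add0r mulmx1 (proj1 pr).
have qq : q *m q = 1%:M - adjm g *m g.
  have : ip (rph n) (rph n) = 1%:M by rewrite ip_rphi.
  rewrite {2}E2 ipDr // !ip_rmul //.
  rewrite -aE ag => <-; rewrite addrK E2 ipDl // !ip_rmull //.
  by rewrite o2 ip_rphi // mulmx0 addr0 mulmx1 (proj1 pq).
have rR : rhoR g = r by exact: sqrtmE.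
have rL : rhoL g = q by exact: sqrtmE.
exists g; rewrite /defect_pos rR rL; split => //; first by rewrite -ag.
have rg := rho_intertwine pr pq rr qq.
(* The second relation follows by inserting [E1] for [t phi_n] in [E2] and cancelling [q] on the
   right. *)
have qu := pdm_unit pq.
rewrite -[LHS]rmul1 -(mulmxV qu) -rmul_rmul.
have -> : rmul (rph n.+1) q = rmul (rph n) (q *m q) - rmul (ph n.+1) (g *m q).
  have -> : rmul (rph n.+1) q = rph n - rmul (tmul 1 (ph n)) g by rewrite {1}E2 addrK.
  by rewrite qq rmulDr rmul1 rmulNr E1 rmulDl !rmul_rmul ag rg opprD addrA.
by rewrite rmulDl rmulNl !rmul_rmul -!mulmxA mulmxV // !mulmx1.
Qed.

End SzegoRecursion.

(** * Limits of matrix functions *)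

Section Limits.
Variable R : realType.
Local Notation C := R[i].

Definition nrm m n (A : 'M[C]_(m, n)) : C := \sum_a \sum_b `|A a b|.

Lemma nrm_ge0 m n (A : 'M[C]_(m, n)) : 0 <= nrm A.
Proof. by apply: sumr_ge0 => a _; apply: sumr_ge0 => b _. Qed.

Lemma le_nrm m n (A : 'M[C]_(m, n)) a b : `|A a b| <= nrm A.
Proof.
rewrite /nrm (bigD1 a) //= (bigD1 b) //= -addrA lerDl addr_ge0 //.
  by apply: sumr_ge0.
by apply: sumr_ge0 => i _; apply: sumr_ge0.
Qed.

Lemma nrmD m n (A B : 'M[C]_(m, n)) : nrm (A + B) <= nrm A + nrm B.
Proof.
rewrite /nrm -big_split; apply: ler_sum => a _; rewrite -big_split.
by apply: ler_sum => b _; rewrite mxE ler_normD.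
Qed.

Lemma nrmZ m n c (A : 'M[C]_(m, n)) : nrm (c *: A) = `|c| * nrm A.
Proof.
rewrite /nrm mulr_sumr; apply: eq_bigr => a _; rewrite mulr_sumr.
by apply: eq_bigr => b _; rewrite mxE normrM.
Qed.

Lemma nrmM m n p (A : 'M[C]_(m, n)) (B : 'M[C]_(n, p)) : nrm (A *m B) <= nrm A * nrm B.
Proof.
rewrite {1 2}/nrm mulr_suml; apply: ler_sum => a _.
rewrite mulr_suml.
apply: le_trans (_ : \sum_b \sum_j `|A a j| * `|B j b| <= _).
  apply: ler_sum => b _; rewrite mxE (le_trans (ler_norm_sum _ _ _)) //.
  by apply: ler_sum => j _; rewrite normrM.
rewrite exchange_big; apply: ler_sum => j _ /=; rewrite -mulr_sumr ler_wpM2l //.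
by rewrite /nrm (bigD1 j) //= lerDl; apply: sumr_ge0 => i _; apply: sumr_ge0.
Qed.

Lemma real_of_pos (x : C) : 0 < x -> exists2 r : R, 0 < r & x = r%:C%C.
Proof.
move=> x0; exists (complex.Re x); first by move: x0; rewrite ltcE => /andP[].
by rewrite RRe_real // gtr0_real.
Qed.

(** Agreement at points arbitrarily close to [z0] suffices, which covers both uniqueness of limits
    and functions that agree off the roots of a polynomial. *)
Lemma has_limz_frequently m n (h1 h2 : C -> 'M[C]_(m, n)) z0 L1 L2 :
  has_limz h1 z0 L1 -> has_limz h2 z0 L2 ->
  (forall e : R, 0 < e -> exists w, [/\ w != z0, `|w - z0| < e%:C%C & h1 w = h2 w]) ->
  L1 = L2.
Proof.
move=> lim1 lim2 freq; apply/matrixP => a b; apply/eqP; rewrite -subr_eq0.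
apply: contraT; rewrite -normr_gt0 => /real_of_pos[r r0 rE].
have [|d1 d10 D1] := lim1 (r / 2); first by rewrite divr_gt0.
have [|d2 d20 D2] := lim2 (r / 2); first by rewrite divr_gt0.
have [|w [wz we hw]] := freq (Num.min d1 d2); first by rewrite lt_min d10.
have w1 : `|w - z0| < d1%:C%C by apply: lt_le_trans we _; rewrite lecR ge_min lexx.
have w2 : `|w - z0| < d2%:C%C by apply: lt_le_trans we _; rewrite lecR ge_min lexx orbT.
have l1 := D1 _ wz w1 a b; have l2 := D2 _ wz w2 a b.
have : `|L1 a b - L2 a b| < (r / 2)%:C%C + (r / 2)%:C%C.
  apply: le_lt_trans (ltrD l1 l2).
  rewrite hw [X in _ <= X + _]distrC (le_trans _ (ler_normD _ _)) //.
  by rewrite addrA subrK.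
by rewrite -rmorphD -splitr rE ltxx.
Qed.

Lemma has_limz_unique m n (h : C -> 'M[C]_(m, n)) z0 L1 L2 :
  has_limz h z0 L1 -> has_limz h z0 L2 -> L1 = L2.
Proof.
move=> h1 h2; apply: has_limz_frequently h1 h2 _ => e e0.
have ne : `|z0 + (e / 2)%:C%C - z0| = (e / 2)%:C%C.
  by rewrite addrC addKr ger0_norm // ler0c divr_ge0 // ltW.
exists (z0 + (e / 2)%:C%C); split=> //.
  by rewrite -subr_eq0 -normr_eq0 ne; apply: lt0r_neq0; rewrite ltcR divr_gt0.
by rewrite ne ltcR ltr_pdivrMr // ltr_pMr // ltr1n.
Qed.

Lemma limzE m n (h : C -> 'M[C]_(m, n)) z0 L : has_limz h z0 L -> limz h z0 = L.
Proof.
move=> hL; apply: (@has_limz_unique _ _ h z0) => //.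
exact: (ClassicalEpsilon.epsilon_spec (inhabits 0) _ (ex_intro _ L hL)).
Qed.

Lemma extend0E m n (h : C -> 'M[C]_(m, n)) z : z != 0 -> extend0 h z = h z.
Proof. by rewrite /extend0 => /negbTE ->. Qed.

Lemma extend0_0 m n (h : C -> 'M[C]_(m, n)) L : has_limz h 0 L -> extend0 h 0 = L.
Proof. by rewrite /extend0 eqxx; exact: limzE. Qed.

Lemma eq_has_limz m n (h g : C -> 'M[C]_(m, n)) z0 L (r : R) : 0 < r ->
  (forall w, w != z0 -> `|w - z0| < r%:C%C -> h w = g w) ->
  has_limz h z0 L -> has_limz g z0 L.
Proof.
move=> r0 hg hL e /hL[s s0 sP]; exists (Num.min r s); first by rewrite lt_min r0.
move=> w wz wr a b.
have h1 : `|w - z0| < r%:C%C by apply: lt_le_trans wr _; rewrite lecR ge_min lexx.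
have h2 : `|w - z0| < s%:C%C by apply: lt_le_trans wr _; rewrite lecR ge_min lexx orbT.
by rewrite -hg //; apply: sP.
Qed.

Lemma has_limz_lipschitz m n (h : C -> 'M[C]_(m, n)) (z0 : C) (L : 'M[C]_(m, n)) (K r : R) : 0 < K -> 0 < r ->
  (forall w, w != z0 -> `|w - z0| < r%:C%C ->
    forall a b, `|h w a b - L a b| <= K%:C%C * `|w - z0|) ->
  has_limz h z0 L.
Proof.
move=> K0 r0 hK e e0; exists (Num.min r (e / K)); first by rewrite lt_min r0 divr_gt0.
move=> w wz wr a b; have KC : 0 < K%:C%C :> C by rewrite ltcR.
have h1 : `|w - z0| < r%:C%C by apply: lt_le_trans wr _; rewrite lecR ge_min lexx.
have h2 : `|w - z0| < (e / K)%:C%C by apply: lt_le_trans wr _; rewrite lecR ge_min lexx orbT.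
apply: le_lt_trans (hK w wz h1 a b) _.
have -> : e%:C%C = K%:C%C * (e / K)%:C%C by rewrite -rmorphM mulrC divfK ?gt_eqF.
by rewrite ltr_pM2l.
Qed.

End Limits.

(** * Cauchy transforms and the Schur algorithm *)

(** The bracket [<X, A>_z], with the kernel attached to the second entry. *)
HB.lock Definition cip (R : realType) d (nu : {measure set R -> \bar R})
    (W : R -> 'M[R[i]]_d) z m n (X : R -> 'M[R[i]]_(d, m)) (A : R -> 'M[R[i]]_(d, n)) :=
  ip nu W X (cauchy z A).

Section SchurIterates.
Variables (R : realType) (d : nat) (nu : {measure set R -> \bar R}).
Variable W : R -> 'M[R[i]]_d.
Hypothesis (Hmu : is_mxmeasure nu W) (Hnt : nontrivial nu W).
Local Notation C := R[i].
Local Notation fn m := (R -> 'M[C]_(d, m)).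
Local Notation ip := (ip nu W).
Local Notation cip := (cip nu W).
Local Notation tp := (@tpow R d).
Local Notation lc := (lincomb tp).
Local Notation ph := (phi nu W).
Local Notation rph := (rphi nu W).

Lemma cipE z m n (X : fn m) (A : fn n) : cip z X A = ip X (cauchy z A).
Proof. by rewrite cip.unlock. Qed.

Lemma tmul_tpow e i : tmul e (tp i) = tp (e + i).
Proof. exact: tmul_tmul. Qed.

(** [t / (t - z) = 1 + z / (t - z)]. *)
Lemma cip_tmul z m n (X : fn m) (A : fn n) : `|z| < 1 -> mbounded X -> mbounded A ->
  cip z X (tmul 1 A) = z *: cip z X A + ip X A.
Proof.
move=> z1 bX bA; have bc := mbounded_cauchy z1 bA.
rewrite !cipE cauchy_tmul -[X in _ = _ + ip _ X](cauchyK A z1) ipBr //.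
- by rewrite ipZr // addrC subrK.
- exact: mbounded_tmul.
- exact: mbounded_scale.
Qed.

Lemma cip_rmul z m n p (X : fn m) (A : fn n) (a : 'M[C]_(n, p)) : `|z| < 1 ->
  mbounded X -> mbounded A -> cip z X (rmul A a) = cip z X A *m a.
Proof. by move=> z1 bX bA; rewrite !cipE cauchy_rmul ip_rmul //; exact: mbounded_cauchy. Qed.

Lemma cip_sumr z m n (X : fn m) I (r : seq I) (F : I -> fn n) : `|z| < 1 ->
  mbounded X -> (forall i, mbounded (F i)) ->
  cip z X (\sum_(i <- r) F i) = \sum_(i <- r) cip z X (F i).
Proof.
move=> z1 bX bF; rewrite cipE; under [in RHS]eq_bigr do rewrite cipE.
rewrite -ip_sumr // => [|i]; last exact: mbounded_cauchy.
congr ip; elim: r => [|i r IHr]; last by rewrite !big_cons cauchyD IHr.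
by rewrite !big_nil; apply: funext => th; rewrite cauchyE scaler0.
Qed.

(* [t^(l+1) / (t - z) = t^l + z t^l / (t - z)], where [X] annihilates the first term. *)
Lemma cip_eval z e n m p (X : fn m) (x : nat -> 'M[C]_(d, p)) : `|z| < 1 -> mbounded X ->
  (forall l, (l < n)%N -> ip X (tp (e + l)) = 0) ->
  cip z X (tmul e (lc n.+1 x)) = cip z X (tp e) *m \sum_(i < n.+1) z ^+ i *: x i.
Proof.
move=> z1 bX o; have bt := @tpow_bounded R d.
have step l : (l <= n)%N -> cip z X (tp (e + l)) = z ^+ l *: cip z X (tp e).
  elim: l => [|l IHl] ln; first by rewrite addn0 expr0 scale1r.
  have -> : tp (e + l.+1) = tmul 1 (tp (e + l)) by rewrite tmul_tpow addnS.
  by rewrite (cip_tmul z1 bX (bt _)) (o _ ln) addr0 (IHl (ltnW ln)) scalerA exprS.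
rewrite tmul_sum cip_sumr // => [|i]; last by apply: mbounded_tmul; exact: mbounded_rmul.
rewrite mulmx_sumr; apply: eq_bigr => i _.
rewrite tmul_rmul tmul_tpow (cip_rmul _ z1 bX (bt _)) (step i (ltn_ord i)).
by rewrite -scalemxAl -scalemxAr.
Qed.

(** For [|z| <= 1/2] the kernel is at most 2 in modulus on the circle. The summand 1 in the constant
    keeps it positive. *)
Lemma cip_bound m n (X : fn m) (A : fn n) : mbounded X -> mbounded A ->
  exists2 B : R, 0 < B & forall z : C, `|z| <= 2^-1 -> nrm (cip z X A) <= B%:C%C.
Proof.
move=> bX bA; have iXA := mintegrable_ip Hmu bX bA.
have h a b : exists B : R, 0 <= B /\ forall z : C, `|z| <= 2^-1 -> `|cip z X A a b| <= B%:C%C.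
  have [B B0 hB] := cint_bound (iXA a b); exists (2 * B); split; first by rewrite mulr_ge0.
  move=> z z2; have z1 : `|z| < 1 by apply: le_lt_trans z2 _; rewrite invf_lt1 ?ltr1n.
  have hc th : `|(eit th - z)^-1| <= 2%:C%C.
    rewrite normfV -[X in _ <= X]invrK.
    have -> : (2%:C%C)^-1 = `|eit th| - 2^-1 :> C.
      by rewrite norm_eit (rmorph_nat _ 2) {2}[1](splitr 1) div1r addrK.
    have h2 : `|eit th| - 2^-1 <= `|eit th - z|.
      rewrite lerBlDr (le_trans _ (lerD (lexx _) z2)) //.
      by rewrite -[X in `|X| <= _](subrK z) ler_normD.
    have h0 : 0 < `|eit th| - 2^-1.
      by rewrite norm_eit subr_gt0 invf_lt1 ?ltr1n.
    by rewrite lef_pV2 // posrE // (lt_le_trans h0).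
  have -> : cip z X A a b = cint nu (fun th => (eit th - z)^-1 *
      (adjm (X th) *m W th *m A th) a b).
    rewrite cipE ipE mintE; apply: eq_cint => th _.
    by rewrite cauchyE -scalemxAr mxE.
  by apply: hB hc; exact: cbounded_cauchy.
have [B /all_and2[B0 hB]] := choice (fun ab => h ab.1 ab.2).
exists (1 + \sum_a \sum_b B (a, b)).
  rewrite ltr_pwDl //; apply: sumr_ge0 => a _; apply: sumr_ge0 => b _; exact: B0.
move=> z z2; apply: (@le_trans _ _ (\sum_a \sum_b B (a, b))%:C%C); last by rewrite lecR lerDr.
rewrite rmorph_sum; apply: ler_sum => a _; rewrite rmorph_sum; apply: ler_sum => b _.
exact: (hB (a, b)).
Qed.


Lemma cipDl z m n (X Y : fn m) (A : fn n) : `|z| < 1 -> mbounded X -> mbounded Y ->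
  mbounded A -> cip z (X + Y) A = cip z X A + cip z Y A.
Proof. by move=> z1 bX bY bA; rewrite !cipE ipDl //; exact: mbounded_cauchy. Qed.

Lemma cipBl z m n (X Y : fn m) (A : fn n) : `|z| < 1 -> mbounded X -> mbounded Y ->
  mbounded A -> cip z (X - Y) A = cip z X A - cip z Y A.
Proof. by move=> z1 bX bY bA; rewrite !cipE ipBl //; exact: mbounded_cauchy. Qed.

Lemma cip_rmull z m n p (X : fn m) (A : fn n) (a : 'M[C]_(m, p)) : `|z| < 1 ->
  mbounded X -> mbounded A -> cip z (rmul X a) A = adjm a *m cip z X A.
Proof. by move=> z1 bX bA; rewrite !cipE ip_rmull //; exact: mbounded_cauchy. Qed.

Lemma cip_tmul2 z e m n (X : fn m) (A : fn n) : cip z (tmul e X) (tmul e A) = cip z X A.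
Proof. by rewrite !cipE cauchy_tmul ip_tmul. Qed.

Lemma extend0_cont m n (h : C -> 'M[C]_(m, n)) L :
  has_limz (extend0 h) 0 L -> extend0 h 0 = L.
Proof.
move=> hL; apply: extend0_0; apply: eq_has_limz hL; first exact: ltr01.
by move=> w w0 _; rewrite extend0E.
Qed.

(** One Schur step at the level of brackets: with [f P = <phi_n, 1>_z], [P = <phi*_n, t>_z],
    [Q = <phi_(n+1), t>_z] and [P' = <phi*_(n+1), t>_z], the step produces [Q P'^-1] up to the
    factor [z^-1]. Since [rhoL g P' = (1 - g^* f) P], invertibility of [P'] yields that of
    [1 - g^* f]. *)
Lemma schur_step_solve (f g P Q P' : 'M[C]_d) : defect_pos g -> P' \in unitmx ->
  f *m P = g *m P + rhoR g *m Q -> P' = rhoL g *m P - adjm g *m Q ->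
  invmx (rhoR g) *m (f - g) *m invmx (1%:M - adjm g *m f) *m rhoL g *m P' = Q.
Proof.
case=> pL pR LL RR P'u fP P'E.
have [Lu Ru] := (pdm_unit pL, pdm_unit pR).
have gR : rhoL g *m adjm g = adjm g *m rhoR g.
  have := congr1 (@adjm _ _ _) (rho_intertwine pR pL RR LL).
  by rewrite !adjmM (proj1 pL) (proj1 pR) => <-.
have RQ : rhoR g *m Q = (f - g) *m P by rewrite mulmxBl fP addrC addKr.
have E : rhoL g *m P' = (1%:M - adjm g *m f) *m P.
  rewrite P'E mulmxBr !mulmxA LL gR -[_ *m rhoR g *m Q]mulmxA RQ.
  by rewrite mulmxA -mulmxBl; congr (_ *m P); rewrite mulmxBr opprB addrA subrK.
have : (1%:M - adjm g *m f) *m P \in unitmx by rewrite -E unitmx_mul Lu.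
rewrite unitmx_mul => /andP[u _].
by rewrite -!mulmxA E mulKmx // -RQ mulKmx.
Qed.

(** [(t + z) / (t - z) = 2 t / (t - z) - 1]. *)
Lemma caraF_pair z m n (X : fn m) (Y : fn n) : `|z| < 1 -> mbounded X -> mbounded Y ->
  mint nu (fun th => ((eit th + z) / (eit th - z)) *: (adjm (X th) *m W th *m Y th)) =
  2%:R *: cip z X (tmul 1 Y) - ip X Y.
Proof.
move=> z1 bX bY.
have bc : mbounded (cauchy z (tmul 1 Y)).
  by apply: mbounded_cauchy => //; exact: mbounded_tmul.
rewrite cipE -ipZr // -ipBr //; last exact: mbounded_scale.
rewrite ipE; apply: eq_mint => th _.
rewrite addrfctE opprfctE scalrfctE cauchyE tmulE expr1.
rewrite mulmxBr -!scalemxAr !scalerA.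
move: (adjm (X th) *m W th *m Y th) => A.
rewrite -{3}[A]scale1r -scalerBl; congr (_ *: _).
by field; apply: eit_subr_neq0.
Qed.

Lemma caraF_cip z : `|z| < 1 -> caraF nu W z =
  2%:R *: cip z (cstf 1%:M) (tmul 1 (cstf 1%:M)) - 1%:M.
Proof.
move=> z1; have b1 := @mbounded_cst R d d 1%:M.
rewrite -[X in _ - X](ip_cst1 Hmu) -caraF_pair //; apply: eq_mint => th _.
by rewrite /cstf adjm1 mul1mx mulmx1.
Qed.

(** [F + 1 = 2 H] and [F - 1 = 2 z G], so the factors 2 and [z] cancel. *)
Lemma schur_raw n (F G H : 'M[C]_n) z : z != 0 -> H \in unitmx ->
  H = 1%:M + z *: G -> F = 2%:R *: H - 1%:M ->
  z^-1 *: ((F - 1%:M) *m invmx (F + 1%:M)) = G *m invmx H.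
Proof.
move=> z0 Hu HE FE; have n2 : 2%:R != 0 :> C by rewrite pnatr_eq0.
have -> : F + 1%:M = 2%:R *: H by rewrite FE subrK.
have -> : F - 1%:M = 2%:R *: (z *: G).
  by rewrite FE HE scalerDr scaler_nat mulr2n -addrA -opprD addrAC subrr add0r.
have u2 : 2%:R *: H \in unitmx by rewrite unitmxZ ?unitfE.
rewrite (invmxZ u2) -!scalemxAl -scalemxAr !scalerA.
set c := (X in X *: _); have -> : c = 1 by rewrite /c; field.
by rewrite scale1r.
Qed.

Variable g : nat -> 'M[C]_d.
Hypothesis gP : forall n, [/\ defect_pos (g n),
  tmul 1 (ph n) = rmul (rph n) (adjm (g n)) + rmul (ph n.+1) (rhoR (g n))
  & rph n.+1 = rmul (rph n) (rhoL (g n)) - rmul (ph n.+1) (g n)].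

Let bp := phi_bounded Hmu Hnt.
Let bs := rphi_bounded Hmu Hnt.

(** Multiplying both entries by [t] leaves the bracket unchanged and puts [t phi_n] in the first,
    where the recursion applies. *)
Lemma cip_phi n z p (A : fn p) : `|z| < 1 -> mbounded A ->
  cip z (ph n) A = g n *m cip z (rph n) (tmul 1 A) + rhoR (g n) *m cip z (ph n.+1) (tmul 1 A).
Proof.
move=> z1 bA; have [[_ [hR _] _ _] E _] := gP n.
have bt : mbounded (tmul 1 A) by exact: mbounded_tmul.
rewrite -(cip_tmul2 z 1) E cipDl //; try exact: mbounded_rmul.
by rewrite !cip_rmull // adjmK hR.
Qed.

Lemma cip_rphi n z p (A : fn p) : `|z| < 1 -> mbounded A ->
  cip z (rph n.+1) A = rhoL (g n) *m cip z (rph n) A - adjm (g n) *m cip z (ph n.+1) A.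
Proof.
move=> z1 bA; have [[[hL _] _ _ _] _ E] := gP n.
rewrite E cipBl //; try exact: mbounded_rmul.
by rewrite !cip_rmull // hL.
Qed.

Lemma phi_orthl n l : (l < n)%N -> ip (ph n) (tp l) = 0.
Proof.
by move=> ln; rewrite -ip_adj ?phi_orth ?adjm0 //; exact: tpow_bounded.
Qed.

Lemma rphi_orthl n l : (0 < l <= n)%N -> ip (rph n) (tp l) = 0.
Proof.
by move=> ln; rewrite -ip_adj ?rphi_orth ?adjm0 //; exact: tpow_bounded.
Qed.

(** As [phi*_n] is orthogonal to [t, ..., t^n], the invertible bracket [<phi*_n, t phi*_n>_z]
    factors as [<phi*_n, t>_z] times the value at [z] of the polynomial [phi*_n]. *)
Lemma cip_rphi_unit n z : `|z| < 1 -> cip z (rph n) (tp 1) \in unitmx.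
Proof.
move=> z1; have [s [sE _ _]] := rphi_coef_tpow Hmu Hnt.
have := ip_cauchy_unit Hmu (bs n) (ip_rphi Hmu Hnt n) z1.
rewrite -cipE {2}sE (cip_eval _ z1 (bs n)).
  by rewrite unitmx_mul => /andP[].
by move=> l ln; rewrite rphi_orthl.
Qed.

Local Notation f n := (schur_iter (schur_fun nu W) n).

Lemma schur_iter_extend0 n : exists h, f n = extend0 h.
Proof. by case: n => [|n]; eexists. Qed.

(** The induction step of the identification, kept apart because the limit at level [n] is needed
    before level [n + 1] is reached. Taking [A = phi*_n] in the extended identity isolates
    [f_n - g n]. *)
Lemma schur_iter_limz n :
  (forall z, z != 0 -> `|z| < 1 ->
     cip z (ph n) (tp 0) = f n z *m cip z (rph n) (tp 1)) ->
  (forall z p (x : nat -> 'M[C]_(d, p)), z != 0 -> `|z| < 1 ->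
     cip z (ph n) (lc n.+1 x) = f n z *m cip z (rph n) (tmul 1 (lc n.+1 x))) /\
  has_limz (f n) 0 (g n).
Proof.
move=> fE; have fE' z p (x : nat -> 'M[C]_(d, p)) : z != 0 -> `|z| < 1 ->
     cip z (ph n) (lc n.+1 x) = f n z *m cip z (rph n) (tmul 1 (lc n.+1 x)).
  move=> z0 z1; have := @cip_eval z 0 n _ _ (ph n) x z1 (bp n).
  rewrite tmul0 => -> => [|l ln]; last by rewrite phi_orthl.
  rewrite (fE z z0 z1) (cip_eval _ z1 (bs n)) ?mulmxA // => l ln.
  by rewrite rphi_orthl.
split=> //.
have [s [sE _ _]] := rphi_coef_tpow Hmu Hnt.
have [B1 B10 hB1] := cip_bound (bp n.+1) (bs n).
have [B2 B20 hB2] := cip_bound (bs n) (bs n).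
have [r r0 rE] : exists2 r : R, 0 <= r & nrm (rhoR (g n)) = r%:C%C.
  exists (complex.Re (nrm (rhoR (g n)))).
    by have := nrm_ge0 (rhoR (g n)); rewrite lecE => /andP[].
  by rewrite RRe_real // ger0_real // nrm_ge0.
have bts : mbounded (tmul 1 (rph n)) by exact: mbounded_tmul.
have o1 : ip (ph n.+1) (rph n) = 0.
  rewrite -ip_adj // sE ip_lincombl ?big1 ?adjm0 // => [i _|]; last exact: tpow_bounded.
  by rewrite phi_orth // mulmx0.
(* The identity [<phi_n, phi*_n>_w = f_n <phi*_n, t phi*_n>_w] expanded on both sides, with
   [t / (t - w) = 1 + w / (t - w)]; the brackets without kernel are 0 and 1. *)
have DE w : w != 0 -> `|w| < 1 -> f n w - g n =
    w *: (rhoR (g n) *m cip w (ph n.+1) (rph n) - (f n w - g n) *m cip w (rph n) (rph n)).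
  move=> w0 w1; have := fE' w d (s n) w0 w1; rewrite -sE (cip_phi n w1 (bs n)).
  rewrite (cip_tmul w1 (bs n) (bs n)) (cip_tmul w1 (bp n.+1) (bs n)) o1 addr0 ip_rphi //.
  set J := cip w (rph n) (rph n); set K := cip w (ph n.+1) (rph n).
  rewrite !mulmxDr !mulmx1 -!scalemxAr => E.
  rewrite scalerBr mulmxBl scalerBr opprB.
  have fwE : f n w = w *: (g n *m J) + g n + w *: (rhoR (g n) *m K) - w *: (f n w *m J).
    by rewrite E addrAC subrr add0r.
  rewrite {1}fwE; move: (w *: _) (w *: _) (w *: _) => a1 a2 a3.
  by apply/matrixP => i l; rewrite !mxE; ring.
(* For [|w| < q] the bounds on the brackets hold, as [q <= 1/2], and [|w| B2 <= 1/2], so the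
   occurrence of [f_n - g n] on the right of [DE] is absorbed on the left at the cost of a factor
   2. *)
pose q := (2 * (1 + B2))^-1.
have B2p : 0 < 1 + B2 by rewrite addr_gt0.
have q0 : 0 < q by rewrite invr_gt0 mulr_gt0.
have q2 : q <= 2^-1 by rewrite /q invfM ler_piMr ?invr_ge0 // invf_le1 // lerDl ltW.
apply: (@has_limz_lipschitz _ _ _ _ _ _ (2 * (1 + r * B1)) q) => //.
  by rewrite mulr_gt0 // ltr_pwDl // mulr_ge0 // ltW.
move=> w w0; rewrite subr0 => wq a b.
have wq2 : `|w| <= 2^-1.
  apply: le_trans (ltW wq) _; rewrite -(rmorph_nat (real_complex R) 2) -fmorphV lecR.
  exact: q2.
have w1 : `|w| < 1 by apply: le_lt_trans wq2 _; rewrite invf_lt1 ?ltr1n.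
apply: le_trans (_ : nrm (f n w - g n) <= _).
  by have := le_nrm (f n w - g n) a b; rewrite !mxE.
have w_ge0 := normr_ge0 w.
have D0 := nrm_ge0 (f n w - g n).
have h : nrm (f n w - g n) <= `|w| * ((r * B1)%:C%C + nrm (f n w - g n) * B2%:C%C).
  rewrite {1}DE // nrmZ ler_wpM2l // (le_trans (nrmD _ _)) // lerD //.
    rewrite (le_trans (nrmM _ _)) // rE rmorphM ler_wpM2l ?ler0c //.
    exact: hB1.
  rewrite -mulNmx (le_trans (nrmM _ _)) //.
  have -> : nrm (- (f n w - g n)) = nrm (f n w - g n).
    by rewrite -scaleN1r nrmZ normrN1 mul1r.
  by rewrite ler_wpM2l // hB2.
have wB : `|w| * B2%:C%C <= 2^-1.
  apply: le_trans (_ : q%:C%C * B2%:C%C <= _).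
    by apply: ler_wpM2r; [rewrite ler0c ltW | exact: ltW].
  rewrite -rmorphM -(rmorph_nat (real_complex R) 2) -fmorphV lecR.
  rewrite /q invfM -mulrA ler_piMr ?invr_ge0 // mulrC ler_pdivrMr // mul1r.
  by rewrite lerDr.
have : nrm (f n w - g n) <= `|w| * (r * B1)%:C%C + nrm (f n w - g n) * 2^-1.
  apply: le_trans h _; rewrite mulrDr lerD2l mulrCA ler_wpM2l //.
rewrite -lerBlDr -[X in X - _]mulr1 -mulrBr.
have -> : 1 - 2^-1 = 2^-1 :> C by rewrite {1}[1](splitr 1) div1r addrK.
rewrite ler_pdivrMr // => /le_trans; apply.
have -> : (2 * (1 + r * B1))%:C%C = 2 * (1 + (r * B1)%:C%C) :> C.
  by rewrite !mulr_natl !mulr2n; apply: eq_ReIm; rewrite !(ReD, ImD) /=; ring.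
move: (r * B1)%:C%C => c.
rewrite [X in _ <= X]mulrC -[X in X <= _]mulrA ler_wpM2l //.
by rewrite [X in X <= _]mulrC ler_wpM2l ?ler0n // lerDr ler01.
Qed.

End SchurIterates.

(** * Szego coefficients as Schur parameters *)

Section VerblunskyCoefficients.
Variables (R : realType) (d : nat) (nu : {measure set R -> \bar R}).
Variable W : R -> 'M[R[i]]_d.
Hypothesis (Hmu : is_mxmeasure nu W) (Hnt : nontrivial nu W).
Local Notation C := R[i].
Local Notation fn m := (R -> 'M[C]_(d, m)).
Local Notation ip := (ip nu W).
Local Notation cip := (cip nu W).
Local Notation tp := (@tpow R d).
Local Notation lc := (lincomb tp).
Local Notation ph := (phi nu W).
Local Notation rph := (rphi nu W).
Local Notation f n := (schur_iter (schur_fun nu W) n).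

Lemma phi0 : ph 0 = tp 0.
Proof.
have [c [-> c0 _]] := phi_coef Hmu Hnt.
by rewrite /lincomb big_ord1 c0 rmul1.
Qed.

Lemma rphi0 : rph 0 = tp 0.
Proof.
have [c [-> c0 _]] := rphi_coef_tpow Hmu Hnt.
by rewrite /lincomb big_ord1 c0 rmul1.
Qed.

Variable g : nat -> 'M[C]_d.
Hypothesis gP : forall n, [/\ defect_pos (g n),
  tmul 1 (ph n) = rmul (rph n) (adjm (g n)) + rmul (ph n.+1) (rhoR (g n))
  & rph n.+1 = rmul (rph n) (rhoL (g n)) - rmul (ph n.+1) (g n)].

Let bp := phi_bounded Hmu Hnt.
Let bs := rphi_bounded Hmu Hnt.

Lemma schur_iter_cip0 n z : z != 0 -> `|z| < 1 ->
  cip z (ph n) (tp 0) = f n z *m cip z (rph n) (tp 1).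
Proof.
elim: n z => [|n IHn] z z0 z1.
  have bt := @tpow_bounded R d.
  have t1 : tp 1 = tmul 1 (tp 0) by rewrite tmul_tpow.
  have Hu := cip_rphi_unit Hmu Hnt 0 z1; rewrite rphi0 in Hu.
  rewrite phi0 rphi0 /schur_iter /= /schur_fun extend0E //.
  rewrite (@schur_raw _ _ _ (cip z (tp 0) (tp 0)) (cip z (tp 0) (tp 1))) //.
  - by rewrite mulmxKV.
  - by rewrite t1 cip_tmul // {3 4}tpow0 ip_cst1 // addrC.
  - by rewrite t1 (caraF_cip Hmu z1) tpow0.
have [_ lim] := schur_iter_limz Hmu Hnt gP IHn.
have [h hE] := schur_iter_extend0 nu W n.
have f0 : f n 0 = g n by rewrite hE; apply: extend0_cont; rewrite -hE.
have [dg _ _] := gP n.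
rewrite /schur_iter iterS -/(schur_iter _ n) /schur_step extend0E // f0.
have b0 : mbounded (tp 0) by exact: tpow_bounded.
(* Orthogonality of [phi_(n+1)] to 1 produces the factor [z] that cancels the [z^-1] of the Schur
   step. *)
have Q0 : cip z (ph n.+1) (tp 1) = z *: cip z (ph n.+1) (tp 0).
  have -> : tp 1 = tmul 1 (tp 0) by rewrite tmul_tpow.
  by rewrite cip_tmul // (phi_orthl Hmu Hnt) // addr0.
have E1 := cip_phi Hmu Hnt gP n z1 b0; rewrite tmul_tpow addn0 in E1.
have E2 := cip_rphi Hmu Hnt gP n z1 (@tpow_bounded R d 1).
rewrite IHn // in E1.
have := schur_step_solve dg (cip_rphi_unit Hmu Hnt n.+1 z1) E1 E2.
by rewrite -scalemxAl Q0 => ->; rewrite scalerA mulVf // scale1r.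
Qed.

Lemma schur_iter_has_limz n : has_limz (f n) 0 (g n).
Proof. by have [] := schur_iter_limz Hmu Hnt gP (@schur_iter_cip0 n). Qed.

Lemma verb_schur_fun n : verb (schur_fun nu W) n = g n.
Proof.
have [h hE] := schur_iter_extend0 nu W n.
by rewrite /verb hE; apply: extend0_cont; rewrite -hE; exact: schur_iter_has_limz.
Qed.

Lemma schur_iter_cip n z p (x : nat -> 'M[C]_(d, p)) : z != 0 -> `|z| < 1 ->
  cip z (ph n) (lc n.+1 x) = f n z *m cip z (rph n) (tmul 1 (lc n.+1 x)).
Proof. by have [h _] := schur_iter_limz Hmu Hnt gP (@schur_iter_cip0 n); exact: h. Qed.

End VerblunskyCoefficients.

(** * Inverse iterates *)

Section RationalFunctions.
Import numFieldNormedType.Exports.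

Lemma cvg_horner (K : numFieldType) T (F : set_system T) (FF : Filter F)
    (h : T -> K) (l : K) (p : {poly K}) :
  (h @ F --> l -> (fun t => p.[h t] : K) @ F --> (p.[l] : K))%classic.
Proof.
move=> hl; elim/poly_ind: p => [|p c IHp].
  have -> : (fun t => (0 : {poly K}).[h t] : K) = (fun=> 0 : K).
    by apply: funext => y; rewrite horner0.
  by rewrite horner0; apply: cvg_cst.
have -> : (fun t => (p * 'X + c%:P).[h t] : K) = (fun t => p.[h t] * h t + c : K).
  by apply: funext => y; rewrite hornerMXaddC.
by rewrite hornerMXaddC; apply: cvgD; [apply: cvgM | apply: cvg_cst].
Qed.

(** A finite family of numerators, so that one radius serves all entries of a matrix. *)
Lemma ratio_continuous (K : numFieldType) (I : finType) (s : I -> {poly K}) (q : {poly K})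
    (z e : K) : q.[z] != 0 -> 0 < e ->
  exists2 r, 0 < r & forall w, `|w - z| < r ->
    forall i, `|q.[w]^-1 * (s i).[w] - q.[z]^-1 * (s i).[z]| < e.
Proof.
move=> qz e0.
have FF := @nbhs_filter K z.
have hc p := @cvg_horner K K (nbhs z) FF id z p cvg_id.
have h i : (\forall w \near nbhs z, `|q.[z]^-1 * (s i).[z] - q.[w]^-1 * (s i).[w]| < e)%classic.
  have c : ((fun w => q.[w]^-1 * (s i).[w]) @ nbhs z --> (q.[z]^-1 * (s i).[z] : K))%classic.
    by apply: cvgM; [apply: cvgV|].
  by move/cvgrPdist_lt: c; apply.
have /nbhs_ballP[r r0 rP] := filter_forall FF h.
exists r => // w wr i; rewrite distrC; apply: (rP w).
by rewrite /ball /= distrC.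
Qed.

Variable R : realType.
Local Notation C := R[i].

Lemma has_limz_rational m n (P : 'M[{poly C}]_(m, n)) (q : {poly C}) z : q.[z] != 0 ->
  has_limz (fun w => q.[w]^-1 *: peval P w) z (q.[z]^-1 *: peval P z).
Proof.
move=> qz e e0.
have [|r r0 rP] := @ratio_continuous _ ('I_m * 'I_n)%type (fun ab => P ab.1 ab.2) q z e%:C%C qz.
  by rewrite ltcR.
have [r' r'0 rE] := real_of_pos r0.
exists r' => // w _ wr a b; rewrite !mxE; apply: (rP w _ (a, b)).
by rewrite rE.
Qed.

(** [P(w) q(z) - P(z) q(w)] vanishes at [w = z] and is divisible by [w - z], so the difference
    quotient is itself rational with denominator [q(w) q(z)], and continuity suffices. *)
Lemma has_limz_rational_diff m n (P : 'M[{poly C}]_(m, n)) (q : {poly C})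
    (G : C -> 'M[C]_(m, n)) z r : 0 < r ->
  (forall w, `|w - z| < r%:C%C -> q.[w] != 0 /\ G w = q.[w]^-1 *: peval P w) ->
  exists L, has_limz (fun w => (w - z)^-1 *: (G w - G z)) z L.
Proof.
move=> r0 GE; have [qz Gz] : q.[z] != 0 /\ G z = q.[z]^-1 *: peval P z.
  by apply: GE; rewrite subrr normr0 ltcR.
have fac (ab : 'I_m * 'I_n) : exists s : {poly C},
    P ab.1 ab.2 * q.[z]%:P - (P ab.1 ab.2).[z]%:P * q = s * ('X - z%:P).
  by apply/factor_theorem; rewrite rootE !hornerE mulrC subrr.
have [s sP] := choice fac.
pose S : 'M[{poly C}]_(m, n) := \matrix_(a, b) s (a, b).
exists ((q * q.[z]%:P).[z]^-1 *: peval S z).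
have qqz : (q * q.[z]%:P).[z] != 0 by rewrite !hornerE mulf_neq0.
apply: eq_has_limz (has_limz_rational S qqz) => [|w wz wr]; first exact: r0.
have [qw ->] := GE w wr; rewrite Gz.
have wz' : w - z != 0 by rewrite subr_eq0.
apply/matrixP => a b; rewrite !mxE.
have := congr1 (horner^~ w) (sP (a, b)); rewrite !hornerE /= => E.
have -> : (s (a, b)).[w] = ((P a b).[w] * q.[z] - (P a b).[z] * q.[w]) / (w - z).
  by rewrite E mulfK.
by field; rewrite qw qz wz'.
Qed.

Lemma has_limz_diff_cont m n (G : C -> 'M[C]_(m, n)) (z : C) (L : 'M[C]_(m, n)) :
  has_limz (fun w => (w - z)^-1 *: (G w - G z)) z L -> has_limz G z (G z).
Proof.
move=> hL; have [r r0 rP] := hL 1 ltr01.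
have [K K0 KE] : exists2 K : R, 0 < K & nrm L + 1 = K%:C%C.
  by apply: real_of_pos; rewrite ltr_wpDl ?nrm_ge0.
apply: (has_limz_lipschitz K0 r0) => w wz wr a b; rewrite -KE.
have wz' : w - z != 0 by rewrite subr_eq0.
have := rP w wz wr a b; rewrite !mxE => h.
have -> : G w a b - G z a b = (w - z) * ((w - z)^-1 * (G w a b - G z a b)) by rewrite mulVKf.
rewrite normrM mulrC ler_wpM2r //.
rewrite -[X in `|X|](subrK (L a b)) (le_trans (ler_normD _ _)) // addrC lerD ?le_nrm //.
exact: ltW h.
Qed.

(** Among the [size q] distinct points [z + e / (k + 2)] one is not a root, since [q] has fewer than
    [size q] roots. *)
Lemma poly_nonroot_near (q : {poly C}) z (e : R) : q != 0 -> 0 < e ->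
  exists w, [/\ w != z, `|w - z| < e%:C%C & q.[w] != 0].
Proof.
move=> q0 e0; pose x (k : nat) : C := z + (e / k.+2%:R)%:C%C.
pose s := map x (iota 0 (size q)).
have xI : injective x.
  move=> k l /addrI /complexI /(mulfI (lt0r_neq0 e0)) /invr_inj /eqP.
  by rewrite eqr_nat => /eqP [].
have us : uniq s by rewrite map_inj_uniq ?iota_uniq.
have /allPn[w /mapP[k _ ->] nr] : ~~ all (root q) s.
  by apply/negP => al; have := max_poly_roots q0 al us; rewrite size_map size_iota ltnn.
exists (x k).
have ek : 0 < e / k.+2%:R by rewrite divr_gt0 ?ltr0n.
have xz : x k - z = (e / k.+2%:R)%:C%C by rewrite /x addrC addKr.
split; first by rewrite -subr_eq0 xz -[0]/(0%:C%C) (inj_eq (@complexI R)) gt_eqF.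
  rewrite xz ger0_norm ?ler0c ?ltW // ltcR ltr_pdivrMr ?ltr0n //.
  by rewrite ltr_pMr // ltr1n.
exact: nr.
Qed.

Lemma disc_nbhs (z : C) : `|z| < 1 -> exists2 r : R, 0 < r &
  forall w, `|w - z| < r%:C%C -> `|w| < 1.
Proof.
move=> z1; have [|r r0 rE] := @real_of_pos R (1 - `|z|); first by rewrite subr_gt0.
exists r => // w; rewrite -rE ltrBrDr; apply: le_lt_trans.
by rewrite -[X in `|X| <= _](subrK z) ler_normD.
Qed.

Lemma eq_off_roots m n (G H : C -> 'M[C]_(m, n)) (q : {poly C}) z : q != 0 ->
  `|z| < 1 -> has_limz G z (G z) -> has_limz H z (H z) ->
  (forall w, `|w| < 1 -> q.[w] != 0 -> G w = H w) -> G z = H z.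
Proof.
move=> q0 z1 Gc Hc GH; apply: has_limz_frequently Gc Hc _ => e e0.
have [r r0 rP] := disc_nbhs z1.
have [|w [wz we qw]] := @poly_nonroot_near q z (Num.min r e) q0; first by rewrite lt_min r0.
exists w; split => //; first by apply: lt_le_trans we _; rewrite lecR ge_min lexx orbT.
by apply: GH => //; apply: rP; apply: lt_le_trans we _; rewrite lecR ge_min lexx.
Qed.

End RationalFunctions.

(** * The inverse Schur step and its rational form *)

Section InverseIterates.
Variables (R : realType) (d : nat).
Local Notation C := R[i].

Definition contraction (A : 'M[C]_d) := psdm (1%:M - adjm A *m A).

Lemma sqnM (A : 'M[C]_d) (v : 'cV[C]_d) : sqn (A *m v) = (adjm v *m (adjm A *m A) *m v) 0 0.
Proof. by rewrite /sqn adjmM !mulmxA. Qed.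

Lemma contractionP (A : 'M[C]_d) :
  contraction A <-> forall v : 'cV[C]_d, sqn (A *m v) <= sqn v.
Proof.
have E (v : 'cV[C]_d) : (adjm v *m (1%:M - adjm A *m A) *m v) 0 0 = sqn v - sqn (A *m v).
  by rewrite mulmxBr mulmxBl mulmx1 mxE [X in _ + X]mxE sqnM.
split=> [[_ pA] v|h]; first by rewrite -subr_ge0 -E.
by split=> [|v]; [rewrite adjmB adjm1 adjmM adjmK | rewrite E subr_ge0].
Qed.

Lemma defect_sqn (g : 'M[C]_d) (v : 'cV[C]_d) : defect_pos g ->
  sqn (g *m v) = sqn v - sqn (rhoL g *m v).
Proof.
case=> -[hL _] _ LL _; rewrite [sqn (rhoL g *m v)]sqnM hL LL mulmxBr mulmxBl mulmx1.
by rewrite mxE [X in _ - (_ + X)]mxE sqnM opprB addrC subrK.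
Qed.

(** If [v = z g b v], then [|v|^2 <= |g b v|^2 = |b v|^2 - |rhoL b v|^2 <= |v|^2 - |rhoL b v|^2];
    hence [b v = 0] and [v = 0]. Strictness of [g] allows [|z| = 1], and the point [z = 1] is used
    below. *)
Lemma contraction_pivot_unit (g b : 'M[C]_d) z : defect_pos g -> contraction b -> `|z| <= 1 ->
  1%:M - z *: (g *m b) \in unitmx.
Proof.
move=> dg /contractionP cb z1; have [pL _ _ _] := dg.
apply: unitmx_inj => v; rewrite mulmxBl mul1mx => /eqP; rewrite subr_eq0 -scalemxAl -mulmxA => /eqP vE.
have b0 : sqn (b *m v) = 0 -> v = 0.
  by move=> /sqn_eq0 bv; rewrite vE bv mulmx0 scaler0.
apply: b0; have Lu := pdm_unit pL.
have z2 : `|z| ^+ 2 <= 1 by rewrite expr_le1.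
have h : sqn v <= sqn (b *m v) - sqn (rhoL g *m (b *m v)).
  rewrite {1}vE sqnZ -defect_sqn //.
  by rewrite ler_piMl // sqn_ge0.
have : sqn (rhoL g *m (b *m v)) = 0.
  apply/eqP; rewrite eq_le sqn_ge0 andbT.
  have := le_trans h (lerB (cb v) (lexx _)).
  by rewrite lerBrDr gerDl.
move=> /sqn_eq0 /(congr1 (mulmx (invmx (rhoL g)))).
by rewrite mulKmx // mulmx0 => ->; rewrite sqn0.
Qed.

(** The Schur step with parameter [- adjm g] and outcome [b], solved for the function it is applied
    to; [rhoL] and [rhoR] are exchanged because the parameter is [- adjm g]. *)
Definition inv_step (g b : 'M[C]_d) (z : C) : 'M[C]_d :=
  - adjm g + z *: (rhoL g *m b *m invmx (1%:M - z *: (g *m b)) *m rhoR g).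

Fixpoint binv (g : nat -> 'M[C]_d) (n : nat) (z : C) : 'M[C]_d :=
  if n is m.+1 then inv_step (g m) (binv g m z) z else 1%:M.

(* [inv_step g b z] is the transfer of [z b] through the unitary matrix
   [[- g^*, rhoL], [rhoR, g]]. *)
Lemma inv_step_gram (g b : 'M[C]_d) z (K := 1%:M - z *: (g *m b)) (M := invmx K *m rhoR g)
    (Y := z *: (b *m M)) : defect_pos g -> K \in unitmx ->
  adjm (inv_step g b z) *m inv_step g b z + adjm M *m M = 1%:M + adjm Y *m Y.
Proof.
move=> dg Ku; have [[hL _] [hR _] LL RR] := dg.
have [pL pR _ _] := dg.
have Rg := rho_intertwine pR pL RR LL.
have gR : adjm g *m rhoR g = rhoL g *m adjm g.
  by have := congr1 (@adjm _ _ _) Rg; rewrite !adjmM hL hR.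
have ME : M = rhoR g + g *m Y.
  have : K *m M = rhoR g by rewrite mulKVmx.
  rewrite mulmxBl mul1mx -scalemxAl -mulmxA => <-.
  by rewrite /Y -scalemxAr subrK.
have bE : inv_step g b z = - adjm g + rhoL g *m Y.
  by rewrite /inv_step /Y /M -scalemxAr !mulmxA.
rewrite bE ME !(adjmD, adjmN, adjmM) adjmK hL hR.
rewrite !(mulmxDl, mulmxDr) !(mulNmx, mulmxN) opprK.
rewrite !mulmxA -[adjm Y *m rhoL g *m rhoL g]mulmxA LL RR.
rewrite -[adjm Y *m rhoL g *m adjm g]mulmxA -gR -[rhoR g *m g *m Y]/(rhoR g *m g *m Y) Rg.
rewrite -[adjm Y *m adjm g *m rhoR g]mulmxA mulmxBr mulmx1 !mulmxBl.
rewrite -!mulmxA.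
move: (g *m (rhoL g *m Y)) (adjm Y *m (adjm g *m rhoR g)) (g *m adjm g)
  (adjm Y *m Y) (adjm Y *m (adjm g *m (g *m Y))) => a1 a2 a3 a4 a5.
by apply/matrixP => i l; rewrite !mxE; ring.
Qed.

Lemma gram_sqn (A1 A2 A3 : 'M[C]_d) (v : 'cV[C]_d) :
  adjm A1 *m A1 + adjm A2 *m A2 = 1%:M + adjm A3 *m A3 ->
  sqn (A1 *m v) + sqn (A2 *m v) = sqn v + sqn (A3 *m v).
Proof.
move=> /(congr1 (fun A : 'M[C]_d => (adjm v *m A *m v) 0 0)).
by rewrite !mulmxDr !mulmxDl mulmx1 [LHS]mxE [RHS]mxE -!sqnM.
Qed.

(** Energy balance of the unitary transfer: [|X v|^2 + |M v|^2 = |v|^2 + |z b M v|^2], and the last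
    term is at most [|M v|^2]. *)
Lemma inv_step_contraction (g b : 'M[C]_d) z : defect_pos g -> contraction b -> `|z| <= 1 ->
  contraction (inv_step g b z).
Proof.
move=> dg cb z1; have Ku := contraction_pivot_unit dg cb z1.
have E := inv_step_gram dg Ku; apply/contractionP => v.
set M := invmx _ *m rhoR g in E.
have E2 := gram_sqn v E.
rewrite -(lerD2r (sqn (M *m v))) E2 lerD2l -scalemxAl sqnZ -mulmxA.
move/contractionP: cb => /(_ (M *m v)); apply: le_trans.
by rewrite ler_piMl ?sqn_ge0 // expr_le1.
Qed.

(** For [b = P / q] one has [1 - z g b = E / q] with [E] this matrix. Writing its inverse as
    [q \adj E / \det E] makes [\det E] the denominator of the next step, and [q] cancels in the
    numerator. *)
Definition den_step (g : 'M[C]_d) (P : 'M[{poly C}]_d) (q : {poly C}) : 'M[{poly C}]_d :=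
  q%:M - 'X *: (map_mx polyC g *m P).

Definition num_step (g : 'M[C]_d) (P : 'M[{poly C}]_d) (q : {poly C}) : 'M[{poly C}]_d :=
  - (\det (den_step g P q) *: map_mx polyC (adjm g)) +
  'X *: (map_mx polyC (rhoL g) *m P *m \adj (den_step g P q) *m map_mx polyC (rhoR g)).

Lemma inv_step_rational (ev : {rmorphism {poly C} -> C}) (z : C) (g b : 'M[C]_d)
    (P : 'M[{poly C}]_d) (q : {poly C}) :
  ev 'X = z -> (forall c, ev c%:P = c) -> ev q != 0 -> b = (ev q)^-1 *: map_mx ev P ->
  1%:M - z *: (g *m b) \in unitmx ->
  ev (\det (den_step g P q)) != 0 /\
  inv_step g b z = (ev (\det (den_step g P q)))^-1 *: map_mx ev (num_step g P q).
Proof.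
move=> evX evC qz bz Ku; pose E := den_step g P q.
have pC (A : 'M[C]_d) : map_mx ev (map_mx polyC A) = A.
  by apply/matrixP => i l; rewrite !mxE evC.
have bz' : map_mx ev P = ev q *: b by rewrite bz scalerA mulfV // scale1r.
have EE : map_mx ev E = ev q *: (1%:M - z *: (g *m b)).
  rewrite scalerBr scalemx1 scalerA [ev q * z]mulrC -scalerA scalemxAr -bz'.
  by rewrite /E /den_step map_mxB map_scalar_mx map_mxZ map_mxM pC evX.
have Eu : map_mx ev E \in unitmx by rewrite EE unitmxZ ?unitfE.
have dnz : ev (\det E) != 0 by rewrite -det_map_mx -unitfE -unitmxE.
split=> //.
have aE : map_mx ev (\adj E) = ev (\det E) *: invmx (map_mx ev E).
  by rewrite map_mx_adj /invmx Eu det_map_mx scalerA mulfV // scale1r.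
rewrite /num_step -/E map_mxD map_mxN !map_mxZ !map_mxM !pC aE evX EE.
have u2 : ev q *: (1%:M - z *: (g *m b)) \in unitmx by rewrite -EE.
rewrite (invmxZ u2).
rewrite bz' /inv_step; move: dnz qz; move: (ev (\det E)) (ev q) => u v u0 v0.
rewrite scalerDr scalerN scalerA (mulVf u0) scale1r; apply: (congr1 (fun X => - adjm g + X)).
rewrite -!(scalemxAl, scalemxAr) !scalerA; congr (_ *: _).
by field; rewrite u0 v0.
Qed.

Variable g : nat -> 'M[C]_d.
Hypothesis gP : forall n, defect_pos (g n).
Local Notation b := (binv g).

Lemma binv_contraction n z : `|z| <= 1 -> contraction (b n z).
Proof.
move=> z1; elim: n => [|n IHn] /=; last exact: inv_step_contraction.
by apply/contractionP => v; rewrite mul1mx.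
Qed.

Lemma binv_pivot_unit n z : `|z| <= 1 -> 1%:M - z *: (g n *m b n z) \in unitmx.
Proof. by move=> z1; apply: contraction_pivot_unit => //; exact: binv_contraction. Qed.

(** At [z = 1] a unitary [b] makes the two extra terms of the energy balance equal. *)
Lemma binv_unitary n : adjm (b n 1) *m b n 1 = 1%:M.
Proof.
elim: n => [|n IHn] /=; first by rewrite adjm1 mulmx1.
have u := @binv_pivot_unit n 1; rewrite normr1 lexx in u.
have := inv_step_gram (gP n) (u isT); rewrite !scale1r.
set M := invmx _ *m _.
have -> : adjm (b n 1 *m M) *m (b n 1 *m M) = adjm M *m M.
  by rewrite adjmM -mulmxA (mulmxA (adjm (b n 1))) IHn mul1mx.
exact: addIr.
Qed.

Lemma binv_rational n : exists (P : 'M[{poly C}]_d) (q : {poly C}),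
  forall z, `|z| <= 1 -> q.[z] != 0 /\ b n z = q.[z]^-1 *: peval P z.
Proof.
elim: n => [|n [P [q PqE]]].
  exists 1%:M, 1 => z _; rewrite hornerC oner_neq0 invr1 scale1r; split=> //=.
  by apply/matrixP => i l; rewrite !mxE; case: eqP => _; rewrite ?hornerC ?horner0.
exists (num_step (g n) P q), (\det (den_step (g n) P q)) => z z1.
have [qz bz] := PqE z z1.
apply: (@inv_step_rational (horner_eval z)) bz _ => //.
- exact: hornerX.
- by move=> c; exact: hornerC.
- exact: binv_pivot_unit.
Qed.

End InverseIterates.

(** * Inverse iterates characterized by their Schur algorithm *)

Section InverseIterateSpec.
Variables (R : realType) (d : nat).
Local Notation C := R[i].

Lemma rhoR_Nadj (g : 'M[C]_d) : rhoR (- adjm g) = rhoL g.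
Proof. by rewrite /rhoR /rhoL adjmN adjmK mulNmx mulmxN opprK. Qed.

Lemma rhoL_Nadj (g : 'M[C]_d) : rhoL (- adjm g) = rhoR g.
Proof. by rewrite /rhoR /rhoL adjmN adjmK mulNmx mulmxN opprK. Qed.

(** The point is the identity [1 + g X = rhoR K^-1 rhoR], which makes the second inverse
    explicit. *)
Lemma inv_stepK (g b : 'M[C]_d) z (X := inv_step g b z) : defect_pos g -> z != 0 ->
  1%:M - z *: (g *m b) \in unitmx ->
  z^-1 *: (invmx (rhoL g) *m (X + adjm g) *m invmx (1%:M + g *m X) *m rhoR g) = b.
Proof.
move=> dg z0; set K := 1%:M - _ => Ku; have [pL pR LL RR] := dg.
have [Lu Ru] := (pdm_unit pL, pdm_unit pR).
have Rg := rho_intertwine pR pL RR LL.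
have XE : X + adjm g = z *: (rhoL g *m b *m invmx K *m rhoR g).
  by rewrite /X /inv_step addrAC addNr add0r.
have DE : 1%:M + g *m X = rhoR g *m invmx K *m rhoR g.
  have -> : X = z *: (rhoL g *m b *m invmx K *m rhoR g) - adjm g by rewrite -XE addrK.
  have KK : (z *: (g *m b)) *m (invmx K *m rhoR g) + rhoR g = invmx K *m rhoR g.
    by rewrite -{2}(mulKVmx Ku (rhoR g)) -mulmxDl /K addrC subrK mul1mx.
  rewrite mulmxBr addrCA -RR -scalemxAr !mulmxA -Rg -[RHS]mulmxA -KK mulmxDr.
  by rewrite -scalemxAl -scalemxAr !mulmxA.
rewrite XE DE -scalemxAr -!scalemxAl scalerA (mulVf z0) scale1r.
have Ki : invmx (rhoR g *m invmx K *m rhoR g) = invmx (rhoR g) *m K *m invmx (rhoR g).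
  apply: mulmx1_invmx; rewrite !mulmxA mulmxK // mulmxKV // mulmxV //.
by rewrite Ki !mulmxA (mulVmx Lu) mul1mx (mulmxK Ru) (mulmxKV Ku) (mulmxKV Ru).
Qed.

(** Invertibility of [b] forces that of [D = 1 + g X]: [invmx D] is a factor of the invertible
    [z b], and it is invertible only if [D] is. *)
Lemma inv_step_unique (g b X : 'M[C]_d) z : defect_pos g -> z != 0 ->
  1%:M - z *: (g *m b) \in unitmx -> b \in unitmx ->
  z^-1 *: (invmx (rhoL g) *m (X + adjm g) *m invmx (1%:M + g *m X) *m rhoR g) = b ->
  X = inv_step g b z.
Proof.
move=> dg z0 Ku bu E; have [pL pR LL RR] := dg.
have [Lu Ru] := (pdm_unit pL, pdm_unit pR).
have Rg := rho_intertwine pR pL RR LL.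
have E1 : invmx (rhoL g) *m (X + adjm g) *m invmx (1%:M + g *m X) *m rhoR g = z *: b.
  by rewrite -E scalerA mulfV // scale1r.
set D := 1%:M + g *m X in E1.
have Du : D \in unitmx.
  have : z *: b \in unitmx by rewrite unitmxZ ?unitfE.
  by rewrite -E1 !unitmx_mul !unitmx_inv => /andP[/andP[_ ->]].
have E2 : X + adjm g = z *: (rhoL g *m b *m invmx (rhoR g) *m D).
  move/(congr1 (fun A => rhoL g *m A *m invmx (rhoR g) *m D)): E1.
  by rewrite !mulmxA (mulmxV Lu) mul1mx (mulmxK Ru) (mulmxKV Du) => ->; rewrite -scalemxAr -!scalemxAl.
have E3 : invmx (rhoR g) *m D = invmx (1%:M - z *: (g *m b)) *m rhoR g.
  have DE : D = rhoR g *m rhoR g + z *: (rhoR g *m (g *m b *m invmx (rhoR g) *m D)).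
    rewrite {1}/D -[X in g *m X](addrK (adjm g)) E2 mulmxBr addrCA -RR addrC.
    by rewrite -scalemxAr !mulmxA -Rg.
  rewrite -[LHS](mulKmx Ku); congr (_ *m _).
  rewrite mulmxBl mul1mx {1}DE mulmxDr (mulKmx Ru) -scalemxAr (mulKmx Ru) -scalemxAl !mulmxA.
  by rewrite addrK.
apply/eqP; rewrite -(inj_eq (addIr (adjm g))) E2 /inv_step addrAC addNr add0r.
by rewrite -!mulmxA E3.
Qed.

Variable g : nat -> 'M[C]_d.
Hypothesis gP : forall n, defect_pos (g n).
Local Notation b := (binv g).

Lemma binv_is_schur n : is_schur (b n).
Proof.
move=> z z1; split; first exact: (binv_contraction gP n (ltW z1)).
have [P [q PqE]] := binv_rational gP n; have [r r0 rP] := disc_nbhs z1.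
by apply: (has_limz_rational_diff r0) => w /rP /ltW; exact: PqE.
Qed.

Lemma binv_cont n z : `|z| < 1 -> has_limz (b n) z (b n z).
Proof. by move=> /(@binv_is_schur n)[_ [L]]; exact: has_limz_diff_cont. Qed.

Lemma binv_at0 n : b n.+1 0 = - adjm (g n).
Proof. by rewrite /= /inv_step scale0r addr0. Qed.

Lemma schur_step_binv (G : C -> 'M[C]_d) n :
  (forall z, `|z| < 1 -> G z = b n.+1 z) ->
  forall z, `|z| < 1 -> schur_step G z = b n z.
Proof.
move=> GE; have G0 : G 0 = - adjm (g n) by rewrite GE ?normr0 ?ltr01 // binv_at0.
rewrite /schur_step G0 rhoR_Nadj rhoL_Nadj adjmN adjmK.
have hE w : w != 0 -> `|w| < 1 -> w^-1 *: (invmx (rhoL (g n)) *m (G w - - adjm (g n)) *m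
    invmx (1%:M - - g n *m G w) *m rhoR (g n)) = b n w.
  move=> w0 w1; rewrite GE // mulNmx !opprK /=; apply: inv_stepK => //.
  by apply: binv_pivot_unit => //; exact: ltW.
move=> z z1; have [->|z0] := eqVneq z 0; last by rewrite extend0E // hE.
apply: extend0_0; apply: (@eq_has_limz _ _ _ (b n) _ _ _ 1) => //.
  by move=> w w0; rewrite subr0 => w1; rewrite hE.
by apply: binv_cont; rewrite normr0 ltr01.
Qed.

Lemma schur_iter_binv n m z : (m <= n)%N -> `|z| < 1 ->
  schur_iter (b n) m z = b (n - m) z.
Proof.
elim: m z => [|m IHm] z mn z1; first by rewrite subn0.
rewrite /schur_iter iterS; apply: schur_step_binv z1 => w w1.
by rewrite -subSn // subSS; apply: IHm => //; exact: ltnW.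
Qed.

(** The value at [z = 1] is unitary, so [\det P] does not vanish there. *)
Lemma binv_det_neq0 n (P : 'M[{poly C}]_d) (q : {poly C}) :
  (forall z, `|z| <= 1 -> q.[z] != 0 /\ b n z = q.[z]^-1 *: peval P z) -> \det P != 0.
Proof.
move=> PqE; have [|q1 bE] := PqE 1; first by rewrite normr1.
have [_ bu] := mulmx1_unit (binv_unitary gP n).
have Pu : peval P 1 \in unitmx.
  by move: bu; rewrite bE unitmxZ // unitfE invr_eq0.
apply: contraL Pu => /eqP P0; rewrite unitmxE.
have -> : \det (peval P 1) = (\det P).[1].
  exact: (det_map_mx (horner_eval (1 : C)) P).
by rewrite P0 horner0 unitr0.
Qed.

(* Where [b i] is invertible for all [i < n], the junk value [invmx A = A] at a
   singular [A] cannot occur in the Schur algorithm of [G]; this leaves finitely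
   many points, which are reached by continuity. *)
Lemma binv_unique (G : C -> 'M[C]_d) n : is_schur G ->
  (forall m, (m < n)%N -> verb G m = - adjm (g (n - 1 - m)%N)) ->
  (forall z, `|z| < 1 -> schur_iter G n z = 1%:M) ->
  forall z, `|z| < 1 -> G z = b n z.
Proof.
move=> Gs Gv G1 z z1.
have [P hP] := choice (fun m => binv_rational gP m).
have [q PqE] := choice hP.
(* The factor ['X] excludes [w = 0], where a Schur step is a limit and not a formula. *)
pose Q := 'X * \prod_(i < n) \det (P i).
have Q0 : Q != 0.
  rewrite mulf_neq0 ?polyX_eq0 //; apply/prodf_neq0 => i _.
  exact: binv_det_neq0 (PqE i).
apply: (@eq_off_roots _ _ _ _ _ Q) => //.
- by have [_ [L]] := Gs z z1; exact: has_limz_diff_cont.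
- exact: binv_cont.
move=> w w1; rewrite hornerM hornerX mulf_eq0 negb_or => /andP[w0 Pw].
(* The algorithm is read backwards from its last iterate 1, which is the inverse iterate of index
   0. *)
suff h m : (m <= n)%N -> schur_iter G (n - m) w = b m w.
  by have := h n (leqnn n); rewrite subnn.
elim: m => [|m IHm] mn; first by rewrite subn0 G1.
have nm : (n - m = (n - m.+1).+1)%N by rewrite subnSK.
have := IHm (ltnW mn); rewrite nm /schur_iter iterS -/(schur_iter G (n - m.+1)).
rewrite /schur_step extend0E //.
have -> : schur_iter G (n - m.+1) 0 = - adjm (g m).
  rewrite -/(verb G (n - m.+1)) Gv; last by rewrite ltn_subrL /= (leq_ltn_trans _ mn).
  by congr (- adjm (g _)); rewrite subnAC subKn ?subn1.
rewrite rhoR_Nadj rhoL_Nadj adjmN adjmK mulNmx !opprK.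
apply: inv_step_unique => //.
  by apply: binv_pivot_unit => //; exact: ltW.
have [qw ->] := PqE m w (ltW w1).
rewrite unitmxZ ?unitfE ?invr_eq0 // unitmxE unitfE.
have -> : \det (peval (P m) w) = (\det (P m)).[w].
  exact: (det_map_mx (horner_eval w) (P m)).
apply: contraNneq Pw => Pm; rewrite horner_prod (bigD1 (Ordinal mn)) //= Pm mul0r.
by [].
Qed.

(** [schur_inv_iter] is a choice: [binv] shows that its specification is satisfiable, and uniqueness
    identifies the chosen function on the disc. *)
Lemma schur_inv_iterE (f : C -> 'M[C]_d) n z : (forall m, verb f m = g m) ->
  `|z| < 1 -> schur_inv_iter f n z = b n z.
Proof.
move=> fg z1.
pose spec G := [/\ is_schur G,
  forall m, (m < n)%N -> verb G m = - adjm (verb f (n - 1 - m)%N)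
  & forall z : C, `|z| < 1 -> schur_iter G n z = 1%:M].
have bspec : spec (b n).
  split; first exact: binv_is_schur.
    move=> m mn; rewrite fg /verb schur_iter_binv ?normr0 ?ltr01 //; last exact: ltnW.
    have -> : (n - m = (n - 1 - m).+1)%N by rewrite subnAC subn1 prednK ?subn_gt0.
    exact: binv_at0.
  by move=> w w1; rewrite schur_iter_binv // subnn.
have [Gs Gv G1] : spec (schur_inv_iter f n).
  exact: (ClassicalEpsilon.epsilon_spec (inhabits _) spec (ex_intro _ _ bspec)).
by apply: binv_unique => // m mn; rewrite Gv // fg.
Qed.

End InverseIterateSpec.

(** * Block matrices and CMV layers *)

Section BlockMatrices.
Variables (R : realType) (n d : nat).
Local Notation C := R[i].
Implicit Types B : nat -> nat -> 'M[C]_d.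

Definition blk_index (i : 'I_(n * d)) : 'I_n * 'I_d :=
  enum_val (cast_ord (esym (mxvec_cast n d)) i).

Lemma blk_index_bij : bijective blk_index.
Proof.
exists (fun x => cast_ord (mxvec_cast n d) (enum_rank x)) => x.
  by rewrite /blk_index enum_valK cast_ordKV.
by rewrite /blk_index cast_ordK enum_rankK.
Qed.

Lemma blkE B i l : blk n d B i l =
  B (blk_index i).1 (blk_index l).1 (blk_index i).2 (blk_index l).2.
Proof. by rewrite /blk castmxE mxE. Qed.

Lemma eq_blk B B' : (forall r s, (r < n)%N -> (s < n)%N -> B r s = B' r s) ->
  blk n d B = blk n d B'.
Proof. by move=> BB; apply/matrixP => i l; rewrite !blkE BB. Qed.

Lemma blkM B B' :
  blk n d B *m blk n d B' = blk n d (fun r s => \sum_(u < n) B r u *m B' u s).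
Proof.
apply/matrixP => i l; rewrite mxE blkE summxE.
transitivity (\sum_(x : 'I_n * 'I_d) B (blk_index i).1 x.1 (blk_index i).2 x.2 *
    B' x.1 (blk_index l).1 x.2 (blk_index l).2).
  rewrite (reindex _ (onW_bij predT blk_index_bij)) /=.
  by apply: eq_bigr => k _; rewrite !blkE.
rewrite -(pair_bigA _ (fun (u : 'I_n) (v : 'I_d) => B (blk_index i).1 u (blk_index i).2 v *
  B' u (blk_index l).1 v (blk_index l).2)) /=.
by apply: eq_bigr => u _; rewrite mxE.
Qed.

Lemma adjm_blk B : adjm (blk n d B) = blk n d (fun r s => adjm (B s r)).
Proof. by apply/matrixP => i l; rewrite adjmE !blkE adjmE. Qed.

Lemma blk1 : blk n d (fun r s => if r == s then 1%:M else 0) = 1%:M :> 'M[C]_(n * d).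
Proof.
apply/matrixP => i l; rewrite blkE !mxE -(inj_eq (bij_inj blk_index_bij)).
rewrite -pair_eqE /= -val_eqE /=; case: eqP => _ /=; last by rewrite mxE.
by rewrite mxE.
Qed.

Lemma blkD B B' : blk n d B + blk n d B' = blk n d (fun r s => B r s + B' r s).
Proof. by apply/matrixP => i l; rewrite mxE !blkE mxE. Qed.

Lemma blkB B B' : blk n d B - blk n d B' = blk n d (fun r s => B r s - B' r s).
Proof. by apply/matrixP => i l; rewrite !mxE !blkE !mxE. Qed.

Lemma blkZ c B : c *: blk n d B = blk n d (fun r s => c *: B r s).
Proof. by apply/matrixP => i l; rewrite mxE !blkE mxE. Qed.

Lemma dsum_blk (D : nat -> 'M[C]_d) B :
  dsum n d D *m blk n d B = blk n d (fun r s => D r *m B r s).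
Proof.
rewrite blkM; apply: eq_blk => r s rn sn.
rewrite (bigD1 (Ordinal rn)) //= eqxx big1 ?addr0 // => u.
by rewrite -val_eqE /= eq_sym => /negbTE ->; rewrite mul0mx.
Qed.

Lemma blk_dsum (D : nat -> 'M[C]_d) B :
  blk n d B *m dsum n d D = blk n d (fun r s => B r s *m D s).
Proof.
rewrite blkM; apply: eq_blk => r s rn sn.
rewrite (bigD1 (Ordinal sn)) //= eqxx big1 ?addr0 // => u.
by rewrite -val_eqE /= => /negbTE ->; rewrite mulmx0.
Qed.

End BlockMatrices.

(** * One CMV layer with modified factors at its unpaired ends *)

Section CMVLayers.
Variables (R : realType) (d : nat).
Local Notation C := R[i].
Variables (off N : nat) (beta : nat -> 'M[C]_d).
Hypothesis off1 : (off <= 1)%N.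

(* Diagonal factors at the indices that the layer leaves unpaired. *)
Definition layer_ends (cb cf : 'M[C]_d) (r : nat) : 'M[C]_d :=
  if (off == 1%N) && (r == 0%N) then cb
  else if (r == N) && ((off <= N)%N && ~~ odd (N - off)) then cf else 1%:M.

(** The lower index of the pair to which [r] belongs in the layer starting at [off]. *)
Let i0 r := (((r - off)./2).*2 + off)%N.

Lemma layer_paired r : (r <= N)%N -> ~~ ((off == 1%N) && (r == 0%N)) ->
  ~~ ((r == N) && ((off <= N)%N && ~~ odd (N - off))) ->
  (off <= r)%N /\ ((i0 r).+1 <= N)%N.
Proof.
move=> rN h1 h2; have offr : (off <= r)%N.
  by move: h1 off1; case: off => [|[|m]] //; case: (r).
split=> //; have := odd_double_half (r - off); rewrite /i0.
case: (boolP (odd (r - off))) => /= o E.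
  by move: E; rewrite add1n -addSn => ->; rewrite subnK.
move: E; rewrite add0n => ->; rewrite subnK // ltn_neqAle rN andbT.
by apply: contra h2 => /eqP rE; rewrite -rE eqxx offr o.
Qed.

(** Where the diagonal factor differs from 1, the layer has the corresponding row and column of the
    identity. *)
Lemma layer_endsC (cb cf : 'M[C]_d) r s : (r <= N)%N -> (s <= N)%N ->
  layer_ends cb cf r *m adjm (pairblk off N beta s r) =
  adjm (pairblk off N beta s r) *m layer_ends cb cf s.
Proof.
move=> rN sN; have unp u v : (u <= N)%N -> (v <= N)%N ->
    layer_ends cb cf u != 1%:M ->
    pairblk off N beta u v = (if u == v then 1%:M else 0) /\
    pairblk off N beta v u = (if v == u then 1%:M else 0).
  rewrite /layer_ends => uN vN.
  have [/andP[/eqP o1 /eqP ->] _|h1] := boolP ((off == 1%N) && (u == 0%N)).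
    by rewrite /pairblk o1 /= andbF.
  have [/andP[/eqP -> /andP[oN eN]] _|h2] := boolP ((u == N) && _); last by rewrite eqxx.
  have dN : ((N - off)./2.*2 + off = N)%N.
    by have := odd_double_half (N - off); rewrite (negbTE eN) add0n => ->; rewrite subnK.
  rewrite /pairblk dN ltnn !andbF; split=> //.
  case: ifP => // /and4P[_ _ /eqP -> ].
  by rewrite dN ltnn.
have [Er|nr] := eqVneq (layer_ends cb cf r) 1%:M; last first.
  have [_ ->] := unp r s rN sN nr.
  by case: eqP => [->|_]; rewrite ?adjm1 ?adjm0 ?mulmx1 ?mul1mx ?mul0mx ?mulmx0.
have [Es|ns] := eqVneq (layer_ends cb cf s) 1%:M.
  by rewrite Er Es mulmx1 mul1mx.
have [-> _] := unp s r sN rN ns.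
by case: eqP => [->|_]; rewrite ?adjm1 ?adjm0 ?mulmx1 ?mul1mx ?mul0mx ?mulmx0.
Qed.

Hypothesis beta_pos : forall i, defect_pos (beta i).

(** The first hypothesis says that the adjoint of [Theta (beta i)] sends the pair [(v i, v i.+1)] to
    [(w i, w i.+1)]; the other two give the unpaired ends. Each row of the adjoint layer meets
    either one such block or a single identity entry. *)
Lemma layerP (cb cf : 'M[C]_d) (v w : nat -> 'M[C]_d) :
  (forall i, (off <= i)%N -> (i.+1 <= N)%N -> ~~ odd (i - off) ->
     w i = beta i *m v i + rhoR (beta i) *m v i.+1 /\
     w i.+1 = rhoL (beta i) *m v i - adjm (beta i) *m v i.+1) ->
  (off = 1%N -> w 0%N = cb *m v 0%N) ->
  ((off <= N)%N -> ~~ odd (N - off) -> w N = cf *m v N) ->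
  forall r, (r <= N)%N -> w r = layer_ends cb cf r *m
    \sum_(u < N.+1) adjm (pairblk off N beta u r) *m v u.
Proof.
move=> pair left right r rN.
have sel (F : nat -> 'M[C]_d) : (forall u, (u <= N)%N -> u != r -> F u = 0) ->
    \sum_(u < N.+1) F u = F r.
  move=> F0; rewrite (bigD1 (Ordinal (rN : (r < N.+1)%N))) //= big1 ?addr0 // => u ur.
  by apply: F0; [rewrite -ltnS | rewrite -val_eqE in ur].
have [/andP[/eqP o1 /eqP r0]|h1] := boolP ((off == 1%N) && (r == 0%N)).
  rewrite /layer_ends o1 r0 /= left //; congr (_ *m _).
  rewrite (eq_bigr (fun u : 'I_N.+1 => (if (u : nat) == r then 1%:M else 0) *m v u)) => [|u _].
    rewrite (sel (fun u => (if u == r then 1%:M else 0) *m v u)) ?eqxx ?mul1mx ?r0 // => u _.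
    by move/negbTE ->; rewrite mul0mx.
  by rewrite /pairblk /= andbF r0; case: eqP; rewrite ?adjm1 ?adjm0.
(* The unpaired right end: its pair would be [(N, N + 1)], which the bound in [pairblk] rejects. *)
have [/andP[/eqP rE /andP[oN eN]]|h2] :=
    boolP ((r == N) && ((off <= N)%N && ~~ odd (N - off))).
  rewrite /layer_ends (negbTE h1) rE eqxx oN eN /= right //; congr (_ *m _).
  have dN : ((N - off)./2.*2 + off = N)%N.
    by have := odd_double_half (N - off); rewrite (negbTE eN) add0n => ->; rewrite subnK.
  rewrite (eq_bigr (fun u : 'I_N.+1 => (if (u : nat) == r then 1%:M else 0) *m v u)) => [|u _].
    rewrite (sel (fun u => (if u == r then 1%:M else 0) *m v u)) ?eqxx ?mul1mx ?rE // => u _.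
    by move/negbTE ->; rewrite mul0mx.
  congr (_ *m _); rewrite /pairblk rE.
  case: ifP => [/and4P[_ _ /eqP -> ]|_]; first by rewrite dN ltnn.
  by case: eqP; rewrite ?adjm1 ?adjm0.
have [offr iN] := layer_paired rN h1 h2.
rewrite /layer_ends (negbTE h1) (negbTE h2) mul1mx.
move iE: (i0 r) iN => i iN.
have offi : (off <= i)%N by rewrite -iE /i0 leq_addl.
have ei : ~~ odd (i - off) by rewrite -iE /i0 addnK odd_double.
have hi : (i - off)./2 = (r - off)./2 by rewrite -iE /i0 addnK doubleK.
have hi1 : (i.+1 - off)./2 = (r - off)./2.
  by rewrite subSn // -hi -uphalfE uphalf_half (negbTE ei).
have iN' : (i < N.+1)%N by apply: ltnW.
have i1N' : (i.+1 < N.+1)%N by [].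
have pb u : (u == i) || (u == i.+1) -> pairblk off N beta u r =
    Theta (beta i) (odd (u - off)) (odd (r - off)).
  move=> ui; have [offu hu] : (off <= u)%N /\ (u - off)./2 = (r - off)./2.
    by case/orP: ui => /eqP ->; split=> //; exact: leqW.
  by rewrite /pairblk offu offr hu eqxx -/(i0 r) iE iN.
have pb0 u : u != i -> u != i.+1 -> pairblk off N beta u r = 0.
  move=> ui ui1; rewrite /pairblk.
  have hu : (off <= u)%N -> (u - off)./2 != (r - off)./2.
    move=> offu; rewrite -hi; apply: contraNneq ui => hh.
    have := odd_double_half (u - off); rewrite hh.
    have := odd_double_half (i - off); rewrite (negbTE ei) add0n => ->.
    case: (odd _) => /= E.
      by case/negP: ui1; rewrite -(subnK offu) -E add1n addSn subnK.
    by rewrite -(subnK offu) -E add0n subnK.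
  case: ifP => [/and4P[/hu/negbTE ->]//|_].
  case: eqP => // ur; exfalso; move: ui ui1; rewrite ur => ri ri1.
  by have := hu; rewrite ur => /(_ offr); rewrite eqxx.
have -> : \sum_(u < N.+1) adjm (pairblk off N beta u r) *m v u =
    adjm (Theta (beta i) false (odd (r - off))) *m v i +
    adjm (Theta (beta i) true (odd (r - off))) *m v i.+1.
  rewrite (bigD1 (Ordinal iN')) //= (bigD1 (Ordinal i1N')) /=; last first.
    by rewrite -val_eqE /= gtn_eqF.
  rewrite big1 ?addr0 => [|u].
    have pi : (i == i) || (i == i.+1) by rewrite eqxx.
    have pi1 : (i.+1 == i) || (i.+1 == i.+1) by rewrite eqxx orbT.
    by rewrite (pb _ pi) (pb _ pi1) (subSn offi) /= (negbTE ei).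
  by rewrite -!val_eqE /= => /andP[ui ui1]; rewrite pb0 // adjm0 mul0mx.
have [wi wi1] := pair i offi iN ei.
have [[hL _] [hR _] _ _] := beta_pos i.
have := odd_double_half (r - off); have := iE; rewrite /i0.
case: (odd (r - off)) => /= E rE.
  have -> : r = i.+1 by rewrite -E -addSn -add1n rE subnK.
  by rewrite wi1 hL adjmN mulNmx.
have -> : r = i by rewrite -E -[(_./2).*2]add0n rE subnK.
by rewrite wi adjmK hR.
Qed.

End CMVLayers.

(** * CMV bases *)

Section CMVBases.
Variables (R : realType) (d : nat) (nu : {measure set R -> \bar R}).
Variable W : R -> 'M[R[i]]_d.
Hypothesis (Hmu : is_mxmeasure nu W) (Hnt : nontrivial nu W).
Local Notation C := R[i].
Local Notation fn m := (R -> 'M[C]_(d, m)).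
Local Notation ip := (ip nu W).
Local Notation cip := (cip nu W).
Local Notation tp := (@tpow R d).
Local Notation lc := (lincomb tp).
Local Notation ph := (phi nu W).
Local Notation rph := (rphi nu W).
Local Notation f n := (schur_iter (schur_fun nu W) n).
Local Notation chif n := (fun th : R => chi nu W n (eit th)).
Local Notation xf n := (fun th : R => xcmv nu W n (eit th)).

Let bp := phi_bounded Hmu Hnt.
Let bs := rphi_bounded Hmu Hnt.

Definition ctmul e m (P : fn m) : fn m := fun th => conjc (eit th) ^+ e *: P th.

Lemma mbounded_ctmul e m (P : fn m) : mbounded P -> mbounded (ctmul e P).
Proof. by apply: mboundedZ; apply: cboundedX; apply: cbounded_conj; exact: cbounded_eit. Qed.

Lemma ctmulK e m (P : fn m) : tmul e (ctmul e P) = P.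
Proof.
apply: funext => th; rewrite tmulE /ctmul scalerA -exprMn eit_conj mulfV ?eit_neq0 //.
by rewrite expr1n scale1r.
Qed.

Lemma tmulK e m (P : fn m) : ctmul e (tmul e P) = P.
Proof.
apply: funext => th; rewrite /ctmul tmulE scalerA -exprMn eit_conj mulVf ?eit_neq0 //.
by rewrite expr1n scale1r.
Qed.

Lemma eit_unitX e th : (eit th : C) ^- e = conjc (eit th) ^+ e.
Proof. by rewrite eit_conj exprVn. Qed.

Lemma eit_conjV th : (conjc (eit th))^-1 = eit th :> C.
Proof. by rewrite eit_conj invrK. Qed.

(** The power [t^(floor(n/2))] clears the denominators of [chi_n]; for [x_n] the exponent is
    [ceil(n/2)]. Together with invariance of [ip] under common shifts, this reduces the CMV bases to
    [phi] and [rphi]. *)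
Lemma tmul_chi n : tmul n./2 (chif n) = if odd n then ph n else rph n.
Proof.
apply: funext => th; rewrite tmulE /chi; case: (boolP (odd n)) => on.
  by rewrite scalerA eit_unitX eit_conj -exprMn mulfV ?eit_neq0 // expr1n scale1r phiE.
rewrite scalerA -exprD addnn eit_conjV rphiE tmulE.
by have := odd_double_half n; rewrite (negbTE on) add0n => ->.
Qed.

Lemma tmul_xcmv n : tmul (uphalf n) (xf n) = if odd n then rph n else ph n.
Proof.
apply: funext => th; rewrite tmulE /xcmv uphalf_half; case: (boolP (odd n)) => on.
  rewrite scalerA -exprD -addnA addnn eit_conjV rphiE tmulE.
  by have := odd_double_half n; rewrite on => ->.
by rewrite add0n scalerA eit_unitX eit_conj -exprMn mulfV ?eit_neq0 // expr1n scale1r phiE.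
Qed.

Lemma chi_bounded n : mbounded (chif n).
Proof.
rewrite -[chif n](tmulK n./2) tmul_chi; apply: mbounded_ctmul.
by case: (odd n).
Qed.

Lemma xcmv_bounded n : mbounded (xf n).
Proof.
rewrite -[xf n](tmulK (uphalf n)) tmul_xcmv; apply: mbounded_ctmul.
by case: (odd n).
Qed.

Definition inspan n (P : fn d) := exists x : nat -> 'M[C]_d, P = lc n x.

Lemma inspan_le m n P : (m <= n)%N -> inspan m P -> inspan n P.
Proof.
move=> mn; rewrite -(subnK mn) => -[x ->].
elim: (n - m)%N => [|k [y ->]]; first by exists x.
by rewrite addSn; exists (fun i => if (i < k + m)%N then y i else 0); rewrite -lincomb_widen.
Qed.

Lemma inspan_tmul e n P : inspan n P -> inspan (e + n) (tmul e P).
Proof.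
move=> Pn; elim: e => [|e [x E]]; first by rewrite tmul0.
rewrite -add1n -tmul_tmul E add1n addSn tmul1_lincomb.
by exists (fun i => if i is j.+1 then x j else 0).
Qed.

Lemma inspan_phi n : inspan n.+1 (ph n).
Proof. by have [c [E _ _]] := phi_coef Hmu Hnt; exists (c n). Qed.

Lemma inspan_rphi n : inspan n.+1 (rph n).
Proof. by have [c [E _ _]] := rphi_coef_tpow Hmu Hnt; exists (c n). Qed.

Lemma ip_inspan_eq0 e n P (A : fn d) : mbounded A -> inspan n P ->
  (forall i, (i < n)%N -> ip (tp (e + i)) A = 0) -> ip (tmul e P) A = 0.
Proof.
move=> bA [x ->] A0; rewrite -[A](ctmulK e) ip_tmul.
apply: ip_lincomb_eq0 => //; first exact: tpow_bounded.
  exact: mbounded_ctmul.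
by move=> i i_n; rewrite -(ip_tmul _ _ e) ctmulK tmul_tpow A0.
Qed.

Lemma tmulC e1 e2 m (P : fn m) : tmul e1 (tmul e2 P) = tmul e2 (tmul e1 P).
Proof. by rewrite !tmul_tmul addnC. Qed.

(** The degree bound that admits [t^(floor(k/2)) chi_s], [s <= k], as second entry in the bracket
    identity for [f_k]. *)
Lemma inspan_chi k s : (s <= k)%N -> inspan k.+1 (tmul k./2 (chif s)).
Proof.
move=> sk; have h := half_leq sk.
rewrite -(subnK h) -tmul_tmul tmul_chi.
have sp : inspan s.+1 (if odd s then ph s else rph s).
  by case: (odd s); [exact: inspan_phi | exact: inspan_rphi].
apply: inspan_le (inspan_tmul _ sp).
rewrite addnS ltnS; have := odd_double_half s; have := odd_double_half k.
have := uphalf_leq sk; rewrite !uphalf_half.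
case: (odd s); case: (odd k) => /=; lia.
Qed.

Lemma inspan_xcmv k s : (s <= k)%N -> inspan k.+1 (tmul (uphalf k) (xf s)).
Proof.
move=> sk; have h := uphalf_leq sk.
rewrite -(subnK h) -tmul_tmul tmul_xcmv.
have sp : inspan s.+1 (if odd s then rph s else ph s).
  by case: (odd s); [exact: inspan_rphi | exact: inspan_phi].
apply: inspan_le (inspan_tmul _ sp).
rewrite addnS ltnS; have := odd_double_half s; have := odd_double_half k.
have := half_leq sk; move: h; rewrite !uphalf_half.
case: (odd s); case: (odd k) => /=; lia.
Qed.

(** The orthogonality to [t, ..., t^j] required by the bracket identity for [b_j]. After a common
    shift it pairs [phi_s] or [phi*_s] with a power of [t] inside its range of orthogonality. *)
Lemma chi_orth j s l : (j <= s)%N -> (0 < l <= j)%N ->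
  ip (tp l) (tmul (uphalf j) (chif s)) = 0.
Proof.
move=> js /andP[l0 lj]; rewrite -(ip_tmul _ _ s./2) tmul_tpow tmulC tmul_chi.
have h1 := half_leq js; have h2 := uphalf_leq js.
have := odd_double_half s; have := odd_double_half j; move: h2; rewrite !uphalf_half.
move=> h2 ej es.
have le : (odd j + j./2 <= s./2 + l)%N by move: h2 ej es; case: (odd s); case: (odd j) => /=; lia.
rewrite -(subnKC le) -tmul_tpow ip_tmul.
case: (boolP (odd s)) es => os /= es.
  by apply: phi_orth => //; move: h2 ej es le; case: (odd j) => /=; lia.
by apply: rphi_orth => //; move: h2 ej es le; case: (odd j) => /=; lia.
Qed.

Lemma xcmv_orth j s l : (j <= s)%N -> (0 < l <= j)%N ->
  ip (tp l) (tmul j./2.+1 (xf s)) = 0.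
Proof.
move=> js /andP[l0 lj]; rewrite -(ip_tmul _ _ (uphalf s)) tmul_tpow tmulC tmul_xcmv.
have h1 := half_leq js; have := uphalf_leq js.
have := odd_double_half s; have := odd_double_half j; rewrite !uphalf_half.
move=> ej es h2.
have le : (j./2.+1 <= odd s + s./2 + l)%N by move: h2 ej es; case: (odd s); case: (odd j) => /=; lia.
rewrite -(subnKC le) -tmul_tpow ip_tmul.
case: (boolP (odd s)) es le => os /= es le.
  by apply: rphi_orth => //; move: h2 ej es le; case: (odd j) => /=; lia.
by apply: phi_orth => //; move: h2 ej es le; case: (odd j) => /=; lia.
Qed.

(** For [u < v] a shift by [t^(floor(v/2))] turns [chi_v] into [phi_v] or [phi*_v], and [chi_u] into
    a combination of powers to which that polynomial is orthogonal. *)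
Lemma chi_ortho r s : ip (chif r) (chif s) = if r == s then 1%:M else 0.
Proof.
have lt u v : (u < v)%N -> ip (chif u) (chif v) = 0.
  move=> uv; rewrite -(ip_tmul _ _ v./2) tmul_chi.
  have h := half_leq (ltnW uv); rewrite -(subnK h) -tmul_tmul tmul_chi.
  have h2 := half_leq uv; rewrite /= uphalf_half in h2.
  have := odd_double_half u; have := odd_double_half v.
  case: (boolP (odd v)) => ov /= ev; case: (boolP (odd u)) h2 => ou /= h2 eu;
    apply: (@ip_inspan_eq0 _ u.+1) => //; try exact: inspan_phi; try exact: inspan_rphi;
    move=> i i_u; (apply: phi_orth => //; lia) || (apply: rphi_orth => //; lia).
case: ltngtP => [/lt //|sr|->]; last first.
  rewrite -(ip_tmul _ _ s./2) tmul_chi; case: (odd s); last exact: ip_rphi.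
  by rewrite ip_phi // eqxx.
by rewrite -ip_adj ?lt ?adjm0 //; exact: chi_bounded.
Qed.

Lemma xcmv_ortho r s : ip (xf r) (xf s) = if r == s then 1%:M else 0.
Proof.
have lt u v : (u < v)%N -> ip (xf u) (xf v) = 0.
  move=> uv; rewrite -(ip_tmul _ _ (uphalf v)) tmul_xcmv.
  have h := uphalf_leq (ltnW uv); rewrite -(subnK h) -tmul_tmul tmul_xcmv.
  have h2 := half_leq uv; rewrite /= uphalf_half in h2.
  have := odd_double_half u; have := odd_double_half v; move: h; rewrite !uphalf_half.
  case: (boolP (odd v)) => ov /=; case: (boolP (odd u)) h2 => ou /= h2 h ev eu;
    apply: (@ip_inspan_eq0 _ u.+1) => //; try exact: inspan_phi; try exact: inspan_rphi;
    move=> i i_u; (apply: phi_orth => //; lia) || (apply: rphi_orth => //; lia).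
case: ltngtP => [/lt //|sr|->]; last first.
  rewrite -(ip_tmul _ _ (uphalf s)) tmul_xcmv; case: (odd s); first exact: ip_rphi.
  by rewrite ip_phi // eqxx.
by rewrite -ip_adj ?lt ?adjm0 //; exact: xcmv_bounded.
Qed.

Variable g : nat -> 'M[C]_d.
Hypothesis gP : forall n, [/\ defect_pos (g n),
  tmul 1 (ph n) = rmul (rph n) (adjm (g n)) + rmul (ph n.+1) (rhoR (g n))
  & rph n.+1 = rmul (rph n) (rhoL (g n)) - rmul (ph n.+1) (g n)].

Let g_pos n : defect_pos (g n). Proof. by have [] := gP n. Qed.

Variable z : C.
Hypothesis z1 : `|z| < 1.

(** With [A = t A'], orthogonality gives [<phi*_j, A>_z = z <phi*_j, A'>_z = z b_j <phi_j, A'>_z].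
    The recursion at [A'] then expresses [<phi_j, A'>_z] through [<phi_(j+1), A>_z] by inverting
    [1 - z g b_j], which is exactly [inv_step]. *)
Lemma binv_cip j p (A : fn p) : mbounded A ->
  (forall l, (0 < l <= j)%N -> ip (tp l) A = 0) ->
  cip z (rph j) A = binv g j z *m cip z (ph j) A.
Proof.
elim: j p A => [|j IHj] p A bA A0; first by rewrite rphi0 // phi0 // mul1mx.
pose A' := ctmul 1 A; have AE : tmul 1 A' = A by exact: ctmulK.
have bA' : mbounded A' by exact: mbounded_ctmul.
have A'0 l : (l <= j)%N -> ip (tp l) A' = 0.
  by move=> lj; rewrite -(ip_tmul _ _ 1) AE tmul_tpow A0.
have IH : cip z (rph j) A' = binv g j z *m cip z (ph j) A'.
  by apply: IHj => // l /andP[_]; exact: A'0.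
have S0 : ip (rph j) A' = 0.
  have [s [-> _ _]] := rphi_coef_tpow Hmu Hnt.
  by apply: ip_lincomb_eq0 => //; exact: tpow_bounded.
have E0 : cip z (rph j) A = z *: (binv g j z *m cip z (ph j) A').
  by rewrite -{1}AE cip_tmul // S0 addr0 IH.
have E1 := cip_phi Hmu Hnt gP j z1 bA'; rewrite AE E0 in E1.
rewrite (cip_rphi Hmu Hnt gP j z1 bA) E0 /=.
have Ku := binv_pivot_unit g_pos j (ltW z1).
move: E1 Ku; move: (binv g j z) (cip z (ph j) A') (cip z (ph j.+1) A) => b q u E1 Ku.
have qE : q = invmx (1%:M - z *: (g j *m b)) *m (rhoR (g j) *m u).
  rewrite -[LHS](mulKmx Ku); congr (_ *m _).
  by rewrite mulmxBl mul1mx {1}E1 -scalemxAr -scalemxAl mulmxA addrC addKr.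
rewrite qE /inv_step mulmxDl mulNmx addrC -scalemxAr; congr (_ + _).
by rewrite -scalemxAl !mulmxA.
Qed.

(** Pairs with even lower index lead from [chi], with a factor [t], to [x]; pairs with odd lower
    index lead from [x] to [chi] without it. Alternating the two gives multiplication by [t]. *)
Lemma cmv_even k p (A : fn p) : mbounded A -> ~~ odd k ->
  cip z (xf k) A = g k *m cip z (chif k) (tmul 1 A) + rhoR (g k) *m cip z (chif k.+1) (tmul 1 A) /\
  cip z (xf k.+1) A =
    rhoL (g k) *m cip z (chif k) (tmul 1 A) - adjm (g k) *m cip z (chif k.+1) (tmul 1 A).
Proof.
move=> bA ek; have bt e : mbounded (tmul e A) by exact: mbounded_tmul.
have h0 : uphalf k = k./2 by rewrite uphalf_half (negbTE ek).
have e0 : cip z (xf k) A = cip z (ph k) (tmul k./2 A).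
  by rewrite -(cip_tmul2 nu W z k./2) -h0 tmul_xcmv (negbTE ek).
have e1 : cip z (chif k) (tmul 1 A) = cip z (rph k) (tmul k./2.+1 A).
  by rewrite -(cip_tmul2 nu W z k./2) tmul_chi (negbTE ek) tmul_tmul addn1.
have e2 : cip z (chif k.+1) (tmul 1 A) = cip z (ph k.+1) (tmul k./2.+1 A).
  rewrite -(cip_tmul2 nu W z k.+1./2) tmul_chi /= (negbTE ek) tmul_tmul addn1.
  by rewrite -/(uphalf k) h0.
have e3 : cip z (xf k.+1) A = cip z (rph k.+1) (tmul k./2.+1 A).
  by rewrite -(cip_tmul2 nu W z (uphalf k.+1)) tmul_xcmv /= (negbTE ek).
rewrite e0 e1 e2 e3 (cip_phi Hmu Hnt gP _ z1 (bt _)) (cip_rphi Hmu Hnt gP _ z1 (bt _)).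
by rewrite tmul_tmul add1n.
Qed.

Lemma cmv_odd k p (A : fn p) : mbounded A -> odd k ->
  cip z (chif k) A = g k *m cip z (xf k) A + rhoR (g k) *m cip z (xf k.+1) A /\
  cip z (chif k.+1) A = rhoL (g k) *m cip z (xf k) A - adjm (g k) *m cip z (xf k.+1) A.
Proof.
move=> bA ok; have bt e : mbounded (tmul e A) by exact: mbounded_tmul.
have h0 : uphalf k = k./2.+1 by rewrite uphalf_half ok.
have e0 : cip z (chif k) A = cip z (ph k) (tmul k./2 A).
  by rewrite -(cip_tmul2 nu W z k./2) tmul_chi ok.
have e1 : cip z (xf k) A = cip z (rph k) (tmul k./2.+1 A).
  by rewrite -(cip_tmul2 nu W z (uphalf k)) tmul_xcmv ok h0.
have e2 : cip z (xf k.+1) A = cip z (ph k.+1) (tmul k./2.+1 A).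
  by rewrite -(cip_tmul2 nu W z (uphalf k.+1)) tmul_xcmv /= ok.
have e3 : cip z (chif k.+1) A = cip z (rph k.+1) (tmul k./2.+1 A).
  rewrite -(cip_tmul2 nu W z k.+1./2) tmul_chi /= ok /=.
  by rewrite -/(uphalf k) h0.
rewrite e0 e1 e2 e3 (cip_phi Hmu Hnt gP _ z1 (bt _)) (cip_rphi Hmu Hnt gP _ z1 (bt _)).
by rewrite tmul_tmul add1n.
Qed.

(** Truncation at [k] cuts the pair [(k, k + 1)], so the parity of [k] decides which of the two
    layers loses its right partner. *)
Lemma cmv_right k (A : fn d) : z != 0 -> inspan k.+1 (tmul k./2 A) ->
  if odd k then cip z (chif k) A = f k z *m cip z (xf k) A
  else cip z (xf k) A = f k z *m cip z (chif k) (tmul 1 A).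
Proof.
move=> z0 [x xE]; have h := schur_iter_cip Hmu Hnt gP k x z0 z1.
rewrite -xE tmul_tmul add1n in h.
have hk := uphalf_half k; case: (boolP (odd k)) hk => ok /= hk.
  have -> : cip z (chif k) A = cip z (ph k) (tmul k./2 A).
    by rewrite -(cip_tmul2 nu W z k./2) tmul_chi ok.
  by rewrite h -(cip_tmul2 nu W z (uphalf k) (xf k)) tmul_xcmv ok hk.
have -> : cip z (xf k) A = cip z (ph k) (tmul k./2 A).
  by rewrite -(cip_tmul2 nu W z (uphalf k)) tmul_xcmv (negbTE ok) hk.
by rewrite h -(cip_tmul2 nu W z k./2 (chif k)) tmul_chi (negbTE ok) tmul_tmul addn1.
Qed.

(** Here the cut pair is [(j - 1, j)]; an odd [j] belongs to the layer of even lower indices. *)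
Lemma cmv_left j (A : fn d) : mbounded A ->
  (forall l, (0 < l <= j)%N -> ip (tp l) (tmul (uphalf j) A) = 0) ->
  if odd j then cip z (xf j) A = binv g j z *m cip z (chif j) (tmul 1 A)
  else cip z (chif j) A = binv g j z *m cip z (xf j) A.
Proof.
move=> bA A0; have bt : mbounded (tmul (uphalf j) A) by exact: mbounded_tmul.
have h := binv_cip bt A0.
have hj := uphalf_half j; case: (boolP (odd j)) hj => oj /= hj.
  have -> : cip z (xf j) A = cip z (rph j) (tmul (uphalf j) A).
    by rewrite -(cip_tmul2 nu W z (uphalf j)) tmul_xcmv oj.
  by rewrite h -(cip_tmul2 nu W z j./2 (chif j)) tmul_chi oj tmul_tmul addn1 hj.
have -> : cip z (chif j) A = cip z (rph j) (tmul (uphalf j) A).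
  by rewrite -(cip_tmul2 nu W z j./2) tmul_chi (negbTE oj) hj.
by rewrite h -(cip_tmul2 nu W z (uphalf j) (xf j)) tmul_xcmv (negbTE oj).
Qed.

End CMVBases.

(** * The Schur functions of the truncations *)

Section CMVAssembly.
Variables (R : realType) (d : nat).
Local Notation C := R[i].

(** All cases of the statement at once: [e] tells whether the finite CMV matrix is the hatted one,
    that is, [odd j] for [chi] and [~~ odd j] for [x], while the parity of [N = k - j] supplies that
    of [k]. *)
Definition cmv_rhs (e : bool) N (beta : nat -> 'M[C]_d) (b f : 'M[C]_d) : 'M[C]_(N.+1 * d) :=
  let B1 := dsum N.+1 d (fun r => if r == 0%N then b else 1%:M) in
  let F1 := dsum N.+1 d (fun r => if r == N then f else 1%:M) in
  let BF := dsum N.+1 d (fun r => if r == 0%N then b else if r == N then f else 1%:M) in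
  if e then if odd N then adjm (CMVhatfin N beta) *m BF
            else F1 *m adjm (CMVhatfin N beta) *m B1
  else if odd N then BF *m adjm (CMVfin N beta)
       else B1 *m adjm (CMVfin N beta) *m F1.

Lemma layer_blk off N (beta : nat -> 'M[C]_d) (b f : 'M[C]_d) (v w : nat -> nat -> 'M[C]_d) :
  (off <= 1)%N -> (forall i, defect_pos (beta i)) ->
  (forall s, (s <= N)%N -> [/\
    forall i, (off <= i)%N -> (i.+1 <= N)%N -> ~~ odd (i - off) ->
      w i s = beta i *m v i s + rhoR (beta i) *m v i.+1 s /\
      w i.+1 s = rhoL (beta i) *m v i s - adjm (beta i) *m v i.+1 s,
    off = 1%N -> w 0%N s = b *m v 0%N s
    & (off <= N)%N -> ~~ odd (N - off) -> w N s = f *m v N s]) ->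
  blk N.+1 d w = dsum N.+1 d (layer_ends off N b f) *m
    (adjm (blk N.+1 d (pairblk off N beta)) *m blk N.+1 d v).
Proof.
move=> off1 bpos lay; rewrite adjm_blk blkM dsum_blk; apply: eq_blk => r s rN sN.
have [h1 h2 h3] := lay s sN.
exact: (@layerP _ _ off N beta off1 bpos b f (v ^~ s) (w ^~ s)).
Qed.

Lemma layer_ends_comm off N (beta : nat -> 'M[C]_d) (b f : 'M[C]_d) : (off <= 1)%N ->
  dsum N.+1 d (layer_ends off N b f) *m adjm (blk N.+1 d (pairblk off N beta)) =
  adjm (blk N.+1 d (pairblk off N beta)) *m dsum N.+1 d (layer_ends off N b f).
Proof.
move=> off1; rewrite adjm_blk dsum_blk blk_dsum; apply: eq_blk => r s rN sN.
exact: layer_endsC.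
Qed.

Lemma dsum1 N (D : nat -> 'M[C]_d) : (forall r, (r < N)%N -> D r = 1%:M) ->
  dsum N d D = 1%:M.
Proof.
by move=> D1; rewrite -(blk1 R N d); apply: eq_blk => r s rN sN; case: eqP => // _; rewrite D1.
Qed.

Lemma eq_dsum N (D D' : nat -> 'M[C]_d) : (forall r, (r < N)%N -> D r = D' r) ->
  dsum N d D = dsum N d D'.
Proof. by move=> DD; apply: eq_blk => r s rN sN; rewrite DD. Qed.

(** [b] always sits in the layer of offset 1; [f] sits in the layer of offset 0 or 1 according as
    [N] is even or odd. Moving the end factors of the right-hand layer past it gives the four
    products. *)
Lemma cmv_rhsE (e : bool) N (beta : nat -> 'M[C]_d) (b f : 'M[C]_d) :
  cmv_rhs e N beta b f =
  dsum N.+1 d (layer_ends (~~ e) N b f) *m adjm (blk N.+1 d (pairblk (~~ e) N beta)) *m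
  (dsum N.+1 d (layer_ends e N b f) *m adjm (blk N.+1 d (pairblk e N beta))).
Proof.
rewrite [in RHS](@layer_ends_comm e) ?leq_b1 //.
have o1 : (1 <= N)%N && ~~ odd (N - 1) = odd N by case: (N) => // n; rewrite subn1.
have L1 r : layer_ends 1 N b f r = if r == 0%N then b else
    if (r == N) && odd N then f else 1%:M by rewrite /layer_ends o1.
have L0 r : layer_ends 0 N b f r = if (r == N) && ~~ odd N then f else 1%:M.
  by rewrite /layer_ends subn0 leq0n.
pose B1 := dsum N.+1 d (fun r => if r == 0%N then b else 1%:M).
pose F1 := dsum N.+1 d (fun r => if r == N then f else 1%:M).
pose BF := dsum N.+1 d (fun r => if r == 0%N then b else if r == N then f else 1%:M).
have E1 : dsum N.+1 d (layer_ends 1 N b f) = if odd N then BF else B1.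
  by case: (boolP (odd N)) L1 => oN L1; apply: eq_dsum => r _; rewrite L1 ?andbT ?andbF.
have E0 : dsum N.+1 d (layer_ends 0 N b f) = if odd N then 1%:M else F1.
  case: (boolP (odd N)) L0 => oN L0; first by apply: dsum1 => r _; rewrite L0 andbF.
  by apply: eq_dsum => r _; rewrite L0 andbT.
rewrite /cmv_rhs -/B1 -/F1 -/BF /CMVhatfin /CMVfin /Lmat /Mmat !adjmM.
clearbody B1 F1 BF; case: e => /=; rewrite E1 E0.
  by case: (odd N); rewrite ?mul1mx !mulmxA.
by case: (odd N); rewrite ?mulmx1 !mulmxA.
Qed.

Lemma has_limz_cst m n (A : 'M[C]_(m, n)) (z0 : C) : has_limz (fun=> A) z0 A.
Proof. by move=> e e0; exists 1 => // w _ _ a b; rewrite subrr normr0 ltcR. Qed.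

Lemma has_limz_nrm m n (h : C -> 'M[C]_(m, n)) (z0 : C) L (e : R) : has_limz h z0 L -> 0 < e ->
  exists2 del : R, 0 < del &
    forall w, w != z0 -> `|w - z0| < del%:C%C -> nrm (h w - L) < e%:C%C.
Proof.
(* The summand 1 keeps [c] positive when the matrices are empty. *)
move=> hL e0; pose c : R := (m * n)%:R + 1.
have c0 : 0 < c by rewrite ltr_wpDl.
have [|r r0 rP] := hL (e / c); first by rewrite divr_gt0.
exists r => // w wz wr.
apply: le_lt_trans (_ : \sum_(a < m) \sum_(b < n) (e / c)%:C%C < _).
  apply: ler_sum => a _; apply: ler_sum => b _; rewrite !mxE; apply: ltW.
  by apply: rP.
rewrite !sumr_const !card_ord -mulrnA -[X in X *+ _]/((e / c)%:C%C) -(rmorphMn (real_complex R)).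
rewrite ltcR -mulr_natr -mulrA gtr_pMr // mulrC ltr_pdivrMr // mul1r mulnC.
by rewrite /c ltrDl ltr01.
Qed.

Lemma has_limzM m n p (h1 : C -> 'M[C]_(m, n)) (h2 : C -> 'M[C]_(n, p)) (z0 : C) L1 L2 :
  has_limz h1 z0 L1 -> has_limz h2 z0 L2 -> has_limz (fun w => h1 w *m h2 w) z0 (L1 *m L2).
Proof.
move=> l1 l2 e e0.
have [K K0 KE] : exists2 K : R, 0 < K & nrm L1 + nrm L2 + 1 = K%:C%C.
  by apply: real_of_pos; rewrite ltr_wpDl ?addr_ge0 ?nrm_ge0.
(* With both errors below [c <= 1], the error of the product is below
   [c + c |L2| + c |L1| = c K <= e]. *)
pose c := Num.min 1 (e / K).
have c0 : 0 < c by rewrite lt_min ltr01 divr_gt0.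
have [r1 r10 h1P] := has_limz_nrm l1 c0; have [r2 r20 h2P] := has_limz_nrm l2 c0.
exists (Num.min r1 r2); first by rewrite lt_min r10.
move=> w wz wr a b.
have {h1P} n1 : nrm (h1 w - L1) < c%:C%C.
  by apply: h1P => //; apply: lt_le_trans wr _; rewrite lecR ge_min lexx.
have {h2P} n2 : nrm (h2 w - L2) < c%:C%C.
  by apply: h2P => //; apply: lt_le_trans wr _; rewrite lecR ge_min lexx orbT.
apply: le_lt_trans (_ : nrm (h1 w *m h2 w - L1 *m L2) < _).
  by have := le_nrm (h1 w *m h2 w - L1 *m L2) a b; rewrite mxE [X in _ + X]mxE.
move: (h1 w) (h2 w) n1 n2 => A B n1 n2.
have -> : A *m B - L1 *m L2 = (A - L1) *m (B - L2) + (A - L1) *m L2 + L1 *m (B - L2).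
  by rewrite -mulmxDr subrK mulmxBl mulmxBr addrA subrK.
have cC : 0 < c%:C%C :> C by rewrite ltcR.
have c1 : c%:C%C <= 1 :> C by rewrite -[1]/(1%:C%C) lecR ge_min lexx.
have [g1 g2] := (nrm_ge0 L1, nrm_ge0 L2).
have ce : c%:C%C * K%:C%C <= e%:C%C :> C.
  by rewrite -rmorphM lecR -ler_pdivlMr // ge_min lexx orbT.
have ce' : c%:C%C + c%:C%C * nrm L2 + c%:C%C * nrm L1 <= e%:C%C.
  by apply: le_trans ce; rewrite -KE le_eqVlt; apply/orP; left; apply/eqP; ring.
apply: lt_le_trans ce'; apply: le_lt_trans (nrmD _ _) _.
apply: ltr_leD; last first.
  by rewrite (le_trans (nrmM _ _)) // mulrC ler_wpM2r // ltW.
apply: le_lt_trans (nrmD _ _) _; apply: ltr_leD; last first.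
  by rewrite (le_trans (nrmM _ _)) // ler_wpM2r // ltW.
apply: le_lt_trans (nrmM _ _) _.
apply: le_lt_trans (ler_wpM2r (nrm_ge0 _) (ltW n1)) _.
by apply: le_lt_trans n2; rewrite ler_piMl ?nrm_ge0.
Qed.

Lemma has_limz_dsum N (P Q : pred nat) (b f : C -> 'M[C]_d) (z0 : C) b0 f0 :
  has_limz b z0 b0 -> has_limz f z0 f0 ->
  has_limz (fun w => dsum N d (fun r => if P r then b w else if Q r then f w else 1%:M)) z0
    (dsum N d (fun r => if P r then b0 else if Q r then f0 else 1%:M)).
Proof.
move=> lb lf e e0; have [r1 r10 bP] := lb e e0; have [r2 r20 fP] := lf e e0.
exists (Num.min r1 r2); first by rewrite lt_min r10.
move=> w wz wr a a'; rewrite !blkE.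
case: eqP => _; last by rewrite subrr normr0 ltcR.
case: (P _).
  by apply: bP => //; apply: lt_le_trans wr _; rewrite lecR ge_min lexx.
case: (Q _); last by rewrite subrr normr0 ltcR.
by apply: fP => //; apply: lt_le_trans wr _; rewrite lecR ge_min lexx orbT.
Qed.

Lemma has_limz_cmv_rhs e N beta (b f : C -> 'M[C]_d) (z0 : C) b0 f0 :
  has_limz b z0 b0 -> has_limz f z0 f0 ->
  has_limz (fun w => cmv_rhs e N beta (b w) (f w)) z0 (cmv_rhs e N beta b0 f0).
Proof.
move=> lb lf; rewrite /cmv_rhs /=.
have lB := has_limz_dsum N.+1 (pred1 0%N) pred0 lb lf.
have lF := has_limz_dsum N.+1 pred0 (pred1 N) lb lf.
have lBF := has_limz_dsum N.+1 (pred1 0%N) (pred1 N) lb lf.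
have lc A : has_limz (fun=> A : 'M[C]_(N.+1 * d)) z0 A by exact: has_limz_cst.
case: e; case: (odd N).
- exact: has_limzM (lc _) lBF.
- exact: has_limzM (has_limzM lF (lc _)) lB.
- exact: has_limzM lBF (lc _).
- exact: has_limzM (has_limzM lB (lc _)) lF.
Qed.

End CMVAssembly.

(** * From bracket matrices to Schur functions *)

Section SchurFunctionsOfTruncations.
Variables (R : realType) (d : nat) (nu : {measure set R -> \bar R}).
Variable W : R -> 'M[R[i]]_d.
Hypothesis (Hmu : is_mxmeasure nu W) (Hnt : nontrivial nu W).
Local Notation C := R[i].
Local Notation fn m := (R -> 'M[C]_(d, m)).
Local Notation ip := (ip nu W).
Local Notation cip := (cip nu W).
Local Notation f n := (schur_iter (schur_fun nu W) n).
Local Notation chif n := (fun th : R => chi nu W n (eit th)).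
Local Notation xf n := (fun th : R => xcmv nu W n (eit th)).

(** Orthonormality gives [H = 1 + z G]; with [G = M H] this reads [(1 - z M) H = 1], so [H] is
    invertible and [G H^-1 = M]. *)
Lemma schur_fun_blk N (X : nat -> fn d) (M : 'M[C]_(N.+1 * d)) z : z != 0 -> `|z| < 1 ->
  (forall r, mbounded (X r)) ->
  (forall r s, ip (X r) (X s) = if r == s then 1%:M else 0) ->
  blk N.+1 d (fun r s => cip z (X r) (X s)) =
    M *m blk N.+1 d (fun r s => cip z (X r) (tmul 1 (X s))) ->
  schur_fun nu (fun th => blk N.+1 d (fun r s => adjm (X r th) *m W th *m X s th)) z = M.
Proof.
move=> z0 z1 bX oX GE.
set G := blk N.+1 d (fun r s => cip z (X r) (X s)) in GE.
set H := blk N.+1 d (fun r s => cip z (X r) (tmul 1 (X s))) in GE.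
have HE : H = 1%:M + z *: G.
  rewrite -blk1 blkZ blkD; apply: eq_blk => r s _ _.
  by rewrite cip_tmul // oX addrC.
have Hu : H \in unitmx.
  have : (1%:M - z *: M) *m H = 1%:M.
    by rewrite mulmxBl mul1mx -scalemxAl -GE {1}HE addrK.
  by case/mulmx1_unit.
rewrite /schur_fun extend0E // (schur_raw z0 Hu HE); first by rewrite GE mulmxK.
rewrite -blk1 blkZ blkB; apply/matrixP => a b.
rewrite mintE blkE -oX.
rewrite -(caraF_pair Hmu z1 (bX _) (bX _)) mintE; apply: eq_cint => th _.
by rewrite mxE blkE [RHS]mxE.
Qed.

Variable g : nat -> 'M[C]_d.
Hypothesis gP : forall n, [/\ defect_pos (g n),
  tmul 1 (phi nu W n) = rmul (rphi nu W n) (adjm (g n)) + rmul (phi nu W n.+1) (rhoR (g n))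
  & rphi nu W n.+1 = rmul (rphi nu W n) (rhoL (g n)) - rmul (phi nu W n.+1) (g n)].

Let g_pos n : defect_pos (g n). Proof. by have [] := gP n. Qed.

Lemma schur_fun_chi j k z : (j <= k)%N -> z != 0 -> `|z| < 1 ->
  schur_fun nu (W_jk nu W j k) z =
  cmv_rhs (odd j) (k - j) (fun i => g (j + i)) (binv g j z) (f k z).
Proof.
move=> jk z0 z1; rewrite /W_jk; set N := (k - j)%N.
have bX n := chi_bounded Hmu Hnt n.
have jN : (j + N = k)%N by rewrite subnKC.
apply: (@schur_fun_blk N (fun r => chif (j + r))) => //.
  by move=> r s; rewrite chi_ortho // eqn_add2l.
(* The matrix between the layers: pairs of even lower index lead from [<chi_r, t chi_s>_z] to [q],
   those of odd lower index from [q] to [<chi_r, chi_s>_z]. *)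
pose q r s := cip z (xf (j + r)) (chif (j + s)).
rewrite cmv_rhsE -!mulmxA.
rewrite -(@layer_blk _ _ (odd j) N _ _ _ _ q (leq_b1 _) (fun i => g_pos (j + i))); last first.
  move=> s sN; split.
  - move=> i ji iN oi; rewrite /q; cbv beta; rewrite addnS; apply: (cmv_even Hmu Hnt gP z1) => //.
    by move: oi; rewrite oddB // oddD oddb addbC.
  - move=> oj; have {}oj : odd j by case: (odd j) oj.
    have := @cmv_left _ _ _ _ Hmu Hnt g gP z z1 j (chif (j + s)) (bX _).
    rewrite oj /q; cbv beta; rewrite addn0; apply => l lj.
    by apply: chi_orth => //; exact: leq_addr.
  - move=> oN eN; have ek : ~~ odd k.
      by move: eN; rewrite -jN oddB // oddD oddb addbC.
    have := @cmv_right _ _ _ _ Hmu Hnt g gP z z1 k (chif (j + s)) z0.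
    rewrite (negbTE ek) /q; cbv beta; rewrite jN; apply.
    by apply: inspan_chi => //; rewrite -jN leq_add2l.
apply: layer_blk => [||s sN]; [exact: leq_b1 | by move=> i; exact: g_pos | split].
- move=> i ji iN oi; rewrite /q; cbv beta; rewrite addnS; apply: (cmv_odd Hmu Hnt gP z1) => //.
  by move: oi; rewrite oddB // oddD oddb; case: (odd i); case: (odd j).
- move=> oj; have {}oj : ~~ odd j by case: (odd j) oj.
  have := @cmv_left _ _ _ _ Hmu Hnt g gP z z1 j (chif (j + s)) (bX _).
  rewrite (negbTE oj) /q; cbv beta; rewrite addn0; apply => l lj.
  by apply: chi_orth => //; exact: leq_addr.
- move=> oN eN; have ok : odd k.
    by move: eN; rewrite -jN oddB // oddD oddb; case: (odd N); case: (odd j).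
  have := @cmv_right _ _ _ _ Hmu Hnt g gP z z1 k (chif (j + s)) z0.
  rewrite ok /q; cbv beta; rewrite jN; apply.
  by apply: inspan_chi => //; rewrite -jN leq_add2l.
Qed.

Lemma schur_fun_xcmv j k z : (j <= k)%N -> z != 0 -> `|z| < 1 ->
  schur_fun nu (What_jk nu W j k) z =
  cmv_rhs (~~ odd j) (k - j) (fun i => g (j + i)) (binv g j z) (f k z).
Proof.
move=> jk z0 z1; rewrite /What_jk; set N := (k - j)%N.
have bX n := xcmv_bounded Hmu Hnt n.
have btX n : mbounded (tmul 1 (xf n)) by exact: mbounded_tmul.
have jN : (j + N = k)%N by rewrite subnKC.
apply: (@schur_fun_blk N (fun r => xf (j + r))) => //.
  by move=> r s; rewrite xcmv_ortho // eqn_add2l.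
(* For the basis [x] the two layers act in the opposite order, so the intermediate matrix carries
   the factor [t]. *)
pose q r s := cip z (chif (j + r)) (tmul 1 (xf (j + s))).
(* The left end falls in the layer whose second entry carries [t] exactly when [j] is even, and the
   total exponent is [floor(j/2) + 1] in both cases. In [span] the exponent is likewise [ceil(k/2)]
   for both parities. *)
have orth s l : (0 < l <= j)%N ->
    ip (@tpow R d l) (tmul (uphalf j) (tmul (~~ odd j) (xf (j + s)))) = 0.
  move=> lj; rewrite tmul_tmul uphalf_half -addnA addnC -addnA.
  have -> : (j./2 + (~~ odd j + odd j) = j./2.+1)%N by case: (odd j); rewrite addn1.
  by apply: xcmv_orth => //; exact: leq_addr.
have span s : (s <= N)%N -> inspan k.+1 (tmul k./2 (tmul (odd k) (xf (j + s)))).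
  move=> sN; rewrite tmul_tmul addnC -uphalf_half.
  by apply: inspan_xcmv => //; rewrite -jN leq_add2l.
rewrite cmv_rhsE negbK -!mulmxA.
rewrite -(@layer_blk _ _ (~~ odd j) N _ _ _ _ q (leq_b1 _) (fun i => g_pos (j + i))); last first.
  move=> s sN; split.
  - move=> i ji iN oi; rewrite /q; cbv beta; rewrite addnS; apply: (cmv_odd Hmu Hnt gP z1) => //.
    by move: oi; rewrite oddB // oddD oddb; case: (odd i); case: (odd j).
  - move=> oj; have {}oj : ~~ odd j by case: (odd j) oj.
    have := @cmv_left _ _ _ _ Hmu Hnt g gP z z1 j (tmul 1 (xf (j + s))) (btX _).
    rewrite (negbTE oj) /q; cbv beta; rewrite addn0; apply => l lj.
    by have := orth s l lj; rewrite oj.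
  - move=> oN eN; have ok : odd k.
      by move: eN; rewrite -jN oddB // oddD oddb; case: (odd N); case: (odd j).
    have := @cmv_right _ _ _ _ Hmu Hnt g gP z z1 k (tmul 1 (xf (j + s))) z0.
    rewrite ok /q; cbv beta; rewrite jN; apply; have := span s sN; rewrite ok; exact.
apply: layer_blk => [||s sN]; [exact: leq_b1 | by move=> i; exact: g_pos | split].
- move=> i ji iN oi; rewrite /q; cbv beta; rewrite addnS; apply: (cmv_even Hmu Hnt gP z1) => //.
  by move: oi; rewrite oddB // oddD oddb addbC.
- move=> oj; have {}oj : odd j by case: (odd j) oj.
  have := @cmv_left _ _ _ _ Hmu Hnt g gP z z1 j (xf (j + s)) (bX _).
  rewrite oj /q; cbv beta; rewrite addn0; apply => l lj.
  by have := orth s l lj; rewrite oj tmul0.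
- move=> oN eN; have ek : ~~ odd k.
    by move: eN; rewrite -jN oddB // oddD oddb addbC.
  have := @cmv_right _ _ _ _ Hmu Hnt g gP z z1 k (xf (j + s)) z0.
  rewrite (negbTE ek) /q; cbv beta; rewrite jN; apply; have := span s sN; rewrite (negbTE ek) tmul0; exact.
Qed.

(** Passage to [z = 0]: there the Schur function is by definition the limit of its values nearby,
    and the right-hand side is continuous because [b_j] and [f_k] are. *)
Lemma schur_fun_cmv_rhs N (V : R -> 'M[C]_(N.+1 * d)) e j k z : `|z| < 1 ->
  (forall w, w != 0 -> `|w| < 1 -> schur_fun nu V w =
     cmv_rhs e N (fun i => g (j + i)) (binv g j w) (f k w)) ->
  schur_fun nu V z = cmv_rhs e N (fun i => g (j + i)) (binv g j z) (f k z).
Proof.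
move=> z1 VE; have [->|z0] := eqVneq z 0; last exact: VE.
apply: extend0_0.
have lb : has_limz (binv g j) 0 (binv g j 0) by apply: binv_cont; rewrite ?normr0 ?ltr01.
have lf : has_limz (f k) 0 (f k 0).
  have := verb_schur_fun Hmu Hnt gP k; rewrite /verb => ->.
  exact: schur_iter_has_limz.
apply: eq_has_limz (has_limz_cmv_rhs e N _ lb lf); first exact: ltr01.
by move=> w w0; rewrite subr0 => w1; rewrite -VE // /schur_fun extend0E.
Qed.

End SchurFunctionsOfTruncations.

Theorem theorem4p4 (R : realType) (d : nat) (nu : {measure set R -> \bar R})
  (W : R -> 'M[R[i]]_d)
  (Hmu : is_mxmeasure nu W) (Hnt : nontrivial nu W)
  (j k : nat) (hjk : (j <= k)%N) (z : R[i]) (hz : `|z| < 1) :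
  let f := schur_fun nu W in
  let alpha := verb f in
  let fk := schur_iter f k z in
  let bj := schur_inv_iter f j z in
  let n := (k - j).+1 in
  (* b_j (+) 1_{k-j},  1_{k-j} (+) f_k,  b_j (+) 1_{k-j-1} (+) f_k *)
  let B1 := dsum n d (fun r => if r == 0%N then bj else 1%:M) in
  let F1 := dsum n d (fun r => if r == (k - j)%N then fk else 1%:M) in
  let BF := dsum n d (fun r => if r == 0%N then bj
                               else if r == (k - j)%N then fk else 1%:M) in
  let C := CMVtr alpha j k in
  let Ch := CMVhattr alpha j k in
  schur_fun nu (W_jk nu W j k) z =
    (if ~~ odd j && ~~ odd k then B1 *m adjm C *m F1
     else if odd j && odd k then F1 *m adjm C *m B1
     else if ~~ odd j then BF *m adjm C
     else adjm C *m BF)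
  /\
  schur_fun nu (What_jk nu W j k) z =
    (if odd j && odd k then B1 *m adjm Ch *m F1
     else if ~~ odd j && ~~ odd k then F1 *m adjm Ch *m B1
     else if odd j then BF *m adjm Ch
     else adjm Ch *m BF).
Proof.
move=> f alpha fk bj n B1 F1 BF C Ch.
have [g gP] := choice (szego Hmu Hnt).
have g_pos m : defect_pos (g m) by have [] := gP m.
have alphaE : alpha = g by apply: funext => m; exact: verb_schur_fun.
have bE : bj = binv g j z.
  by apply: schur_inv_iterE => // m; exact: verb_schur_fun.
(* [cmv_rhs] splits on the parity of [k - j], the statement on those of [j] and [k]. *)
have oN : odd (k - j) = odd k (+) odd j by rewrite oddB.
have h1 := schur_fun_cmv_rhs Hmu Hnt gP hz (fun w => schur_fun_chi Hmu Hnt gP hjk (z := w)).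
have h2 := schur_fun_cmv_rhs Hmu Hnt gP hz (fun w => schur_fun_xcmv Hmu Hnt gP hjk (z := w)).
rewrite h1 h2 /cmv_rhs oN -bE -/fk -/n -/B1 -/F1 -/BF.
rewrite /C /Ch /CMVtr /CMVhattr alphaE.
by case: (odd j); case: (odd k).
Qed.
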